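(* Consider on $\mathbb{R}_t\times\mathbb{R}_x$ the initial value problem $$-\partial_t^2\Phi-(\partial_t\Phi-2\partial_x\Phi)\,\partial_t\partial_x\Phi+2\big(2+(\partial_t\Phi-2\partial_x\Phi)\big)\partial_x^2\Phi=0,\qquad \big(\Phi(0,x),\partial_t\Phi(0,x)\big)=(0,-\arctan(x)).$$ (1) [Existence] There is a classical solution $\Phi_C$ of this problem on an open set $\Omega_C\subsetneq\mathbb{R}^{1+1}$ with $\Psi_C:=\partial_t\Phi_C-2\partial_x\Phi_C\in(-\frac{\pi}{2},\frac{\pi}{2})$. In particular, the acoustical metric $\mathbf{g}=\mathbf{g}(\Psi_C)$ is always a well-defined Lorentzian metric on $\Omega_C$. (2) [Uniqueness] $(\Omega_C,\Phi_C)$ is the unique maximal globally hyperbolic development (MGHD) of the data posed on $\{t=0\}\times\mathbb{R}$. (3) [Characterisation of the boundary] The boundary of the MGHD satisfies the following. (a) It is the disjoint union of a codimension $1$ submanifold $\mathcal{B}$ (the singular boundary), a codimension $2$ submanifold $\mathcal{S}$ (the initial singularity), and a codimension $1$ submanifold $\underline{\mathcal{C}}$ (the Cauchy horizon). Each of these is connected, and the boundary is connected. (b) Let $\mathscr{S}(z):=\big(t=1+z^2,\; x=(2-\arctan(z))(1+z^2)+z\big)$. Then $\mathcal{B}=\{\mathscr{S}(z)\mid z\in(0,\infty)\}$ and $\mathcal{S}=\mathscr{S}(0)$. (c) Both $\underline{\mathcal{C}}$ and $\mathcal{B}$ emanate from $\mathcal{S}$, in the sense that $\mathrm{cl}(\underline{\mathcal{C}})\setminus\underline{\mathcal{C}}=\mathcal{S}$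 and $\mathrm{cl}(\mathcal{B})\setminus\mathcal{B}=\mathcal{S}$, where $\mathrm{cl}(A)$ denotes the topological closure of $A$. (d) The solution $\Phi_C$ extends smoothly to $\underline{\mathcal{C}}$. (e) The solution $\Phi_C$ extends as a $C^{1,1/3}$ function on $\mathcal{S}$ and as a $C^{1,1/2}$ function on $\mathcal{B}$, and this regularity is sharp. Consequently, for any $p\in\mathcal{S}\cup\mathcal{B}$ and any sequence $\{p_n\}_{n=1}^\infty\subset\Omega_C$ with $p_n\to p$, one has $|\partial^2\Phi_C(p_n)|\to\infty$. (f) The acoustical metric $\mathbf{g}$ extends as a $C^{0,1/3}$, a $C^{0,1/2}$, and a smooth Lorentzian metric to $\mathcal{S}$, $\mathcal{B}$, and $\underline{\mathcal{C}}$, respectively (the extension is still denoted $\mathbf{g}$). Similarly, $L$ extends as a $C^{0,1/3}$ and a $C^{0,1/2}$ acoustically null vectorfield to $\mathcal{S}$ and $\mathcal{B}$, respectively. (g) The smooth vectorfield $\underline{L}$ is everywhere tangent to $\underline{\mathcal{C}}$, making the Cauchy horizon acoustically null with respect to the extended metric. Similarly, the extended vectorfield $L$ is everywhere tangent to $\mathcal{B}$, making the singular boundary intrinsically acoustically null with respect to the extended metric $\mathbf{g}$. (4) [Degeneracies along the singular boundary] Let $p\in\mathcal{B}$ and consider the backwards ODE initial value problem for the integral curves of the extended $L$: $\frac{d}{ds}\gamma(s)=L\circ\gamma(s)$, $\gamma(0)=p$. Then, for some $a>0$, this problem has two different solutions $\gamma_1,\gamma_2:(-a,0]\to\mathbb{R}^{1+1}$,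 where $\gamma_1((-a,0])\subset\mathcal{B}$ is the integral curve along the singular boundary emanating backwards from $p$, and $\gamma_2((-a,0))\subset\Omega_C$ is an integral curve in the MGHD whose smooth evolution terminates at $\gamma_2(0)=p\in\mathcal{B}$.
   Context: Points of $\mathbb{R}^{1+1}=\mathbb{R}_t\times\mathbb{R}_x$ are written $(t,x)$. For a function $\Phi$ put $\Psi:=\partial_t\Phi-2\partial_x\Phi$. The acoustical metric is $$\mathbf{g}=\mathbf{g}(\Psi)=-\frac{8(2+\Psi)}{(4+\Psi)^2}\,dt^2-\frac{2\Psi}{(4+\Psi)^2}\,(dt\otimes dx+dx\otimes dt)+\frac{4}{(4+\Psi)^2}\,dx^2$$ (for $\Psi\neq-4$); its inverse is the principal symbol of the wave equation. The characteristic vectorfields are $L:=\partial_t+(2+\Psi)\partial_x$ and $\underline{L}:=\partial_t-2\partial_x$; on $\Omega_C$ these are taken with $\Psi=\Psi_C$. A vector $X$ is timelike, null, or spacelike with respect to a Lorentzian metric $g$ if $g(X,X)<0$, $=0$, or $>0$, respectively; it is causal if it is timelike or null. ''Acoustically null'' means null with respect to $\mathbf{g}$. A hypersurface (curve) is null if its tangent vectors are null. A $C^1$-regular curve $\gamma:I\to\Omega$, where $I$ is an interval with endpoints $-\infty\le a<b\le\infty$ (each endpoint possibly included), is timelike if $\dot\gamma(s)$ is timelike for all $s\in I$; it is extendible in $\Omega$ if at least one of $\lim_{s\to a}\gamma(s)$, $\lim_{s\to b}\gamma(s)$ exists in $\Omega$, and inextendible otherwise. For an open set $\Omega\subseteq\mathbb{R}^2$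 containing $\Sigma=\{t=0\}\times\mathbb{R}$ and a smooth Lorentzian metric $g$ on $\Omega$, $(\Omega,g)$ is globally hyperbolic with Cauchy hypersurface $\Sigma$ if every inextendible timelike $C^1$-curve in $\Omega$ intersects $\Sigma$ exactly once. A globally hyperbolic development (GHD) of the data is a pair $(\Omega,\Phi)$ where $\Omega\subseteq\mathbb{R}^2$ is an open set containing $\Sigma$ and $\Phi:\Omega\to\mathbb{R}$ is a smooth classical solution of the initial value problem such that $(\Omega,\mathbf{g}(\Psi))$ is globally hyperbolic with Cauchy hypersurface $\Sigma$. A GHD $(\Omega,\Phi)$ is maximal (an MGHD) if there is no GHD $(\Omega',\Phi')$ with $\Omega\subsetneq\Omega'$ and $\Phi'|_\Omega=\Phi$. Regularity statements ''at'' or ''on'' a part of the boundary are local: a function on $\Omega_C$ extends with regularity $C^{k,\alpha}$ to a subset $A\subset\partial\Omega_C$ if for every $p\in A$ it extends, in a neighbourhood of $p$ in $\mathrm{cl}(\Omega_C)$, as a $C^{k,\alpha}$ function. ''Sharp'' means that the Hölder exponent cannot be increased. *)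

(* Defs.v *)
From HB Require Import structures.
From mathcomp Require Import all_boot all_order all_algebra.
From mathcomp Require Import all_classical all_reals all_analysis.

Set Implicit Arguments.
Unset Strict Implicit.
Unset Printing Implicit Defensive.

Import Order.TTheory GRing.Theory Num.Theory numFieldNormedType.Exports.

Local Open Scope classical_set_scope.
Local Open Scope ring_scope.

(* Points and vectors of R_t x R_x are pairs (t, x).  The library norm on the
   product is the maximum norm; it is equivalent to the Euclidean one, so the
   topological and Hoelder notions below do not depend on this choice.
   A function on an open set Omega is a total function on R * R of which only
   the values on Omega matter. *)

Section Calculus.
Variable R : realType.
Implicit Types (V : normedModType R) (Omega U A M : set (R * R)) (p q : R * R).

Definition e_t : R * R := (1, 0).
Definition e_x : R * R := (0, 1).

(* [false] stands for t and [true] for x. *)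
Definition axis (i : bool) : R * R := if i then e_x else e_t.

(* pderiv [:: i1; ...; ik] f = d_i1 ... d_ik f *)
Definition pderiv V (s : seq bool) (f : R * R -> V) : R * R -> V :=
  foldr (fun i g => 'D_(axis i) g) f s.

Definition Ck_on V (k : nat) Omega (f : R * R -> V) : Prop :=
  (forall s i p, (size s < k)%N -> Omega p ->
     derivable (pderiv s f) p (axis i)) /\
  (forall s p, (size s <= k)%N -> Omega p -> continuous_at p (pderiv s f)).

Definition smooth_on V Omega (f : R * R -> V) : Prop :=
  forall k, Ck_on k Omega f.

Definition holder_on V (alpha : R) A (f : R * R -> V) : Prop :=
  exists C : R, forall p q, A p -> A q ->
    `|f p - f q| <= C * `|p - q| `^ alpha.

Definition boundary A : set (R * R) := closure A `\` interior A.

(* F is C^k on U `&` closure Omega: it is C^k on U `&` Omega and its partial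
   derivatives of order at most k have continuous extensions D to
   U `&` closure Omega, with D [::] = F. *)
Definition Ck_up_to_boundary V (k : nat) Omega U
    (F : R * R -> V) (D : seq bool -> R * R -> V) : Prop :=
  [/\ Ck_on k (U `&` Omega) F,
      forall p, (U `&` closure Omega) p -> D [::] p = F p,
      forall s p, (size s <= k)%N -> (U `&` Omega) p -> D s p = pderiv s F p &
      forall s, (size s <= k)%N -> {within U `&` closure Omega, continuous (D s)}].

(* Near p, the function F is a C^{k,alpha} extension to closure Omega of the
   function f on Omega. *)
Definition holder_extension V (k : nat) (alpha : R) Omega
    (f F : R * R -> V) p : Prop :=
  exists U D, [/\ open_nbhs p U,
    forall q, (U `&` Omega) q -> F q = f q,
    Ck_up_to_boundary k Omega U F D &
    forall s, size s = k -> holder_on alpha (U `&` closure Omega) (D s)].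

Definition smooth_extension V Omega (f F : R * R -> V) p : Prop :=
  exists U D, [/\ open_nbhs p U,
    forall q, (U `&` Omega) q -> F q = f q &
    forall k, Ck_up_to_boundary k Omega U F D].

Definition extends_holder V (k : nat) (alpha : R) Omega (f : R * R -> V) A : Prop :=
  forall p, A p -> exists F, holder_extension k alpha Omega f F p.

Definition sharp_exponent V (k : nat) (alpha : R) Omega (f : R * R -> V) A : Prop :=
  forall p, A p -> forall beta, alpha < beta ->
    ~ exists F, holder_extension k beta Omega f F p.

Definition extends_smoothly V Omega (f : R * R -> V) A : Prop :=
  forall p, A p -> exists F, smooth_extension Omega f F p.

Definition hessian_norm (f : R * R -> R) p : R :=
  Num.sqrt (\sum_(i : bool) \sum_(j : bool) (pderiv [:: i; j] f p) ^+ 2).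

(* Derivative along the set I: one-sided at an endpoint belonging to I. *)
Definition deriv_within (I : set R) (gamma : R -> R * R) (s : R) (v : R * R) : Prop :=
  (fun r => (r - s)^-1 *: (gamma r - gamma s)) @ within I s^' --> v.

Definition C1_curve (I : set R) (gamma dgamma : R -> R * R) : Prop :=
  (forall s, I s -> deriv_within I gamma s (dgamma s)) /\
  {within I, continuous dgamma}.

Definition smooth_curve (I : set R) (gamma : R -> R * R) : Prop :=
  forall n s, I s -> derivable (derive1n n gamma) s 1.

Definition integral_curve (X : R * R -> R * R) (I : set R) (gamma : R -> R * R) : Prop :=
  forall s, I s -> deriv_within I gamma s (X (gamma s)).

(* Embedded smooth submanifold of codimension d, through local defining
   functions with linearly independent differentials. *)
Definition submanifold (d : nat) M : Prop :=
  forall p, M p -> exists U (f : 'I_d -> R * R -> R),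
    [/\ open_nbhs p U,
        forall i, smooth_on U (f i),
        forall q, U q -> (M q <-> forall i, f i q = 0) &
        forall q, U q -> forall c : 'I_d -> R,
          (forall b, \sum_i c i * pderiv [:: b] (f i) q = 0) ->
          forall i, c i = 0].

Definition tangent_to M p (v : R * R) : Prop :=
  exists e gamma dgamma, [/\ 0 < e, C1_curve `](- e), e[ gamma dgamma,
    forall s, - e < s < e -> M (gamma s), gamma 0 = p & dgamma 0 = v].

End Calculus.

Section Geometry.
Variable R : realType.
Implicit Types (Omega M : set (R * R)) (g : R * R -> R * R * R).

(* The triple (a, b, c) is the symmetric bilinear form
   a dt^2 + b (dt (x) dx + dx (x) dt) + c dx^2. *)
Definition form_app (h : R * R * R) (u v : R * R) : R :=
  h.1.1 * (u.1 * v.1) + h.1.2 * (u.1 * v.2 + u.2 * v.1) + h.2 * (u.2 * v.2).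

(* Signature (-, +). *)
Definition lorentzian (h : R * R * R) : Prop :=
  exists u v, [/\ form_app h u u = -1, form_app h v v = 1 & form_app h u v = 0].

Definition timelike (h : R * R * R) (v : R * R) : Prop := form_app h v v < 0.

Definition null (h : R * R * R) (v : R * R) : Prop := form_app h v v = 0.

Definition smooth_lorentzian_metric Omega g : Prop :=
  smooth_on Omega g /\ forall p, Omega p -> lorentzian (g p).

Definition null_curve g M : Prop :=
  forall p v, M p -> tangent_to M p v -> null (g p) v.

(* I is an interval with endpoints a < b, each of which may belong to I. *)
Definition interval_with_endpoints (a b : \bar R) (I : set R) : Prop :=
  [/\ (a < b)%E, forall s, (a < s%:E < b)%E -> I s &
      forall s, I s -> (a <= s%:E <= b)%E].

(* The filters "s -> b, s < b" and "s -> a, s > a"; the cases -oo and +oo,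
   respectively, are not used. *)
Definition from_left (b : \bar R) : set_system R :=
  match b with
  | EFin r => r^'-
  | EPInf => +oo
  | ENInf => -oo
  end.

Definition from_right (a : \bar R) : set_system R :=
  match a with
  | EFin r => r^'+
  | EPInf => +oo
  | ENInf => -oo
  end.

Definition extendible_in Omega (a b : \bar R) (gamma : R -> R * R) : Prop :=
  exists2 q, Omega q & (gamma @ from_right a --> q) \/ (gamma @ from_left b --> q).

Definition Sigma : set (R * R) := [set p | p.1 = 0].

Definition globally_hyperbolic Omega g : Prop :=
  [/\ open Omega, Sigma `<=` Omega, smooth_lorentzian_metric Omega g &
      forall a b I gamma dgamma,
        interval_with_endpoints a b I -> C1_curve I gamma dgamma ->
        (forall s, I s -> Omega (gamma s)) ->
        (forall s, I s -> timelike (g (gamma s)) (dgamma s)) ->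
        ~ extendible_in Omega a b gamma ->
        exists! s, I s /\ Sigma (gamma s)].

End Geometry.

Arguments Sigma {R}.

Section WaveEquation.
Variable R : realType.
Implicit Types (Omega : set (R * R)) (Phi : R * R -> R) (p : R * R).

Definition Psi Phi p : R := 'D_(e_t R) Phi p - 2 * 'D_(e_x R) Phi p.

Definition acoustical_form (psi : R) : R * R * R :=
  (- (8 * (2 + psi) / (4 + psi) ^+ 2),
   - (2 * psi / (4 + psi) ^+ 2),
   4 / (4 + psi) ^+ 2).

Definition acoustical_metric Phi p : R * R * R := acoustical_form (Psi Phi p).

Definition L Phi p : R * R := (1, 2 + Psi Phi p).

Definition Lbar p : R * R := (1, - 2).

Definition wave_equation Phi p : Prop :=
  - 'D_(e_t R) ('D_(e_t R) Phi) p
  - ('D_(e_t R) Phi p - 2 * 'D_(e_x R) Phi p) * 'D_(e_t R) ('D_(e_x R) Phi) p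
  + 2 * (2 + ('D_(e_t R) Phi p - 2 * 'D_(e_x R) Phi p))
      * 'D_(e_x R) ('D_(e_x R) Phi) p = 0.

Definition initial_data Phi : Prop :=
  forall x, Phi (0, x) = 0 /\ 'D_(e_t R) Phi (0, x) = - atan x.

Definition classical_solution Omega Phi : Prop :=
  [/\ open Omega, Sigma `<=` Omega, Ck_on 2 Omega Phi,
      forall p, Omega p -> wave_equation Phi p & initial_data Phi].

(* The condition Psi <> -4 is where the acoustical metric is defined. *)
Definition GHD Omega Phi : Prop :=
  [/\ classical_solution Omega Phi, smooth_on Omega Phi,
      forall p, Omega p -> Psi Phi p <> - 4 &
      globally_hyperbolic Omega (acoustical_metric Phi)].

Definition MGHD Omega Phi : Prop :=
  GHD Omega Phi /\
  ~ exists Omega' Phi', [/\ GHD Omega' Phi', Omega `<=` Omega', Omega <> Omega' &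
      forall p, Omega p -> Phi' p = Phi p].

Definition sing (z : R) : R * R :=
  (1 + z ^+ 2, (2 - atan z) * (1 + z ^+ 2) + z).

End WaveEquation.

(* Main.v *)
Require Import Defs.
From HB Require Import structures.
From mathcomp Require Import all_boot all_order all_algebra.
From mathcomp Require Import ring lra.
From mathcomp Require Import all_classical all_reals all_analysis.
Import Order.TTheory GRing.Theory Num.Theory numFieldNormedType.Exports.
Local Open Scope classical_set_scope.
Local Open Scope ring_scope.

Set Implicit Arguments.
Unset Strict Implicit.
Unset Printing Implicit Defensive.

(** The wave operator factors: with L = d_t + (2 + Psi) d_x and Lbar = d_t - 2 d_x the equation reads
    - L (Lbar Phi) = 0, and Lbar Phi = Psi. So Psi solves the Burgers equation
    Psi_t + (2 + Psi) Psi_x = 0 with data - atan x: it is constant along the straight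
    characteristics x = z + t (2 - atan z), which start at z and focus at t = 1 + z^2. In the
    coordinate x - 2 t the characteristic is kap t z = z - t atan z. Inverting this relation for
    the foot z gives Psi = - atan z, and Phi is obtained by integrating Psi along the lines
    u = x + 2 t = const, with a gradient that depends on u and z only (Phi_of).

    The curve B is the envelope of the characteristics with z > 0, S is its cusp (1, 2), and C
    is the half-line u = 4, t > 1 that issues from S in the direction Lbar. The domain Omega is
    the set where u < 4 or x lies to the right of B, and the foot zC is single-valued on its
    closure. Omega is globally hyperbolic (timelike_meets_Sigma): towards the past a timelike
    curve has monotone t and u, and to the right of B its foot increases, so it cannot
    approach the boundary without having met Sigma.

    The core is uniqueness. Let (U, Phi) be any globally hyperbolic development, and look at the
    future of Sigma. Every curve used against global hyperbolicity is a graph over t that is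
    timelike as long as it is in U and issues from a point outside U. They are built from
    solutions of x' = - 2 + h k, where h is a Lipschitz minorant of the gap 4 + Psi between the two
    characteristic slopes (drift_curve). They show that Psi > - 4, that the Lbar-lines from
    points of U down to Sigma stay in U (vertical_segment), and, by an extremal argument in the
    strip of characteristics that end on a short segment, that so do the L-lines (good_closed).
    Hence Psi is given by an unfocused characteristic at every point of U
    (characteristic_solution). Following the foot along an Lbar-line then shows that U is
    contained in Omega, and Psi = Lbar Phi determines Phi there (GHD_subset, GHD_eq). Existence
    and uniqueness of the maximal development follow formally.

    The regularity at the boundary is that of the foot. The derivative of kap t vanishes to
    second order at S and to first order along B, which gives
    |zC p - zC q|^3 <= K |p - q| up to S (zC_cubic) and the same with a square near B
    (zC_quadratic); points on the line t = const through a singular point show that the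
    exponents 1/3 and 1/2 are optimal (PhiC_sharp). Since z_x = (1 + z^2) / (1 + z^2 - t), the
    second derivatives of Phi blow up where t = 1 + z^2, that is, at S and B. Across C the left
    branch of the foot continues smoothly, because it is the reflection of the right branch
    (zleft). Finally, B and the characteristics tangent to it are both integral curves of the
    extended L (two_integral_curves). *)

(** * Calculus of one variable *)

Section RealCalculus.
Variable R : realType.
Implicit Types (f df : R -> R) (a b c d e s t x y z : R).

Lemma continuous_epsP (V W : normedModType R) (f : V -> W) (x : V) :
  {for x, continuous f} <->
  forall e : R, 0 < e -> exists2 d : R, 0 < d & forall y : V, `|y - x| < d -> `|f y - f x| < e.
Proof.
split=> [fx e e0|H].
  have /cvgrPdist_lt/(_ _ e0)/nbhs_ballP[d /= d0 dP] := fx.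
  exists d => // y yx; rewrite distrC; apply: dP.
  by rewrite -ball_normE /= distrC.
apply/cvgrPdist_lt => e e0; have [d d0 dP] := H e e0.
apply/nbhs_ballP; exists d => //= y; rewrite -ball_normE /= distrC => yx.
by rewrite distrC; exact: dP.
Qed.

Lemma is_derive_epsP f x d :
  is_derive x 1 f d <->
  forall e : R, 0 < e -> exists2 r : R, 0 < r &
    forall h : R, `|h| < r -> `|f (x + h) - f x - h * d| <= e * `|h|.
Proof.
split=> [[fx fd] e e0|H].
  have : (h^-1 *: (f (h *: 1 + x) - f x)) @[h --> (0:R)^'] --> d.
    by rewrite -fd; exact: fx.
  move=> /cvgrPdist_lt/(_ _ e0)/nbhs_ballP[r /= r0 rP].
  exists r => // h hr; have [->|h0] := eqVneq h 0.
    by rewrite addr0 subrr mul0r subrr !normr0 mulr0.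
  have := rP h; rewrite -ball_normE /= sub0r normrN => /(_ hr h0) H.
  have -> : f (x + h) - f x - h * d =
      - (h * (d - h^-1 *: (f (h *: 1 + x) - f x))).
    by rewrite /GRing.scale /= mulr1 [h + x]addrC; field.
  by rewrite normrN normrM mulrC ler_pM2r ?normr_gt0//; exact: ltW.
have cv : (h^-1 *: (f (h *: 1 + x) - f x)) @[h --> (0:R)^'] --> d.
  apply/cvgrPdist_lt => e e0; have e20 : 0 < e / 2 by rewrite divr_gt0.
  have [r r0 rP] := H _ e20.
  apply/nbhs_ballP; exists r => //= h; rewrite -ball_normE /= sub0r normrN => hr h0.
  have -> : d - h^-1 *: (f (h *: 1 + x) - f x) =
      - (h^-1 * (f (x + h) - f x - h * d)).
    by rewrite /GRing.scale /= mulr1 [h + x]addrC; field.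
  rewrite normrN normrM normfV mulrC ltr_pdivrMr ?normr_gt0//.
  apply: (le_lt_trans (rP h hr)); rewrite ltr_pM2r ?normr_gt0//.
  by rewrite ltr_pdivrMr// ltr_pMr// ltrDl.
apply: DeriveDef; first exact: (cvgP _ cv).
exact: (cvg_lim (@norm_hausdorff _ _) cv).
Qed.

Lemma is_derive_continuous f x d : is_derive x 1 f d -> {for x, continuous f}.
Proof.
by move=> [fx _]; apply: differentiable_continuous; apply/derivable1_diffP.
Qed.

Lemma mean_value f df a b : a < b ->
  (forall x, a <= x <= b -> is_derive x 1 f (df x)) ->
  exists2 c, a < c < b & f b - f a = df c * (b - a).
Proof.
move=> ab H; have [||c] := @MVT _ f df a b ab.
- by move=> x; rewrite in_itv /= => /andP[ax xb]; apply: H; rewrite !ltW.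
- apply: continuous_in_subspaceT => x; rewrite inE /= in_itv /= => xab.
  exact: (is_derive_continuous (H _ xab)).
- by rewrite in_itv /=; exists c.
Qed.

Lemma ger0_derive_le f df a b : a <= b ->
  (forall x, a <= x <= b -> is_derive x 1 f (df x)) ->
  (forall x, a < x < b -> 0 <= df x) -> f a <= f b.
Proof.
rewrite le_eqVlt => /predU1P[->//|ab] H H0.
have [c cab E] := mean_value ab H.
by rewrite -subr_ge0 E mulr_ge0 ?H0// subr_ge0 ltW.
Qed.

Lemma gtr0_derive_lt f df a b : a < b ->
  (forall x, a <= x <= b -> is_derive x 1 f (df x)) ->
  (forall x, a < x < b -> 0 < df x) -> f a < f b.
Proof.
move=> ab H H0; have [c cab E] := mean_value ab H.
by rewrite -subr_gt0 E mulr_gt0 ?H0// subr_gt0.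
Qed.

Lemma derive_eq0_cst f a b : a <= b ->
  (forall x, a <= x <= b -> is_derive x 1 f 0) -> f b = f a.
Proof.
rewrite le_eqVlt => /predU1P[->//|ab] H.
have [c cab /eqP] := mean_value (df := cst 0) ab H.
by rewrite mul0r subr_eq0 => /eqP.
Qed.

Lemma IVT0 f a b : a <= b -> (forall x, a <= x <= b -> {for x, continuous f}) ->
  f a <= 0 <= f b \/ f b <= 0 <= f a -> exists2 c, a <= c <= b & f c = 0.
Proof.
move=> ab cf H; have [||c] := @IVT _ f a b 0 ab.
- apply: continuous_in_subspaceT => x; rewrite inE /= in_itv /=; exact: cf.
- rewrite ge_min le_max; case: H => /andP[-> ->]; by rewrite ?orbT.
- by rewrite in_itv /=; exists c.
Qed.

(** Primitives on the line, and timelike curves, are assembled from two halves that agree to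
    first order at the junction. *)
Lemma glue_derive f g df dg x0 :
  f x0 = g x0 -> df x0 = dg x0 -> forall x,
  (x <= x0 -> is_derive x 1 f (df x)) -> (x0 <= x -> is_derive x 1 g (dg x)) ->
  is_derive x 1 (fun y => if y <= x0 then f y else g y)
    (if x <= x0 then df x else dg x).
Proof.
move=> fg dfg x Hf Hg; case: (ltgtP x x0) => [xx0|xx0|xx0].
- apply: (@near_eq_is_derive _ _ _ f); last exact: Hf (ltW xx0).
  near=> y; have -> // : y <= x0.
  by apply: ltW; near: y; exact: lt_nbhsl.
- apply: (@near_eq_is_derive _ _ _ g); last exact: Hg (ltW xx0).
  near=> y; rewrite leNgt (_ : x0 < y)//.
  by near: y; exact: lt_nbhsr.
- rewrite xx0 in Hf Hg *; move/is_derive_epsP: (Hf (lexx _)) => {}Hf.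
  move/is_derive_epsP: (Hg (lexx _)) => {}Hg.
  apply/is_derive_epsP => e e0; have [r r0 rP] := Hf e e0; have [r' r'0 r'P] := Hg e e0.
  exists (Num.min r r') => [|h]; first by rewrite lt_min r0.
  rewrite lt_min => /andP[hr hr']; rewrite lexx; case: ifPn => _; first exact: rP.
  by rewrite fg dfg; exact: r'P.
Unshelve. all: by end_near. Qed.

End RealCalculus.

Section Antiderivative.
Variable R : realType.
Implicit Types (f : R -> R) (x : R).

Lemma antiderivative_right f : continuous f ->
  exists2 G : R -> R, G 0 = 0 & forall x, 0 <= x -> is_derive x 1 G (f x).
Proof.
move=> cf.
pose F := fun x : R => \int[lebesgue_measure]_(t in `[-1, x]) f t.
exists (fun x => F x - F 0) => [|x x0]; first by rewrite subrr.
have xu : x < x + 1 by rewrite ltrDl.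
have ax : -1 < x by rewrite (lt_le_trans _ x0)// ltrN10.
have intf : lebesgue_measure.-integrable `[-1, x + 1] (EFin \o f).
  apply: continuous_compact_integrable; first exact: segment_compact.
  exact: continuous_subspaceT.
have [dF F'] := continuous_FTC1_closed xu intf ax (cf x).
have dFx : is_derive x 1 F (f x) by apply: (DeriveDef dF); rewrite -derive1E; exact: F'.
by apply: is_derive_eq (subr0 _).
Qed.

(** The integral from a fixed base point is differentiable only to the right of it, so the two
    half lines are treated separately, by reflection, and glued. *)
Lemma antiderivative f : continuous f ->
  exists2 F : R -> R, F 0 = 0 & forall x, is_derive x 1 F (f x).
Proof.
move=> cf; have [G G0 G'] := antiderivative_right cf.
have cfN : continuous (fun x => f (- x)).
  by move=> x; apply: (@continuous_comp _ _ _ -%R f); [exact: opp_continuous|exact: cf].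
have [H H0 H'] := antiderivative_right cfN.
pose Hm := fun x : R => - H (- x).
have Hm' x : x <= 0 -> is_derive x 1 Hm (f x).
  rewrite -oppr_ge0 => /H'; rewrite opprK => Hx.
  have K : is_derive x 1 (H \o -%R) (f x * -1) by exact: is_derive1_comp.
  have := is_deriveN K; rewrite mulrN1 opprK; exact.
exists (fun y => if y <= 0 then Hm y else G y) => [|x].
  by rewrite lexx /Hm oppr0 H0 oppr0.
have := @glue_derive _ Hm G f f 0 _ erefl x (Hm' x) (G' x).
by rewrite if_same; apply; rewrite /Hm oppr0 H0 G0 oppr0.
Qed.

End Antiderivative.

(** * Calculus in the plane *)

Section PlaneCalculus.
Variable R : realType.
Implicit Types (f ft fx : R * R -> R) (p q : R * R).

(** Partial derivatives are ordinary derivatives of restrictions to axis-parallel lines. *)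
Definition coord (i : bool) p : R := if i then p.2 else p.1.

Definition slice (V : Type) (i : bool) (f : R * R -> V) p : R -> V :=
  fun s => if i then f (p.1, s) else f (s, p.2).

Lemma slice_quotient (V : normedModType R) i (f : R * R -> V) p :
  (fun h : R => h^-1 *: ((f \o shift p) (h *: axis R i) - f p)) =
  (fun h : R => h^-1 *: ((slice i f p \o shift (coord i p)) (h *: (1:R)) - slice i f p (coord i p))).
Proof.
apply/funext => h; case: p => t x; congr (_ *: _).
case: i; rewrite /slice/=.
  have -> // : h *: axis R true + (t, x) = (t, h *: 1 + x).
  by rewrite -[LHS]/(h *: (0:R) + t, h *: (1:R) + x) scaler0 add0r.
have -> // : h *: axis R false + (t, x) = (h *: 1 + t, x).
by rewrite -[LHS]/(h *: (1:R) + t, h *: (0:R) + x) scaler0 add0r.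
Qed.

Lemma derivable_axisP (V : normedModType R) i (f : R * R -> V) p :
  derivable f p (axis R i) <-> derivable (slice i f p) (coord i p) 1.
Proof. by rewrite /derivable slice_quotient. Qed.

Lemma derive_axisE (V : normedModType R) i (f : R * R -> V) p :
  'D_(axis R i) f p = 'D_1 (slice i f p) (coord i p).
Proof. by rewrite /derive slice_quotient. Qed.

Lemma is_derive_axisP (V : normedModType R) i (f : R * R -> V) p (d : V) :
  is_derive p (axis R i) f d <-> is_derive (coord i p) 1 (slice i f p) d.
Proof.
split=> -[H1 H2]; apply: DeriveDef.
- by apply/derivable_axisP.
- by rewrite -derive_axisE.
- by apply/derivable_axisP.
- by rewrite derive_axisE.
Qed.

Lemma norm_pairE (a b : R) : `|(a, b)| = Num.max `|a| `|b|. Proof. by []. Qed.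

Lemma norm_pair_lt p (e : R) : (`|p| < e) = (`|p.1| < e) && (`|p.2| < e).
Proof. by case: p => a b; rewrite norm_pairE gt_max. Qed.

Lemma norm_pair_le p (e : R) : (`|p| <= e) = (`|p.1| <= e) && (`|p.2| <= e).
Proof. by case: p => a b; rewrite norm_pairE ge_max. Qed.

Lemma continuous_pair (V : normedModType R) (f g : V -> R) (x : V) :
  {for x, continuous f} -> {for x, continuous g} ->
  {for x, continuous (fun y => (f y, g y))}.
Proof.
move=> /continuous_epsP cf /continuous_epsP cg; apply/continuous_epsP => e e0.
have [r r0 rP] := cf _ e0; have [r' r'0 r'P] := cg _ e0.
exists (Num.min r r') => [|y]; first by rewrite lt_min r0.
by rewrite lt_min norm_pair_lt /= => /andP[/rP -> /r'P].
Qed.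

Lemma open_epsP (A : set (R * R)) : open A <->
  forall p, A p -> exists2 r : R, 0 < r & forall q, `|q - p| < r -> A q.
Proof.
rewrite openE; split=> [H p /H /nbhs_ballP[r /= r0 rP]|H p /H [r r0 rP]].
  by exists r => // q qp; apply: rP; rewrite -ball_normE /= distrC.
by apply/nbhs_ballP; exists r => //= q; rewrite -ball_normE /= distrC => /rP.
Qed.

Lemma mean_value_increment (g dg : R -> R) (x h : R) :
  (forall s, `|s| <= `|h| -> is_derive (x + s) 1 g (dg (x + s))) ->
  exists2 s, `|s| <= `|h| & g (x + h) - g x = h * dg (x + s).
Proof.
move=> H; case: (ltgtP h 0) => [h0|h0|->].
- have [||c /andP[c1 c2] E] := @mean_value _ g dg (x + h) x.
  + by rewrite gtrDl.
  + move=> y /andP[y1 y2]; rewrite (_ : y = x + (y - x)); last by ring.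
    by apply: H; rewrite ler0_norm ?ltr0_norm//; lra.
  exists (c - x); first by rewrite ler0_norm ?ltr0_norm//; lra.
  rewrite (_ : x + (c - x) = c); last by ring.
  by rewrite -opprB E; ring.
- have [||c /andP[c1 c2] E] := @mean_value _ g dg x (x + h).
  + by rewrite ltrDl.
  + move=> y /andP[y1 y2]; rewrite (_ : y = x + (y - x)); last by ring.
    by apply: H; rewrite ger0_norm ?gtr0_norm//; lra.
  exists (c - x); first by rewrite ger0_norm ?gtr0_norm//; lra.
  rewrite (_ : x + (c - x) = c); last by ring.
  by rewrite E; ring.
- by exists 0; rewrite ?lexx// addr0 subrr mul0r.
Qed.

(** Frechet differentiability at p with gradient (a, b). *)
Definition has_gradient f p (a b : R) :=
  forall e : R, 0 < e -> exists2 r : R, 0 < r & forall h k : R, `|h| < r -> `|k| < r ->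
    `|f (p.1 + h, p.2 + k) - f p - (h * a + k * b)| <= e * (`|h| + `|k|).

(** Move first in t, then in x, and apply the mean value theorem to each leg. *)
Lemma C1_has_gradient (U : set (R * R)) f ft fx p : open U -> U p ->
  (forall q, U q -> is_derive q (axis R false) f (ft q)) ->
  (forall q, U q -> is_derive q (axis R true) f (fx q)) ->
  {for p, continuous ft} -> {for p, continuous fx} ->
  has_gradient f p (ft p) (fx p).
Proof.
move=> /open_epsP oU Up Ht Hx /continuous_epsP ct /continuous_epsP cx e e0.
have [r r0 rP] := oU _ Up; have [r1 r10 r1P] := ct _ e0; have [r2 r20 r2P] := cx _ e0.
exists (Num.min r (Num.min r1 r2)) => [|h k]; first by rewrite !lt_min r0 r10.
rewrite !lt_min => /and3P[hr hr1 hr2] /and3P[kr kr1 kr2].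
clear ct cx; case: p => t x in Up rP r1P r2P *; rewrite /=.
have [s hs E1] : exists2 s, `|s| <= `|h| &
    f (t + h, x) - f (t, x) = h * ft (t + s, x).
  apply: (@mean_value_increment (fun s => f (s, x)) (fun s => ft (s, x))) => s hs.
  apply/(is_derive_axisP false f (t + s, x)); apply: Ht; apply: rP.
  rewrite norm_pair_lt /= subrr normr0 r0 andbT.
  by rewrite (_ : t + s - t = s); [exact: le_lt_trans hr|ring].
have [s' ks E2] : exists2 s, `|s| <= `|k| &
    f (t + h, x + k) - f (t + h, x) = k * fx (t + h, x + s).
  apply: (@mean_value_increment (fun s => f (t + h, s)) (fun s => fx (t + h, s))) => s' ks.
  apply/(is_derive_axisP true f (t + h, x + s')); apply: Hx; apply: rP.
  rewrite norm_pair_lt /= (_ : t + h - t = h); last by ring.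
  by rewrite hr (_ : x + s' - x = s'); [exact: le_lt_trans kr|ring].
have -> : f (t + h, x + k) - f (t, x) - (h * ft (t, x) + k * fx (t, x)) =
    h * (ft (t + s, x) - ft (t, x)) + k * (fx (t + h, x + s') - fx (t, x)).
  rewrite !mulrBr -E1 -E2; ring.
apply: (le_trans (ler_normD _ _)); rewrite !normrM mulrDr ![e * _]mulrC.
apply: lerD; apply: ler_wpM2l => //; apply: ltW.
  apply: r1P; rewrite norm_pair_lt /= subrr normr0 r10 andbT.
  by rewrite (_ : t + s - t = s); [exact: le_lt_trans hr1|ring].
apply: r2P; rewrite norm_pair_lt /= (_ : t + h - t = h); last by ring.
by rewrite hr2 (_ : x + s' - x = s'); [exact: le_lt_trans kr2|ring].
Qed.

Lemma has_gradient_chain f p (a b : R) (g1 g2 : R -> R) (s d1 d2 : R) :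
  has_gradient f p a b -> is_derive s 1 g1 d1 -> is_derive s 1 g2 d2 ->
  (g1 s, g2 s) = p -> is_derive s 1 (fun r => f (g1 r, g2 r)) (d1 * a + d2 * b).
Proof.
move=> Hf H1 H2 ep; apply/is_derive_epsP => e e0.
pose M := `|d1| + `|d2| + 2.
have M0 : 0 < M by rewrite /M; have := normr_ge0 d1; have := normr_ge0 d2; lra.
have [r r0 rP] := Hf _ (divr_gt0 e0 (mulr_gt0 (ltr0n _ 2) M0)).
pose N := `|a| + `|b| + 1.
have N0 : 0 < N by rewrite /N; have := normr_ge0 a; have := normr_ge0 b; lra.
pose e1 := Num.min 1 (e / (2 * N)).
have e10 : 0 < e1 by rewrite /e1 lt_min ltr01 /= divr_gt0// mulr_gt0.
have e11 : e1 <= 1 by rewrite /e1 ge_min lexx.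
have e1e : e1 * N <= e / 2.
  rewrite -ler_pdivlMr// /e1 ge_min; apply/orP; right.
  by rewrite [leRHS](_ : _ = e / (2 * N))//; field; rewrite gt_eqF.
move/is_derive_epsP/(_ _ e10): H1 => [r1 r10 r1P].
move/is_derive_epsP/(_ _ e10): H2 => [r2 r20 r2P].
exists (Num.min (r / M) (Num.min r1 r2)) => [|h].
  by rewrite !lt_min r10 r20 divr_gt0.
rewrite !lt_min ltr_pdivlMr// => /and3P[hr hr1 hr2].
have {}r1P := r1P _ hr1; have {}r2P := r2P _ hr2.
set h1 := g1 (s + h) - g1 s; set h2 := g2 (s + h) - g2 s.
rewrite -/h1 in r1P; rewrite -/h2 in r2P.
have nh := normr_ge0 h.
have B1 : `|h1| <= (`|d1| + 1) * `|h|.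
  rewrite (_ : h1 = (h1 - h * d1) + h * d1); last by ring.
  apply: (le_trans (ler_normD _ _)); rewrite normrM mulrDl mul1r addrC mulrC lerD2l.
  by apply: (le_trans r1P); rewrite ler_piMl.
have B2 : `|h2| <= (`|d2| + 1) * `|h|.
  rewrite (_ : h2 = (h2 - h * d2) + h * d2); last by ring.
  apply: (le_trans (ler_normD _ _)); rewrite normrM mulrDl mul1r addrC mulrC lerD2l.
  by apply: (le_trans r2P); rewrite ler_piMl.
have B12 : `|h1| + `|h2| <= M * `|h|.
  apply: (le_trans (lerD B1 B2)); rewrite /M; lra.
have h1r : `|h1| < r by have := normr_ge0 h2; have := hr; rewrite mulrC; lra.
have h2r : `|h2| < r by have := normr_ge0 h1; have := hr; rewrite mulrC; lra.
have e1s : g1 s + h1 = g1 (s + h) by rewrite /h1; ring.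
have e2s : g2 s + h2 = g2 (s + h) by rewrite /h2; ring.
have := rP _ _ h1r h2r; rewrite -ep /= e1s e2s => K.
have -> : f (g1 (s + h), g2 (s + h)) - f (g1 s, g2 s) - h * (d1 * a + d2 * b) =
  (f (g1 (s + h), g2 (s + h)) - f (g1 s, g2 s) - (h1 * a + h2 * b)) +
  ((h1 - h * d1) * a + (h2 - h * d2) * b) by ring.
apply: (le_trans (ler_normD _ _)).
have -> : e * `|h| = e / 2 * `|h| + e / 2 * `|h| by field.
apply: lerD.
  apply: (le_trans K).
  have -> : e / 2 * `|h| = e / (2 * M) * (M * `|h|) by field; rewrite gt_eqF.
  by rewrite ler_wpM2l// divr_ge0// ltW// mulr_gt0.
apply: (@le_trans _ _ (e1 * N * `|h|)); last by rewrite ler_wpM2r.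
apply: (le_trans (ler_normD _ _)); rewrite !normrM.
have A1 := ler_wpM2r (normr_ge0 a) r1P.
have A2 := ler_wpM2r (normr_ge0 b) r2P.
apply: (le_trans (lerD A1 A2)); rewrite /N.
have : 0 <= e1 * `|h| by rewrite mulr_ge0// ltW.
nra.
Qed.

End PlaneCalculus.

(** * Mixed derivatives and a global Picard theorem *)

Section ClairautPicard.
Variable R : realType.

(** Both mixed derivatives at p are limits of the same second differences. *)
Lemma clairaut (U : set (R * R)) (f ft fx ftx fxt : R * R -> R) p : open U -> U p ->
  (forall q, U q -> is_derive q (axis R false) f (ft q)) ->
  (forall q, U q -> is_derive q (axis R true) f (fx q)) ->
  (forall q, U q -> is_derive q (axis R true) ft (ftx q)) ->
  (forall q, U q -> is_derive q (axis R false) fx (fxt q)) ->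
  {for p, continuous ftx} -> {for p, continuous fxt} -> ftx p = fxt p.
Proof.
move=> /open_epsP oU Up Ht Hx Htx Hxt /continuous_epsP c1 /continuous_epsP c2.
apply/eqP; rewrite -subr_eq0 -normr_le0; apply/ler_addgt0Pl => e e0; rewrite addr0.
have e20 : 0 < e / 2 by rewrite divr_gt0.
have [r r0 rP] := oU _ Up.
have [r1 r10 r1P] := c1 _ e20; have [r2 r20 r2P] := c2 _ e20.
clear c1 c2.
pose m := Num.min r (Num.min r1 r2).
have m0 : 0 < m by rewrite !lt_min r0 r10.
pose h := m / 2; have h0 : 0 < h by rewrite divr_gt0.
have hm : h < m by rewrite ltr_pdivrMr// ltr_pMr// ltrDl.
case: p => t x in Up rP r1P r2P *.
have near s s' : `|s| <= `|h| -> `|s'| <= `|h| -> `|(t + s, x + s') - (t, x)| < m.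
  move=> hs hs'; rewrite norm_pair_lt /= ![_ + _ - _]addrAC !subrr !add0r.
  by rewrite (gtr0_norm h0) in hs hs'; rewrite !(le_lt_trans _ hm).
have inU s s' : `|s| <= `|h| -> `|s'| <= `|h| -> U (t + s, x + s').
  by move=> hs hs'; apply: rP; have := near _ _ hs hs'; rewrite /m lt_min => /andP[].
pose S := f (t + h, x + h) - f (t + h, x) - f (t, x + h) + f (t, x).
have z0 : `|0 : R| <= `|h| by rewrite normr0.
have [s1 hs1 E1] : exists2 s, `|s| <= `|h| &
    S = h * (ft (t + s, x + h) - ft (t + s, x)).
  have [|s hs E] := @mean_value_increment _ (fun s => f (s, x + h) - f (s, x))
    (fun s => ft (s, x + h) - ft (s, x)) t h.
    move=> s hs; apply: is_deriveB.
      by apply/(is_derive_axisP false f (t + s, x + h)); apply: Ht; exact: inU.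
    apply/(is_derive_axisP false f (t + s, x)); apply: Ht.
    by have := inU _ _ hs z0; rewrite addr0.
  by exists s => //; rewrite -E /S; ring.
have [s2 hs2 E2] : exists2 s, `|s| <= `|h| &
    ft (t + s1, x + h) - ft (t + s1, x) = h * ftx (t + s1, x + s).
  apply: (@mean_value_increment _ (fun s => ft (t + s1, s)) (fun s => ftx (t + s1, s))).
  move=> s hs; apply/(is_derive_axisP true ft (t + s1, x + s)); apply: Htx; exact: inU.
have [s3 hs3 E3] : exists2 s, `|s| <= `|h| &
    S = h * (fx (t + h, x + s) - fx (t, x + s)).
  have [|s hs E] := @mean_value_increment _ (fun s => f (t + h, s) - f (t, s))
    (fun s => fx (t + h, s) - fx (t, s)) x h.
    move=> s hs; apply: is_deriveB.
      by apply/(is_derive_axisP true f (t + h, x + s)); apply: Hx; exact: inU.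
    apply/(is_derive_axisP true f (t, x + s)); apply: Hx.
    by have := inU _ _ z0 hs; rewrite addr0.
  by exists s => //; rewrite -E /S; ring.
have [s4 hs4 E4] : exists2 s, `|s| <= `|h| &
    fx (t + h, x + s3) - fx (t, x + s3) = h * fxt (t + s, x + s3).
  apply: (@mean_value_increment _ (fun s => fx (s, x + s3)) (fun s => fxt (s, x + s3))).
  move=> s hs; apply/(is_derive_axisP false fx (t + s, x + s3)); apply: Hxt; exact: inU.
have EE : ftx (t + s1, x + s2) = fxt (t + s4, x + s3).
  have hn : h != 0 by rewrite gt_eqF.
  by apply: (mulfI hn); apply: (mulfI hn); rewrite -E2 -E4 -E1 -E3.
have A1 : `|ftx (t + s1, x + s2) - ftx (t, x)| < e / 2.
  by apply: r1P; have := near _ _ hs1 hs2; rewrite /m !lt_min => /and3P[].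
have A2 : `|fxt (t + s4, x + s3) - fxt (t, x)| < e / 2.
  by apply: r2P; have := near _ _ hs4 hs3; rewrite /m !lt_min => /and3P[].
rewrite (_ : _ - _ = (fxt (t + s4, x + s3) - fxt (t, x)) -
   (ftx (t + s1, x + s2) - ftx (t, x))); last by rewrite EE; ring.
apply: (le_trans (ler_normB _ _)).
by apply: ltW; rewrite (splitr e) ltrD.
Qed.

Lemma derive_norm_bound (w dw phi dphi : R -> R) (t0 t : R) :
  (forall s : R, is_derive s 1 w (dw s)) -> (forall s : R, is_derive s 1 phi (dphi s)) ->
  (forall s, `|dw s| <= dphi s) -> `|w t - w t0| <= `|phi t - phi t0|.
Proof.
move=> Hw Hp H.
have key a b : a <= b -> `|w b - w a| <= phi b - phi a.
  move=> ab; rewrite ler_norml; apply/andP; split.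
    suff : phi a + w a <= phi b + w b by lra.
    apply: (@ger0_derive_le _ (phi + w) (fun s => dphi s + dw s)) => //.
    by move=> s _ /=; have := H s; rewrite ler_norml => /andP[]; lra.
  suff : phi a - w a <= phi b - w b by lra.
  apply: (@ger0_derive_le _ (phi - w) (fun s => dphi s - dw s)) => //.
  by move=> s _ /=; have := H s; rewrite ler_norml => /andP[]; lra.
case: (leP t0 t) => [/key H1|/ltW/key H1].
  by rewrite [leRHS]ger0_norm// (le_trans _ H1).
by rewrite distrC [leRHS]distrC [leRHS]ger0_norm// (le_trans _ H1).
Qed.

Lemma pi2_le2 : pi / 2 <= 2 :> R.
Proof.
exact: ltW (pihalf_lt2 R).
Qed.

(** A weight with value 1 at t0 whose total mass pi / N is as small as desired. *)
Definition bell (N t0 t : R) : R := (1 + (N * (t - t0)) ^+ 2)^-1.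

Lemma bell_gt0 N t0 t : 0 < bell N t0 t.
Proof. by rewrite invr_gt0 ltr_pwDl// sqr_ge0. Qed.

Lemma bell_le1 N t0 t : bell N t0 t <= 1.
Proof.
rewrite invf_le1; last by rewrite ltr_pwDl// sqr_ge0.
by rewrite lerDl sqr_ge0.
Qed.

Lemma bell_center N t0 : bell N t0 t0 = 1.
Proof. by rewrite /bell subrr mulr0 expr0n addr0 invr1. Qed.

Lemma continuous_bell N t0 : continuous (bell N t0).
Proof.
move=> t; apply: cvgV; first by rewrite gt_eqF// ltr_pwDl// sqr_ge0.
apply: cvgD; first exact: cvg_cst.
apply: cvgM; apply: cvgM; [exact: cvg_cst| |exact: cvg_cst|]; apply: cvgB;
  by [exact: cvg_id|exact: cvg_cst].
Qed.

Lemma is_derive_atan_bell (N t0 c t : R) :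
  is_derive t 1 (fun s : R => c * atan (N * (s - t0))) (c * (N * bell N t0 t)).
Proof.
have H1 : is_derive t 1 (fun s : R => N * (s - t0)) N.
  have : is_derive t 1 (N \*: (id - cst t0)) (N *: (1 - 0)) by exact: is_deriveZ.
  by rewrite subr0 /GRing.scale /= mulr1.
have H2 : is_derive t 1 (atan \o (fun s : R => N * (s - t0))) ((1 + (N * (t - t0)) ^+ 2)^-1 * N).
  by apply: is_derive1_comp.
have H3 := is_deriveZ c H2.
by apply: (is_derive_eq H3); rewrite /bell /GRing.scale /= [_^-1 * N]mulrC.
Qed.

(** Global solvability of x' = g(t, x) bell(t) for bounded Lipschitz g. The total mass of the
    integrable weight is so small that the Picard map contracts the sup norm on all of R. *)
Lemma picard (g : R * R -> R) (K M N t0 x0 : R) : 0 < N -> 0 <= K -> 4 * K <= N ->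
  continuous g -> (forall t x y, `|g (t, x) - g (t, y)| <= K * `|x - y|) ->
  (forall p, `|g p| <= M) ->
  exists2 x : R -> R, x t0 = x0 & forall t : R, is_derive t 1 x (g (t, x t) * bell N t0 t).
Proof.
move=> N0 K0 KN cg Lg Mg.
have M0 : 0 <= M by apply: le_trans (Mg (0, 0)).
have /choice[T HT] (u : R -> R) : exists v : R -> R, continuous u -> v t0 = x0 /\
    forall t : R, is_derive t 1 v (g (t, u t) * bell N t0 t).
  have [cu|nu] := pselect (continuous u); last by exists u.
  have [|F F0 F'] := @antiderivative _ (fun t => g (t, u t) * bell N t0 t).
    move=> t; apply: (@continuousM _ _ (fun t => g (t, u t)) (bell N t0)); last exact: continuous_bell.
    apply: (@continuous_comp _ _ _ (fun t => (t, u t)) g); last exact: cg.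
    by apply: continuous_pair; [exact: cvg_id|exact: cu].
  exists (fun t => F t - F t0 + x0) => _; split; first by rewrite subrr add0r.
  move=> t; have := is_deriveD (is_deriveB (F' t) (is_derive_cst (F t0) t 1)) (is_derive_cst x0 t 1).
  by rewrite subr0 addr0.
have cT u : continuous u -> continuous (T u).
  by move=> /HT[_ H] t; exact: is_derive_continuous (H t).
have contr u v D : continuous u -> continuous v -> 0 <= D ->
    (forall t, `|u t - v t| <= D) -> forall t, `|T u t - T v t| <= D / 2.
  move=> cu cv D0 uv t; have [Tu Tu'] := HT u cu; have [Tv Tv'] := HT v cv.
  have H := derive_norm_bound t0 t (fun s => is_deriveB (Tu' s) (Tv' s))
    (fun s => is_derive_atan_bell N t0 (D / 4) s).
  rewrite !fctE Tu Tv !subrr mulr0 atan0 mulr0 !subr0 in H; apply: le_trans (H _) _ => {H}.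
  - move=> s; rewrite -mulrBl normrM (gtr0_norm (bell_gt0 _ _ _)) mulrA.
    apply: ler_wpM2r; [exact: ltW (bell_gt0 _ _ _)|apply: (le_trans (Lg _ _ _))].
    apply: (@le_trans _ _ (K * D)); first by rewrite ler_wpM2l.
    have := ler_wpM2r D0 KN; lra.
  - rewrite normrM (ger0_norm (divr_ge0 D0 _))//.
    have : `|atan (N * (t - t0))| <= 2.
      rewrite ler_norml; have := pi2_le2; have := atan_ltpi2 (N * (t - t0)).
      have := atan_gtNpi2 (N * (t - t0)); lra.
    have D4 : 0 <= D / 4 by rewrite divr_ge0.
    move=> /(ler_wpM2l D4); lra.
pose u n := iter n T (cst x0).
have cu n : continuous (u n) by elim: n => [|n IH]; [move=> t; exact: cvg_cst|exact: cT].
pose D0 := 2 * M / N; have D00 : 0 <= D0 by rewrite divr_ge0 ?mulr_ge0// ltW.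
have du n t : `|u n.+1 t - u n t| <= D0 / 2 ^+ n.
  elim: n t => [|n IH] t; last first.
    rewrite exprS invfM [_^-1 * _]mulrC mulrA.
    apply: (contr _ _ (D0 / 2 ^+ n) (cu n.+1) (cu n) _ IH).
    by rewrite divr_ge0// exprn_ge0.
  rewrite expr0 divr1 /u /=; have [Tu Tu'] := HT (cst x0) (cu 0%N).
  have H := derive_norm_bound t0 t Tu' (fun s => is_derive_atan_bell N t0 (M / N) s).
  rewrite Tu subrr mulr0 atan0 mulr0 subr0 in H; apply: le_trans (H _) _ => {H}.
  - move=> s; rewrite normrM (gtr0_norm (bell_gt0 _ _ _)) mulrA divfK ?gt_eqF//.
    by apply: ler_wpM2r; [exact: ltW (bell_gt0 _ _ _)|exact: Mg].
  - have MN : 0 <= M / N by rewrite divr_ge0// ltW.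
    rewrite normrM (ger0_norm MN).
    have : `|atan (N * (t - t0))| <= 2.
      rewrite ler_norml; have := pi2_le2; have := atan_ltpi2 (N * (t - t0)).
      have := atan_gtNpi2 (N * (t - t0)); lra.
    move=> /(ler_wpM2l MN); rewrite /D0; lra.
pose e n := 2 * (D0 / 2 ^+ n).
have eS n : e n = e n.+1 + D0 / 2 ^+ n.
  by rewrite /e exprS; field; rewrite expf_neq0// pnatr_eq0.
have e_ge0 n : 0 <= e n by rewrite /e mulr_ge0// divr_ge0// exprn_ge0.
have lo t m n : (m <= n)%N -> u m t - e m <= u n t - e n.
  move=> /subnK <-; elim: (n - m)%N => [|k IH]; first by rewrite add0n.
  apply: (le_trans IH); rewrite addSn (eS (k + m)%N).
  by have := du (k + m)%N t; rewrite ler_norml => /andP[]; lra.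
have hi t m n : (m <= n)%N -> u n t + e n <= u m t + e m.
  move=> /subnK <-; elim: (n - m)%N => [|k IH]; first by rewrite add0n.
  apply: le_trans IH; rewrite addSn (eS (k + m)%N).
  by have := du (k + m)%N t; rewrite ler_norml => /andP[]; lra.
(* The lower bounds u n - e n increase and the upper bounds u n + e n decrease to the same limit. *)
pose x t := sup (range (fun n => u n t - e n)).
have ubx t m : ubound (range (fun n => u n t - e n)) (u m t + e m).
  move=> _ [n _ <-]; case: (leqP m n) => [mn|/ltnW nm].
    by have := hi t _ _ mn; have := e_ge0 n; lra.
  by have := lo t _ _ nm; have := e_ge0 m; lra.
have xu n t : `|x t - u n t| <= e n.
  rewrite ler_norml; apply/andP; split.
    rewrite lerBrDr addrC; apply: ub_le_sup; last by exists n.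
    by exists (u 0%N t + e 0%N); exact: ubx.
  rewrite lerBlDr addrC; apply: ge_sup; last exact: ubx.
  by exists (u 0%N t - e 0%N); exists 0%N.
have small (d : R) : 0 < d -> exists n, e n < d.
  move=> d0; exists (Num.bound (2 * D0 / d)).
  have := @upper_nthrootP R (2 * D0 / d) _ (leqnn _).
  rewrite ltr_pdivrMr//; set q := (2 ^+ _) => H.
  rewrite /e mulrA ltr_pdivrMr; last by rewrite exprn_gt0.
  by rewrite [ltRHS]mulrC.
have cx : continuous x.
  move=> t; apply/continuous_epsP => d d0.
  have [|n en] := small (d / 3); first by rewrite divr_gt0.
  have /continuous_epsP/(_ (d / 3)) := cu n t; case; first by rewrite divr_gt0.
  move=> r r0 rP; exists r => // s /rP.
  have := xu n t; have := xu n s; rewrite !ler_norml !ltr_norml.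
  move=> /andP[? ?] /andP[? ?] /andP[? ?]; apply/andP; split; lra.
have [E1 E2] := HT x cx.
suff E : x = T x by exists x => [|t]; [rewrite E|have := E2 t; rewrite -E].
apply/funext => t; apply/eqP; rewrite -subr_eq0 -normr_le0.
apply/ler_addgt0Pl => d d0; rewrite addr0.
have [n en] := small _ d0.
have TT := contr _ _ _ cx (cu n) (e_ge0 n) (xu n) t.
have xS := xu n.+1 t; rewrite (_ : u n.+1 = T (u n))// in xS.
have eE : e n.+1 = e n / 2 by rewrite /e exprS invfM; field; rewrite expf_neq0// pnatr_eq0.
rewrite ler_norml in TT; rewrite ler_norml in xS; rewrite ler_norml.
move: TT xS => /andP[? ?] /andP[? ?]; apply/andP; split; lra.
Qed.

End ClairautPicard.

(** * Curves in an open set *)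

Section Barriers.
Variable R : realType.
Implicit Types (p q r : R * R) (w h : R * R -> R).

(** The supremum of the exit times is attained, because the good times form an open set. *)
Lemma last_exit (Q : R -> Prop) (s0 t1 : R) :
  (forall s, s0 <= s <= t1 -> Q s -> exists2 r : R, 0 < r & forall s', `|s' - s| < r -> Q s') ->
  s0 <= t1 -> ~ Q s0 -> Q t1 ->
  exists a, [/\ s0 <= a, a < t1, ~ Q a & forall s, a < s <= t1 -> Q s].
Proof.
move=> oQ s01 nQ0 Q1; pose A := [set s | s <= t1 /\ ~ Q s].
have A0 : A s0 by [].
have ubA : ubound A t1 by move=> s [].
have hA : has_sup A by split; [exists s0|exists t1].
have sA : sup A <= t1 by apply: ge_sup => //; exists s0.
have s0A : s0 <= sup A by apply: ub_le_sup => //; exists t1.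
have nQs : ~ Q (sup A).
  have /oQ H : s0 <= sup A <= t1 by rewrite s0A.
  move=> /H[r r0 rP]; have [s [st1 nQs] sr] := sup_adherent r0 hA.
  have sS : s <= sup A by apply: ub_le_sup; [exists t1|].
  apply: nQs; apply: rP; rewrite ltr_norml; apply/andP; split; lra.
exists (sup A); split => //.
  by rewrite lt_neqAle sA andbT; apply/eqP => E; apply: nQs; rewrite E.
move=> s /andP[As st1]; apply: contrapT => nQ.
suff : s <= sup A by rewrite leNgt As.
by apply: ub_le_sup; [exists t1|].
Qed.

Lemma first_exit (Q : R -> Prop) (t0 s1 : R) :
  (forall s, t0 <= s <= s1 -> Q s -> exists2 r : R, 0 < r & forall s', `|s' - s| < r -> Q s') ->
  t0 <= s1 -> Q t0 -> ~ Q s1 ->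
  exists b, [/\ b <= s1, t0 < b, ~ Q b & forall s, t0 <= s < b -> Q s].
Proof.
move=> oQ s01 Q0 nQ1.
have [||||a [a1 a2 a3 a4]] := @last_exit (fun s => Q (- s)) (- s1) (- t0).
- move=> s /andP[h1 h2] Qs; have [|r r0 rP] := oQ _ _ Qs.
    by rewrite lerNr h2 lerNl h1.
  by exists r => // s' s's; apply: rP; rewrite -opprD normrN.
- by rewrite lerN2.
- by rewrite opprK.
- by rewrite opprK.
- exists (- a); split => //; [by rewrite lerNl|by rewrite ltrNr|].
  move=> s /andP[h1 h2]; have := a4 (- s); rewrite opprK; apply.
  by rewrite ltrNr h2 lerN2.
Qed.

(** Continuous induction on a segment. *)
Lemma segment_clopen (Q : R -> Prop) (T : R) : 0 <= T -> Q 0 ->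
  (forall s, 0 <= s <= T -> Q s ->
     exists2 r : R, 0 < r & forall s', 0 <= s' <= T -> `|s' - s| < r -> Q s') ->
  (forall s, 0 <= s <= T ->
     (forall r : R, 0 < r -> exists s', [/\ 0 <= s' <= T, `|s' - s| < r & Q s']) -> Q s) ->
  Q T.
Proof.
move=> T0 Q0 oQ cQ; apply: contrapT => nQT.
pose Q' s := Q (Num.min T (Num.max 0 s)).
have clamp s : 0 <= Num.min T (Num.max 0 s) <= T.
  by rewrite ge_min lexx /= le_min T0 le_max lexx.
have clampE s : 0 <= s <= T -> Num.min T (Num.max 0 s) = s.
  by move=> /andP[s0 sT]; rewrite (max_idPr s0) (min_idPr sT).
have maxL (a b : R) : `|Num.max 0 a - Num.max 0 b| <= `|a - b|.
  rewrite ler_norml; have := ler_norm (a - b); have := ler_norm (b - a); rewrite distrC.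
  by case: (leP 0 a) => ?; case: (leP 0 b) => ? ? ?; apply/andP; split; lra.
have minL (a b : R) : `|Num.min T a - Num.min T b| <= `|a - b|.
  rewrite ler_norml; have := ler_norm (a - b); have := ler_norm (b - a); rewrite distrC.
  by case: (leP T a) => ?; case: (leP T b) => ? ? ?; apply/andP; split; lra.
have clampL s s' : `|Num.min T (Num.max 0 s') - Num.min T (Num.max 0 s)| <= `|s' - s|.
  exact: le_trans (minL _ _) (maxL _ _).
have [||||b [b1 b2 b3 b4]] := @first_exit Q' 0 T.
- move=> s _ /(oQ _ (clamp s))[r r0 rP]; exists r => // s' s's.
  by apply: rP => //; exact: le_lt_trans s's.
- by [].
- by rewrite /Q' clampE ?lexx.
- by rewrite /Q' clampE// lexx T0.
apply: b3; rewrite /Q' clampE; last by rewrite b1 ltW.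
apply: cQ; first by rewrite b1 ltW.
move=> r r0; pose s := Num.max 0 (b - r / 2).
have s0 : 0 <= s by rewrite le_max lexx.
have sb : s < b by rewrite gt_max b2 gtrBl divr_gt0.
have sT : 0 <= s <= T by rewrite s0 (le_trans (ltW sb)).
exists s; split => //.
  rewrite distrC gtr0_norm ?subr_gt0// ltrBlDl -ltrBlDr lt_max; apply/orP; right; lra.
by rewrite -(clampE _ sT); apply: b4; rewrite s0.
Qed.

(** The largest K-Lipschitz minorant of w. Where w is locally
    bounded below by a positive constant the minorant is positive too, and it can serve as the
    right-hand side of an ordinary differential equation on the whole plane. *)
Definition lipschitz_minorant (K : R) w p : R := inf (range (fun q => K * `|p - q| + w q)).

Section Minorant.
Variables (K M : R) (w : R * R -> R).
Hypotheses (K0 : 0 <= K) (w0 : forall q, 0 <= w q) (wM : forall q, w q <= M).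
Local Notation m := (lipschitz_minorant K w).

Lemma minorant_lb p : lbound (range (fun q => K * `|p - q| + w q)) 0.
Proof. by move=> _ [q _ <-]; rewrite addr_ge0// mulr_ge0. Qed.

Lemma minorant_le p q : m p <= K * `|p - q| + w q.
Proof.
by apply: ge_inf; [exists 0; exact: minorant_lb|exists q].
Qed.

Lemma minorant_ge p (v : R) : (forall q, v <= K * `|p - q| + w q) -> v <= m p.
Proof. by move=> H; apply: lb_le_inf; [exists (K * `|p - p| + w p); exists p|move=> _ [q _ <-]]. Qed.

Lemma minorant_ge0 p : 0 <= m p.
Proof. by apply: minorant_ge => q; rewrite addr_ge0// mulr_ge0. Qed.

Lemma minorant_le_self p : m p <= w p.
Proof. by have := minorant_le p p; rewrite subrr normr0 mulr0 add0r. Qed.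

Lemma minorant_norm p : `|m p| <= M.
Proof. by rewrite ger0_norm ?minorant_ge0//; apply: le_trans (wM p); exact: minorant_le_self. Qed.

Lemma minorant_lip p p' : `|m p - m p'| <= K * `|p - p'|.
Proof.
have key a b : m a <= K * `|a - b| + m b.
  rewrite -lerBlDl; apply: minorant_ge => q; rewrite lerBlDl.
  apply: (le_trans (minorant_le a q)); rewrite addrA lerD2r -mulrDr ler_wpM2l//.
  by apply: le_trans (ler_normD _ _); rewrite addrA subrK.
have := key p p'; have := key p' p; rewrite distrC ler_norml => ? ?.
by apply/andP; split; lra.
Qed.

Lemma minorant_ge_near p (v r : R) : 0 <= v -> v <= K * r ->
  (forall q, `|q - p| < r -> v <= w q) -> v <= m p.
Proof.
move=> v0 vK H; apply: minorant_ge => q; case: (ltP `|p - q| r) => [|rq].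
  rewrite distrC => /H; have := mulr_ge0 K0 (normr_ge0 (p - q)).
  by rewrite distrC; lra.
have := ler_wpM2l K0 rq; have := w0 q; lra.
Qed.

End Minorant.

(** The 1-Lipschitz minorant of the indicator function of U is positive on U and vanishes off
    it; its minimum along the arc is an admissible width. *)
Lemma arc_tube (U : set (R * R)) (c : R -> R * R) (a b : R) : open U -> a <= b ->
  (forall s, a <= s <= b -> {for s, continuous c}) ->
  (forall s, a <= s <= b -> U (c s)) ->
  exists2 r : R, 0 < r & forall s q, a <= s <= b -> `|q - c s| < r -> U q.
Proof.
move=> oU ab cc Uc; pose w q : R := if `[< U q >] then 1 else 0.
have w0 q : 0 <= w q by rewrite /w; case: ifP.
pose m := lipschitz_minorant 1 w.
have m_lip := minorant_lip (@ler01 R) w0.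
have [|s sab smin] := @EVT_min R (m \o c) a b ab.
  apply: continuous_in_subspaceT => s; rewrite inE /= in_itv /= => /cc cs.
  apply/continuous_epsP => e e0; move/continuous_epsP/(_ _ e0): cs => [d d0 dP].
  exists d => // y /dP; apply: le_lt_trans; rewrite -[leRHS]mul1r; exact: m_lip.
rewrite in_itv /= in sab.
have ms : 0 < m (c s).
  have /open_epsP/(_ _ (Uc s sab))[r r0 rP] := oU.
  apply: (@lt_le_trans _ _ (Num.min 1 r)); first by rewrite lt_min ltr01.
  apply: (@minorant_ge_near 1 w ler01 w0 _ _ r).
  - by rewrite le_min ler01 ltW.
  - by rewrite mul1r ge_min lexx orbT.
  - by move=> q /rP Uq; rewrite /w; case: asboolP => // _; rewrite ge_min lexx.
exists (m (c s)) => // s' q s'ab qc.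
have mq : 0 < m q.
  have := m_lip (c s') q; rewrite mul1r distrC => H.
  have : m (c s) <= m (c s') by apply: smin; rewrite in_itv.
  have := ler_norm (m (c s') - m q); rewrite distrC [`|c s' - q|]distrC in H *; lra.
have : m q <= w q by exact: (minorant_le_self ler01 w0 q).
rewrite /w.
by case: asboolP => // _; lra.
Qed.

(** Curves with slope - 2 + h k, which drift off the lines x + 2 t = const. For 0 < h k < 4 + Psi
    the slope lies between those of Lbar and L, and the curve is timelike; the weight k serves
    to solve the equation on the whole line in one stroke. *)
Lemma drift_curve (K M : R) h r : 0 <= K ->
  (forall p q, `|h p - h q| <= K * `|p - q|) -> (forall p, `|h p| <= M) ->
  exists x dx : R -> R, [/\ x r.1 = r.2, forall t : R, is_derive t 1 x (dx t),
    continuous dx & forall t, dx t = - 2 + h (t, x t) * bell (4 * K + 1) r.1 t].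
Proof.
move=> K0 Lh Mh.
have ch : continuous h.
  move=> p; apply/continuous_epsP => e e0.
  exists (e / (K + 1)); first by rewrite divr_gt0// ltr_wpDl.
  move=> q; rewrite ltr_pdivlMr ?ltr_wpDl// => qe; apply: le_lt_trans (Lh q p) _.
  by have := normr_ge0 (q - p); lra.
pose g p := h (p.1, p.2 - 2 * p.1).
have cg : continuous g.
  move=> p; apply: (@continuous_comp _ _ _ (fun p => (p.1, p.2 - 2 * p.1)) h); last exact: ch.
  apply: (@continuous_pair _ _ (fun p => p.1) (fun p => p.2 - 2 * p.1)); first exact: cvg_fst.
  by apply: cvgB; [exact: cvg_snd|apply: cvgM; [exact: cvg_cst|exact: cvg_fst]].
have N0 : 0 < 4 * K + 1 by rewrite ltr_wpDl// mulr_ge0.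
have KN : 4 * K <= 4 * K + 1 by rewrite lerDl.
have [||u u0 u'] := picard r.1 (r.2 + 2 * r.1) N0 K0 KN cg (M := M).
- move=> t x y; apply: (le_trans (Lh _ _)); rewrite ler_wpM2l//.
  by rewrite norm_pair_le /= subrr normr0 normr_ge0 /= opprB addrA subrK.
- by move=> p; exact: Mh.
have dx (t : R) : is_derive t 1 (fun s : R => u s - 2 * s) (- 2 + h (t, u t - 2 * t) * bell (4 * K + 1) r.1 t).
  apply: (is_derive_eq (is_deriveB (u' t) (is_deriveZ 2 (is_derive_id t (1:R))))).
  by rewrite /g /= /GRing.scale /=; ring.
exists (fun s => u s - 2 * s), (fun t => - 2 + h (t, u t - 2 * t) * bell (4 * K + 1) r.1 t).
split => //; first by rewrite u0 addrK.
move=> t; apply: cvgD; first exact: cvg_cst.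
apply: (@continuousM _ _ (fun t => h (t, u t - 2 * t)) (bell _ _)); last exact: continuous_bell.
apply: (@continuous_comp _ _ _ (fun t => (t, u t - 2 * t)) h); last exact: ch.
by apply: continuous_pair; [exact: cvg_id|exact: is_derive_continuous (dx t)].
Qed.

End Barriers.

(** * Global hyperbolicity forces the method of characteristics *)

Section ContinuityHelpers.
Variable R : realType.

Lemma has_gradient_continuous (f : R * R -> R) p a b :
  has_gradient f p a b -> {for p, continuous f}.
Proof.
move=> H; apply/continuous_epsP => e e0; have [r r0 rP] := H 1 ltr01.
pose B := `|a| + `|b| + 2.
have B0 : 0 < B by rewrite /B; have := normr_ge0 a; have := normr_ge0 b; lra.
exists (Num.min r (e / B)) => [|q]; first by rewrite lt_min r0 divr_gt0.
rewrite norm_pair_lt !lt_min !ltr_pdivlMr//= => /andP[/andP[h1 h2] /andP[k1 k2]].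
have := rP _ _ h1 k1; set h := q.1 - p.1; set k := q.2 - p.2.
have -> : p.1 + h = q.1 by rewrite /h; ring.
have -> : p.2 + k = q.2 by rewrite /k; ring.
rewrite mul1r -surjective_pairing => K.
rewrite (_ : f q - f p = (f q - f p - (h * a + k * b)) + (h * a + k * b)); last by ring.
apply: (le_lt_trans (ler_normD _ _)).
apply: (@le_lt_trans _ _ ((`|h| + `|k|) + (`|h| * `|a| + `|k| * `|b|))).
  by apply: lerD => //; apply: (le_trans (ler_normD _ _)); rewrite !normrM.
have := normr_ge0 h; have := normr_ge0 k; have := normr_ge0 a; have := normr_ge0 b.
rewrite -/h in h2; rewrite -/k in k2.
move: `|h| `|k| `|a| `|b| @B B0 h2 k2 => x y u v B B0 h2 k2 *; rewrite /B in h2 k2 B0.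
nra.
Qed.

Lemma continuous_near_lt (V : normedModType R) (g : V -> R) (p : V) (v : R) :
  {for p, continuous g} -> g p < v -> exists2 r : R, 0 < r & forall q, `|q - p| < r -> g q < v.
Proof.
move=> /continuous_epsP H gv; have [|r r0 rP] := H (v - g p); first by rewrite subr_gt0.
exists r => // q /rP; have := ler_norm (g q - g p); lra.
Qed.

Lemma continuous_near_gt (V : normedModType R) (g : V -> R) (p : V) (v : R) :
  {for p, continuous g} -> v < g p -> exists2 r : R, 0 < r & forall q, `|q - p| < r -> v < g q.
Proof.
move=> /continuous_epsP H gv; have [|r r0 rP] := H (g p - v); first by rewrite subr_gt0.
exists r => // q /rP; have := ler_norm (g p - g q); rewrite distrC; lra.
Qed.

Lemma glue_continuous (f g : R -> R) (x0 : R) : f x0 = g x0 -> forall x,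
  (x <= x0 -> {for x, continuous f}) -> (x0 <= x -> {for x, continuous g}) ->
  {for x, continuous (fun y => if y <= x0 then f y else g y)}.
Proof.
move=> fg x Hf Hg; apply/continuous_epsP => e e0.
case: (ltgtP x x0) => [xx0|xx0|xx0].
- have /continuous_epsP/(_ _ e0)[r r0 rP] := Hf (ltW xx0).
  exists (Num.min r (x0 - x)) => [|y]; first by rewrite lt_min r0 subr_gt0.
  rewrite lt_min => /andP[/rP yr]; have := ler_norm (y - x) => ? ?.
  by rewrite (_ : y <= x0)//; lra.
- have /continuous_epsP/(_ _ e0)[r r0 rP] := Hg (ltW xx0).
  exists (Num.min r (x - x0)) => [|y]; first by rewrite lt_min r0 subr_gt0.
  rewrite lt_min => /andP[/rP yr]; have := ler_norm (x - y); rewrite distrC => ? ?.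
  by rewrite leNgt (_ : x0 < y)//; lra.
- rewrite xx0 in Hf Hg *.
  have /continuous_epsP/(_ _ e0)[r r0 rP] := Hf (lexx _).
  have /continuous_epsP/(_ _ e0)[r' r'0 r'P] := Hg (lexx _).
  exists (Num.min r r') => [|y]; first by rewrite lt_min r0.
  rewrite lt_min => /andP[yr yr'] /=; case: ifPn => _; first exact: rP.
  by rewrite fg; exact: r'P.
Qed.

Lemma continuous_curve_open (U : set (R * R)) (x : R -> R) (s : R) : open U ->
  {for s, continuous x} -> U (s, x s) ->
  exists2 r : R, 0 < r & forall s', `|s' - s| < r -> U (s', x s').
Proof.
move=> /open_epsP oU /continuous_epsP cx Us; have [r r0 rP] := oU _ Us.
have [d d0 dP] := cx _ r0; exists (Num.min r d) => [|s']; first by rewrite lt_min r0.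
by rewrite lt_min => /andP[h1 /dP h2]; apply: rP; rewrite norm_pair_lt h1.
Qed.

End ContinuityHelpers.

Lemma drift_timelike (R : realType) (d ps : R) : (0 < d < 4 + ps) \/ (4 + ps < d < 0) ->
  (- 2 + d + 2) * (- 2 + d - (2 + ps)) < 0.
Proof.
have -> : - 2 + d + 2 = d by ring.
by move=> [/andP[d0 d1]|/andP[d1 d0]]; [rewrite pmulr_rlt0|rewrite nmulr_rlt0]; lra.
Qed.

(** Here psi is any C^1 solution of the Burgers equation psi_t + (2 + psi) psi_x = 0 on an open set
    U around the line t = 0. Global hyperbolicity enters only through gh: a graph over t that is
    timelike wherever it lies in U cannot issue into U from a point (a, x a) outside U with
    a >= 0. *)
Section Uniqueness.
Variable R : realType.
Implicit Types p q r : R * R.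
Variables (U : set (R * R)) (psi pt px : R * R -> R).
Hypotheses (oU : open U) (SU : forall x, U (0, x)).
Hypothesis dt : forall p, U p -> is_derive p (axis R false) psi (pt p).
Hypothesis dx : forall p, U p -> is_derive p (axis R true) psi (px p).
Hypothesis ct : forall p, U p -> {for p, continuous pt}.
Hypothesis cx : forall p, U p -> {for p, continuous px}.
Hypothesis burgers : forall p, U p -> pt p + (2 + psi p) * px p = 0.
Hypothesis psiN4 : forall p, U p -> psi p <> - 4.
Hypothesis init : forall x, - 4 < psi (0, x).
Hypothesis gh : forall (x dx : R -> R) (a t1 : R), 0 <= a -> a < t1 ->
  (forall t : R, a <= t -> is_derive t 1 x (dx t)) ->
  (forall t, a <= t -> {for t, continuous dx}) ->
  ~ U (a, x a) -> (forall s, a < s <= t1 -> U (s, x s)) ->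
  (forall s, a < s -> U (s, x s) -> (dx s + 2) * (dx s - (2 + psi (s, x s))) < 0) ->
  False.

Let grad p : U p -> has_gradient psi p (pt p) (px p).
Proof. by move=> Up; apply: (C1_has_gradient oU) => //; [exact: ct|exact: cx]. Qed.

Let cpsi p : U p -> {for p, continuous psi}.
Proof. by move=> /grad; exact: has_gradient_continuous. Qed.

Let oUP p : U p -> exists2 r : R, 0 < r & forall q, `|q - p| < r -> U q.
Proof. by move: p; apply/open_epsP. Qed.

(** The gap 4 + psi between the slopes of L and Lbar, truncated at M, on the part of U where it
    has the sign s. *)
Definition margin (s M : R) q : R :=
  if `[< U q /\ 0 < s * (4 + psi q) >] then Num.min M (s * (4 + psi q)) else 0.

Let margin_ge0 s M q : 0 <= M -> 0 <= margin s M q.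
Proof.
by move=> M0; rewrite /margin; case: asboolP => // -[_ ?]; rewrite le_min M0 ltW.
Qed.

Let margin_leM s M q : 0 <= M -> margin s M q <= M.
Proof. by move=> M0; rewrite /margin; case: asboolP => // _; rewrite ge_min lexx. Qed.

Let margin_le s M q : 0 < s * (4 + psi q) -> margin s M q <= s * (4 + psi q).
Proof.
by move=> H; rewrite /margin; case: asboolP => // [_|_]; [rewrite ge_min lexx orbT|exact: ltW].
Qed.

Let margin_eq0 s M q : s * (4 + psi q) <= 0 -> margin s M q = 0.
Proof. by move=> H; rewrite /margin; case: asboolP => // -[_]; rewrite ltNge H. Qed.

Let margin_near s M q v : U q -> 0 <= v -> v < M -> v < s * (4 + psi q) ->
  exists2 r : R, 0 < r & forall q', `|q' - q| < r -> v <= margin s M q'.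
Proof.
move=> Uq v0 vM vs; have [r1 r10 r1P] := oUP Uq.
have cg : {for q, continuous (fun q => s * (4 + psi q))}.
  by apply: cvgM; [exact: cvg_cst|apply: cvgD; [exact: cvg_cst|exact: cpsi]].
have [r2 r20 r2P] := continuous_near_gt cg vs.
exists (Num.min r1 r2) => [|q']; first by rewrite lt_min r10.
rewrite lt_min => /andP[/r1P Uq' /r2P vq']; rewrite /margin asboolT.
  by rewrite le_min !ltW.
by split => //; exact: le_lt_trans vq'.
Qed.

Local Notation minor K s M := (lipschitz_minorant K (margin s M)).

Let minor_gt0 K s M q : 0 < K -> 0 < M -> U q -> 0 < s * (4 + psi q) -> 0 < minor K s M q.
Proof.
move=> K0 M0 Uq sq; pose v := Num.min M (s * (4 + psi q)) / 2.
have v20 : 0 < Num.min M (s * (4 + psi q)) by rewrite lt_min M0.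
have v0 : 0 < v by rewrite divr_gt0.
have : v < Num.min M (s * (4 + psi q)) by rewrite ltr_pdivrMr// ltr_pMr// ltrDl.
rewrite lt_min => /andP[vM vs].
have [r r0 rP] := margin_near Uq (ltW v0) vM vs.
apply: (@lt_le_trans _ _ (Num.min v (K * r))); first by rewrite lt_min v0 mulr_gt0.
apply: (minorant_ge_near (ltW K0) (fun q => margin_ge0 s q (ltW M0)) (r := r)).
- by rewrite le_min !ltW// mulr_gt0.
- by rewrite ge_min lexx orbT.
- by move=> q' /rP; apply: le_trans; rewrite ge_min lexx.
Qed.

(** Since psi <> - 4, only the connectedness of U in the future of Sigma is at stake: a curve
    that is timelike whatever the sign of 4 + psi connects the point to Sigma, by gh, and psi
    cannot cross the value - 4 along it. *)
Lemma psi_gtN4 p : U p -> 0 <= p.1 -> - 4 < psi p.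
Proof.
move=> Up p0.
(* Only the minorant for the sign of 4 + psi is nonzero at a point of U. *)
pose h q := (minor 1 1 1 q - minor 1 (-1) 1 q) / 2.
have mg s q : 0 <= margin s 1 q by exact: margin_ge0.
have mM s q : margin s 1 q <= 1 by exact: margin_leM.
have Lh q q' : `|h q - h q'| <= 1 * `|q - q'|.
  have H1 := minorant_lip ler01 (mg 1) q q'.
  have H2 := minorant_lip ler01 (mg (-1)) q q'.
  rewrite /h; move: H1 H2; rewrite !ler_norml => /andP[? ?] /andP[? ?].
  apply/andP; split; lra.
have Mh q : `|h q| <= 1.
  have H1 := minorant_norm ler01 (mg 1) (mM 1) q.
  have H2 := minorant_norm ler01 (mg (-1)) (mM (-1)) q.
  rewrite /h; move: H1 H2; rewrite !ler_norml => /andP[? ?] /andP[? ?].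
  apply/andP; split; lra.
have [x [dx' [xp x' cdx dxE]]] := drift_curve p ler01 Lh Mh.
have cxx s : {for s, continuous x} by exact: is_derive_continuous (x' s).
have tl s : U (s, x s) -> (dx' s + 2) * (dx' s - (2 + psi (s, x s))) < 0.
  move=> Us; rewrite dxE; set q := (s, x s); set k := bell _ _ _.
  have k0 : 0 < k by exact: bell_gt0.
  have k1 : k <= 1 by exact: bell_le1.
  have ge0 e : 0 <= minor 1 e 1 q by exact: (minorant_ge0 ler01 (mg e)).
  have lew e : minor 1 e 1 q <= margin e 1 q by exact: (minorant_le_self ler01 (mg e)).
  have [pos|neg] : - 4 < psi q \/ psi q < - 4.
    by case: (ltgtP (- 4) (psi q)) => [|_|/esym /psiN4//]; [left|right].
  - have e1 : minor 1 (-1) 1 q = 0.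
      by apply/eqP; rewrite eq_le ge0 andbT (le_trans (lew _))// margin_eq0//; lra.
    have e2 : 0 < minor 1 1 1 q by apply: minor_gt0 => //; lra.
    have e3 : minor 1 1 1 q <= 4 + psi q.
      by apply: (le_trans (lew _)); rewrite -[leRHS]mul1r; apply: margin_le; lra.
    apply: drift_timelike; left; rewrite /h e1 subr0.
    move: (minor 1 1 1 q) (psi q) e2 e3 => m ps m0 m1.
    have : m / 2 * k <= m / 2 by rewrite ler_piMr// divr_ge0// ltW.
    have : 0 < m / 2 * k by rewrite !mulr_gt0.
    by move=> ? ?; apply/andP; split; lra.
  - have e1 : minor 1 1 1 q = 0.
      by apply/eqP; rewrite eq_le ge0 andbT (le_trans (lew _))// margin_eq0//; lra.
    have e2 : 0 < minor 1 (-1) 1 q by apply: minor_gt0 => //; lra.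
    have e3 : minor 1 (-1) 1 q <= -1 * (4 + psi q).
      by apply: (le_trans (lew _)); apply: margin_le; lra.
    apply: drift_timelike; right; rewrite /h e1 sub0r.
    move: (minor 1 (-1) 1 q) (psi q) e2 e3 => m ps m0 m1.
    have : m / 2 * k <= m / 2 by rewrite ler_piMr// divr_ge0// ltW.
    have : 0 < m / 2 * k by rewrite !mulr_gt0.
    by rewrite mulNr mulNr => ? ?; apply/andP; split; lra.
have inU s : 0 <= s <= p.1 -> U (s, x s).
  move=> /andP[s0 sp]; apply: contrapT => nU.
  have [||a [a1 a2 a3 a4]] := @last_exit _ (fun s => U (s, x s)) s p.1 _ sp nU.
  - by move=> s' _; apply: continuous_curve_open.
  - by rewrite xp -surjective_pairing.
  by apply: (gh (le_trans s0 a1) a2 (fun t _ => x' t) (fun t _ => cdx t) a3 a4) => t _; exact: tl.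
rewrite ltNge; apply/negP => pN4.
have [||s s01 sE] := @IVT0 _ (fun s => psi (s, x s) + 4) 0 p.1 p0.
- move=> s /inU Us; apply: cvgD; last exact: cvg_cst.
  apply: (@continuous_comp _ _ _ (fun s => (s, x s)) psi); last exact: cpsi.
  by apply: continuous_pair; [exact: cvg_id|exact: cxx].
- by right; rewrite xp -surjective_pairing; have := init (x 0); lra.
- by apply: (@psiN4 (s, x s)); [exact: inU|lra].
Qed.

(** Take for h a multiple th < 1 of the minorant of 4 + psi, with th adjusted to the initial slope v;
    K is so large that the minorant at r still exceeds v + 2. *)
Lemma timelike_extension r v : U r -> 0 <= r.1 -> - 2 < v < 2 + psi r ->
  exists x dx : R -> R, [/\ x r.1 = r.2, dx r.1 = v,
    forall t : R, is_derive t 1 x (dx t), continuous dx &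
    forall s, 0 <= s -> U (s, x s) -> (dx s + 2) * (dx s - (2 + psi (s, x s))) < 0].
Proof.
move=> Ur r0 /andP[v1 v2]; pose M := 4 + psi r; pose v' := (v + 2 + M) / 2.
have M0 : 0 < M by rewrite /M; lra.
have v'0 : 0 < v' by rewrite /v' /M; lra.
have v'M : v' < M by rewrite /v' /M; lra.
have vv' : v + 2 < v' by rewrite /v' /M; lra.
have mg q : 0 <= margin 1 M q by apply: margin_ge0; exact: ltW.
have mM q : margin 1 M q <= M by apply: margin_leM; exact: ltW.
have [|d d0 dP] := @margin_near 1 M r v' Ur (ltW v'0) v'M; first by rewrite mul1r.
pose K := v' / d; have K0 : 0 < K by rewrite divr_gt0.
have mr : v' <= minor K 1 M r.
  apply: (minorant_ge_near (ltW K0) mg (ltW v'0) _ dP).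
  by rewrite /K divfK// gt_eqF.
have mr0 : 0 < minor K 1 M r by lra.
pose th := (v + 2) / minor K 1 M r.
have th0 : 0 < th by rewrite divr_gt0//; lra.
have th1 : th < 1 by rewrite ltr_pdivrMr// mul1r; lra.
pose h q := th * minor K 1 M q.
have Lh q q' : `|h q - h q'| <= K * `|q - q'|.
  rewrite /h -mulrBr normrM (gtr0_norm th0); have H := minorant_lip (ltW K0) mg q q'.
  by apply: le_trans H; rewrite ler_piMl// ltW.
have Mh q : `|h q| <= M.
  rewrite /h normrM (gtr0_norm th0); have H := minorant_norm (ltW K0) mg mM q.
  by apply: le_trans H; rewrite ler_piMl// ltW.
have [x [dx' [xr x' cdx dxE]]] := drift_curve r (ltW K0) Lh Mh.
exists x, dx'; split => //.
  rewrite dxE bell_center mulr1 xr -surjective_pairing /h /th divfK ?gt_eqF//; ring.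
move=> s s0 Us; rewrite dxE; set k := bell _ _ _.
have k0 : 0 < k by exact: bell_gt0.
have k1 : k <= 1 by exact: bell_le1.
have pN4 : - 4 < psi (s, x s) by exact: psi_gtN4.
have m0 : 0 < minor K 1 M (s, x s) by apply: minor_gt0 => //; lra.
have m1 : minor K 1 M (s, x s) <= 4 + psi (s, x s).
  apply: (le_trans (minorant_le_self (ltW K0) mg _)); rewrite -[leRHS]mul1r.
  by apply: margin_le; lra.
have hk0 : 0 < h (s, x s) * k by apply: mulr_gt0 => //; exact: mulr_gt0.
have hk1 : h (s, x s) * k < 4 + psi (s, x s).
  apply: (@le_lt_trans _ _ (h (s, x s))); first by apply: ler_piMr => //; apply: ltW; exact: mulr_gt0.
  by apply: lt_le_trans m1; rewrite /h gtr_pMl.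
by apply: drift_timelike; left; rewrite hk0 hk1.
Qed.

(** If the Lbar-line from p down to time s met the complement of U, a timelike curve of slope
    close to - 2 issuing from the missing point would pass so close to p that it enters U, which
    contradicts gh. *)
Lemma vertical_segment p s : U p -> 0 <= s <= p.1 -> U (s, p.2 + 2 * (p.1 - s)).
Proof.
move=> Up /andP[s0 sp]; apply: contrapT; set q := (s, _) => nU.
have [r r0 rP] := oUP Up.
have sp' : s < p.1.
  rewrite lt_neqAle sp andbT; apply/eqP => E; apply: nU.
  by rewrite /q E subrr mulr0 addr0 -surjective_pairing.
pose c := Num.min 2^-1 (r / (p.1 - s + 1)).
have d0 : 0 < p.1 - s by rewrite subr_gt0.
have d10 : 0 < p.1 - s + 1 by lra.
have c0 : 0 < c by rewrite lt_min invr_gt0 ltr0n divr_gt0.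
have c1 : c <= 2^-1 by rewrite ge_min lexx.
have cd : c * (p.1 - s) < r.
  have : c * (p.1 - s + 1) <= r by rewrite -ler_pdivlMr// ge_min lexx orbT.
  lra.
have mg q' : 0 <= margin 1 1 q' by exact: margin_ge0.
have mM q' : margin 1 1 q' <= 1 by exact: margin_leM.
pose h q' := c * minor 1 1 1 q'.
have c1' : c <= 1 by lra.
have Lh q' q'' : `|h q' - h q''| <= 1 * `|q' - q''|.
  rewrite /h -mulrBr normrM (gtr0_norm c0); have H := minorant_lip ler01 mg q' q''.
  by apply: le_trans H; rewrite ler_piMl.
have Mh q' : `|h q'| <= 1.
  rewrite /h normrM (gtr0_norm c0); have H := minorant_norm ler01 mg mM q'.
  by apply: le_trans H; rewrite ler_piMl.
have [x [dx' [xq x' cdx dxE]]] := drift_curve q ler01 Lh Mh.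
have h0 q' : 0 <= h q' by apply: mulr_ge0; [exact: ltW|exact: (minorant_ge0 ler01 mg)].
have hc q' : h q' <= c.
  apply: ler_piMr; first exact: ltW.
  by apply: le_trans (ler_norm _) _; exact: (minorant_norm ler01 mg mM).
have k0 t : 0 < bell (4 * 1 + 1) q.1 t by exact: bell_gt0.
have k1 t : bell (4 * 1 + 1) q.1 t <= 1 by exact: bell_le1.
have Up1 : U (p.1, x p.1).
  apply: rP; rewrite norm_pair_lt /= subrr normr0 r0 /=.
  have [t _ E] := mean_value sp' (fun t _ => x' t).
  have -> : x p.1 - p.2 = (dx' t + 2) * (p.1 - s) by move: E; rewrite xq /=; lra.
  rewrite dxE addrAC addNr add0r normrM (gtr0_norm d0); apply: le_lt_trans cd.
  rewrite ler_wpM2r ?(ltW d0)// ger0_norm; last by rewrite mulr_ge0// ltW.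
  by apply: le_trans (hc (t, x t)); rewrite ler_piMr.
have [||a [a1 a2 a3 a4]] := @last_exit _ (fun s => U (s, x s)) s p.1 _ sp _ Up1.
- by move=> s' _; apply: continuous_curve_open => //; exact: is_derive_continuous (x' s').
- by rewrite (_ : x s = q.2).
apply: (gh (le_trans s0 a1) a2 (fun t _ => x' t) (fun t _ => cdx t) a3 a4) => t ta Ut.
have pN4 : - 4 < psi (t, x t).
  by apply: psi_gtN4 => //=; apply: ltW; apply: le_lt_trans ta; exact: le_trans a1.
have m0 : 0 < minor 1 1 1 (t, x t) by apply: minor_gt0 => //; lra.
have m1 : minor 1 1 1 (t, x t) <= 4 + psi (t, x t).
  apply: (le_trans (minorant_le_self ler01 mg _)); rewrite -[leRHS]mul1r.
  by apply: margin_le; lra.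
rewrite dxE; set k := bell _ _ _.
have hk0 : 0 < h (t, x t) * k by apply: mulr_gt0; [exact: mulr_gt0|exact: k0].
have hk1 : h (t, x t) * k < 4 + psi (t, x t).
  apply: (@le_lt_trans _ _ (h (t, x t))); first by apply: ler_piMr; [exact: h0|exact: k1].
  by apply: lt_le_trans m1; rewrite /h gtr_pMl//; lra.
by apply: drift_timelike; left; rewrite hk0 hk1.
Qed.

(** Psi is constant on straight L-lines: its deviation from the initial value solves a
    homogeneous linear equation along the line. *)
Lemma psi_line p a :
  (forall s, 0 <= s <= 1 -> U (p.1 - s * a, p.2 - s * (a * (2 + psi p)))) ->
  psi (p.1 - a, p.2 - a * (2 + psi p)) = psi p.
Proof.
move=> H; pose m s := (p.1 - s * a, p.2 - s * (a * (2 + psi p))).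
pose F s := psi (m s) - psi p.
have H' s : 0 <= s <= 1 -> U (m s) by exact: H.
have d1 (b c s : R) : is_derive s 1 (fun s => b - s * c) (- c).
  apply: (is_derive_eq (is_deriveB (is_derive_cst b s 1)
    (is_deriveM (is_derive_id s (1:R)) (is_derive_cst c s 1)))).
  by rewrite /GRing.scale /=; ring.
have cm s : {for s, continuous m}.
  by apply: continuous_pair; apply: is_derive_continuous (d1 _ _ _).
have dF (s : R) : 0 <= s <= 1 -> is_derive s 1 F (a * F s * px (m s)).
  move=> s01; have Us := H' _ s01.
  have := has_gradient_chain (grad Us) (d1 p.1 a s) (d1 p.2 (a * (2 + psi p)) s) erefl.
  move=> /is_deriveB/(_ (is_derive_cst (psi p) s 1)) K; apply: (is_derive_eq K).
  rewrite subr0; have := burgers Us; rewrite /F -/(m s).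
  move=> /eqP; rewrite addr_eq0 => /eqP ->; ring.
have [B B0 pB] : exists2 B, 0 <= B & forall s, 0 <= s <= 1 -> a * px (m s) <= B.
  have [|s s01 sM] := @EVT_max R (fun s => a * px (m s)) 0 1 ler01.
    apply: continuous_in_subspaceT => s; rewrite inE /= in_itv /= => s01.
    apply: (@continuousM _ _ (cst a) (px \o m)); first exact: cvg_cst.
    by apply: continuous_comp; [exact: cm|exact: cx (H' _ s01)].
  exists (Num.max 0 (a * px (m s))) => [|t t01]; first by rewrite le_max lexx.
  by rewrite le_max sM ?orbT// in_itv.
(* Gronwall: F^2 exp (- 2 B s) does not increase, and it vanishes at s = 0. *)
pose G s := F s ^+ 2 * expR (- (2 * B) * s).
have dE (s : R) : is_derive s 1 (fun s => expR (- (2 * B) * s)) (expR (- (2 * B) * s) * - (2 * B)).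
  have h1 : is_derive s 1 (fun s : R => - (2 * B) * s) (- (2 * B)).
    apply: (is_derive_eq (is_deriveZ (- (2 * B)) (is_derive_id s (1:R)))).
    by rewrite /GRing.scale /= mulr1.
  exact: (@is_derive1_comp _ expR _ s _ _ (is_derive_expR _) h1).
have : - G 0 <= - G 1.
  apply: (@ger0_derive_le _ (- G) (fun s => 2 * (B - a * px (m s)) * G s)) => //.
    move=> s s01.
    have h2 := is_deriveM (dF s s01) (dF s s01).
    have h3 := is_deriveN (is_deriveM h2 (dE s)).
    have -> : - G = - (F * F * (fun s => expR (- (2 * B) * s))).
      by congr (- _); apply/funext => y; rewrite /G expr2.
    apply: (is_derive_eq h3).
    by rewrite /GRing.scale /= /G !fctE; ring.
  move=> s /andP[s0 s1]; rewrite mulr_ge0//.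
    by rewrite mulr_ge0// subr_ge0 pB// !ltW.
  by rewrite mulr_ge0 ?sqr_ge0// expR_ge0.
have F0 : F 0 = 0 by rewrite /F /m !mul0r !subr0 -surjective_pairing subrr.
rewrite /G F0 expr0n mul0r oppr0 oppr_ge0 pmulr_lle0 ?expR_gt0// => F1.
have : F 1 ^+ 2 == 0 by rewrite eq_le F1 sqr_ge0.
by rewrite expf_eq0 /= subr_eq0 /m !mul1r => /eqP.
Qed.

(** The abscissa at time 0 of the straight L-line through p. *)
Definition foot p : R := p.2 - p.1 * (2 + psi p).

(** The point is reached from the data: its straight L-line stays in U down to time 0. *)
Definition good p := forall s, 0 <= s <= 1 -> U (p.1 - s * p.1, p.2 - s * (p.1 * (2 + psi p))).

Let good_U p : good p -> U p.
Proof. by move=> /(_ 0); rewrite !mul0r !subr0 -surjective_pairing lexx ler01; exact. Qed.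

Let good_psi p : good p -> psi p = psi (0, foot p).
Proof. by move=> /psi_line; rewrite subrr. Qed.

Let cfoot p : U p -> {for p, continuous foot}.
Proof.
move=> Up; apply: cvgB; first exact: cvg_snd.
apply: cvgM; first exact: cvg_fst.
by apply: cvgD; [exact: cvg_cst|exact: cpsi].
Qed.

(** The L-line of p is a compact arc in U, and L-lines depend continuously on their endpoint. *)
Let good_open p : good p -> exists2 r : R, 0 < r & forall q, `|q - p| < r -> good q.
Proof.
move=> gp; have Up := good_U gp.
pose c q s := (q.1 - s * q.1, q.2 - s * (q.1 * (2 + psi q))).
have [||r r0 rP] := @arc_tube _ U (c p) 0 1 oU ler01.
- move=> s _; apply: continuous_pair; apply: cvgB; (try exact: cvg_cst);
  by apply: cvgM; [exact: cvg_id|exact: cvg_cst].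
- by move=> s; exact: gp.
have /continuous_epsP/(_ _ r0)[d d0 dP] := cfoot Up.
exists (Num.min r d) => [|q]; first by rewrite lt_min r0.
rewrite lt_min => /andP[qr /dP qd] s s01; apply: (rP s) => //; case/andP: (s01) => s0 s1.
have cE q' : c q' s = ((1 - s) * q'.1, (1 - s) * q'.2 + s * foot q').
  by rewrite /c /foot; congr (_, _); ring.
rewrite -/(c q s) !cE norm_pair_lt; move: qr; rewrite norm_pair_lt => /andP[/= h1 h2].
have s1' : 0 <= 1 - s by rewrite subr_ge0.
apply/andP; split => /=.
  rewrite -mulrBr normrM ger0_norm//; apply: le_lt_trans h1.
  by rewrite ler_piMl//; lra.
have -> : (1 - s) * q.2 + s * foot q - ((1 - s) * p.2 + s * foot p) =
  (1 - s) * (q.2 - p.2) + s * (foot q - foot p) by ring.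
apply: (le_lt_trans (ler_normD _ _)); rewrite !normrM (ger0_norm s1') (ger0_norm s0).
move: (`|q.2 - p.2|) (`|foot q - foot p|) h2 qd => A B A1 B1.
have [E|sn] := eqVneq s 1; first by rewrite E subrr mul0r add0r mul1r.
have : 0 < 1 - s by rewrite lt_neqAle s1' andbT eq_sym subr_eq0 eq_sym.
nra.
Qed.

(** Differentiating psi = psi_0(foot) in x. *)
Let good_slope p : good p ->
  px p * (1 + p.1 * px (0, foot p)) = px (0, foot p).
Proof.
move=> gp; have Up := good_U gp; have [r r0 rP] := good_open gp.
have h1 : is_derive (p.2 : R) (1:R) (fun s : R => psi (p.1, s)) (px p).
  exact/(is_derive_axisP true psi p)/dx.
have h2 : is_derive (p.2 : R) (1:R) (fun s : R => s - p.1 * (2 + psi (p.1, s))) (1 - p.1 * px p).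
  have := is_deriveB (is_derive_id p.2 (1:R))
    (is_deriveZ p.1 (is_deriveD (is_derive_cst (2:R) (p.2:R) (1:R)) h1)).
  by rewrite add0r.
have h3 : is_derive (p.2 - p.1 * (2 + psi (p.1, p.2)) : R) (1:R) (fun z : R => psi (0, z)) (px (0, foot p)).
  rewrite -surjective_pairing; apply/(is_derive_axisP true psi (0, foot p))/dx; exact: SU.
have h4 := @is_derive1_comp R (fun z => psi (0, z))
    (fun s => s - p.1 * (2 + psi (p.1, s))) p.2 _ _ h3 h2.
have h5 : is_derive (p.2 : R) (1:R) (fun s : R => psi (p.1, s)) (px (0, foot p) * (1 - p.1 * px p)).
  apply: near_eq_is_derive h4; apply/nbhs_ballP; exists r => //= y.
  rewrite -ball_normE /= distrC => yr; rewrite [RHS]good_psi//.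
  by apply: rP; rewrite norm_pair_lt /= subrr normr0 r0.
have E : px p = px (0, foot p) * (1 - p.1 * px p).
  by rewrite -[LHS](@derive_val _ _ _ _ _ _ _ h1) (@derive_val _ _ _ _ _ _ _ h5).
rewrite mulrDr mulr1 {1}E; ring.
Qed.

(** If 1 + t f were not positive at p, with f = psi_x at the foot, it would vanish at an earlier point
    of the same L-line, where good_slope would give f = 0. *)
Let good_focus p : 0 <= p.1 -> good p -> 0 < 1 + p.1 * px (0, foot p).
Proof.
move=> p0 gp; rewrite ltNge; apply/negP => neg.
set f := px (0, foot p) in neg.
pose s := 1 - (- f^-1) / p.1.
have f0 : f != 0 by apply/eqP => E; move: neg; rewrite E mulr0 addr0 ler10.
have p10 : p.1 != 0 by apply/eqP => E; move: neg; rewrite E mul0r addr0 ler10.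
have pp : 0 < p.1 by rewrite lt_neqAle eq_sym p10.
have fneg : f < 0.
  rewrite ltNge; apply/negP => fp; have := mulr_ge0 p0 fp; lra.
have tau0 : 0 < - f^-1 by rewrite oppr_gt0 invr_lt0.
have taup : - f^-1 <= p.1.
  have : p.1 * f * f^-1 >= - 1 * f^-1 by apply: ler_wnM2r; [rewrite invr_le0 ltW|lra].
  by rewrite mulfK// mulN1r.
have s0 : 0 <= s by rewrite subr_ge0 ler_pdivrMr// mul1r.
have s1 : s <= 1 by rewrite gerBl divr_ge0// ltW.
pose q := (p.1 - s * p.1, p.2 - s * (p.1 * (2 + psi p))).
have q1 : q.1 = - f^-1 by rewrite /q /s /=; field; rewrite p10 f0.
have psq : psi q = psi p.
  have := @psi_line p (s * p.1); rewrite -mulrA; apply => s' /andP[s'0 s'1].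
  have := gp (s' * s); rewrite !mulrA; apply; rewrite mulr_ge0//=.
  by rewrite -[leRHS]mulr1; apply: ler_pM.
have fq : foot q = foot p by rewrite /foot psq /q /=; ring.
have gq : good q.
  move=> s' /andP[s'0 s'1]; rewrite psq.
  have -> : (q.1 - s' * q.1, q.2 - s' * (q.1 * (2 + psi p))) =
    (p.1 - (s + s' * (1 - s)) * p.1, p.2 - (s + s' * (1 - s)) * (p.1 * (2 + psi p))).
    by rewrite /q /=; congr (_, _); ring.
  apply: gp; apply/andP; split; first by rewrite addr_ge0// mulr_ge0// subr_ge0.
  have : s' * (1 - s) <= 1 * (1 - s) by rewrite ler_wpM2r// subr_ge0.
  lra.
have := good_slope gq; rewrite fq q1 -/f mulNr mulVf// subrr mulr0 => /esym/eqP.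
by rewrite (negbTE f0).
Qed.

Let limit_ge0 (g : R * R -> R) p : {for p, continuous g} ->
  (forall r : R, 0 < r -> exists q, `|q - p| < r /\ 0 <= g q) -> 0 <= g p.
Proof.
move=> cg H; rewrite leNgt; apply/negP => g0.
by have [r r0 rP] := continuous_near_lt cg g0; have [q [/rP]] := H _ r0; rewrite ltNge => /negbTE->.
Qed.

(** A limit p of good points satisfies the focusing estimate strictly, by continuity, so the
    straight lines ending at (tp, xp - y), for small y >= 0, form a strip (t, y) -> P t y
    without folds. If the line y = 0 met the complement of U, let (tb, yb) maximize t - y / e0
    on the compact set Z of the parameters of missing points. The curve y = yb + e' (t - tb) with
    0 < e' < e0 lies in U for t > tb by maximality, and so does the part of each line of the
    strip above it; hence psi is known on the curve, and the curve is timelike because it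
    crosses the lines slowly. It issues from a missing point, which contradicts gh. *)
Let good_closed p : U p -> 0 <= p.1 ->
  (forall r : R, 0 < r -> exists q, [/\ `|q - p| < r, 0 <= q.1 & good q]) -> good p.
Proof.
move=> Up p0 lim; set tp := p.1 in p0 *.
pose f q := px (0, foot q).
have cf : {for p, continuous f}.
  apply: (@continuous_comp _ _ _ (fun q => (0, foot q)) px); last by apply: cx; exact: SU.
  by apply: continuous_pair; [exact: cvg_cst|exact: cfoot].
have cD : {for p, continuous (fun q => 1 + q.1 * f q)}.
  apply: cvgD; first exact: cvg_cst.
  by apply: cvgM; [exact: cvg_fst|exact: cf].
have cE : {for p, continuous (fun q => px q * (1 + q.1 * f q) - f q)}.
  apply: cvgB; last exact: cf.
  by apply: cvgM; [exact: cx|exact: cD].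
have E0 : px p * (1 + tp * f p) = f p.
  apply/eqP; rewrite -subr_eq0 eq_le -oppr_ge0; apply/andP; split.
    apply: (@limit_ge0 (fun q => - (px q * (1 + q.1 * f q) - f q))).
      by apply: cvgN; exact: cE.
    move=> r /lim[q [qp q0 gq]]; exists q; split => //.
    by rewrite /f good_slope// subrr oppr0.
  apply: (@limit_ge0 (fun q => px q * (1 + q.1 * f q) - f q)) => //.
  move=> r /lim[q [qp q0 gq]]; exists q; split => //.
  by rewrite /f good_slope// subrr.
have D0 : 0 <= 1 + tp * f p.
  apply: (limit_ge0 cD) => r /lim[q [qp q0 gq]]; exists q; split => //.
  by apply: ltW; exact: good_focus.
have {D0} D0 : 0 < 1 + tp * f p.
  rewrite lt_neqAle D0 andbT; apply/eqP => D1.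
  by move: E0; rewrite -D1 mulr0 => E1; move: D1; rewrite -E1 mulr0 addr0 => /esym/eqP; rewrite oner_eq0.
(* At a good point 1 - t psi_x is the inverse of 1 + t f, so it is positive in the limit too. *)
have foc : tp * px p < 1.
  rewrite -subr_gt0 -(pmulr_lgt0 _ D0).
  have -> : (1 - tp * px p) * (1 + tp * f p) =
     1 + tp * (f p - px p * (1 + tp * f p)) by ring.
  by rewrite E0 subrr mulr0 addr0.
have pN4 := psi_gtN4 Up p0.
pose kap := (4 + psi p) / 2.
have kap0 : 0 < kap by rewrite divr_gt0//; lra.
pose B := `|px p| + 1; have B0 : 0 < B by rewrite ltr_wpDl.
pose r_ y : R * R := (tp, p.2 - y).
have [y2 y20 near] : exists2 y2 : R, 0 < y2 & forall y, `|y| < y2 ->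
    [/\ U (r_ y), tp * px (r_ y) < 1, - B < px (r_ y) & kap < 4 + psi (r_ y)].
  have [r1 r10 r1P] := oUP Up.
  have [r2 r20 r2P] : exists2 r : R, 0 < r & forall q, `|q - p| < r -> tp * px q < 1.
    apply: (@continuous_near_lt _ _ (fun q => tp * px q)) => //.
    by apply: cvgM; [exact: cvg_cst|exact: cx].
  have [r3 r30 r3P] : exists2 r : R, 0 < r & forall q, `|q - p| < r -> - B < px q.
    apply: continuous_near_gt; first exact: cx.
    by rewrite /B; have := ler_norm (- px p); rewrite normrN; lra.
  have [r4 r40 r4P] : exists2 r : R, 0 < r & forall q, `|q - p| < r -> kap < 4 + psi q.
    apply: (@continuous_near_gt _ _ (fun q => 4 + psi q)).
      by apply: cvgD; [exact: cvg_cst|exact: cpsi].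
    by rewrite /kap; lra.
  exists (Num.min (Num.min r1 r2) (Num.min r3 r4)) => [|y]; first by rewrite !lt_min r10 r20 r30.
  have yE : `|r_ y - p| <= `|y|.
    by rewrite norm_pair_le /= subrr normr0 normr_ge0 addrAC subrr add0r normrN lexx.
  rewrite !lt_min => /andP[/andP[h1 h2] /andP[h3 h4]].
  by split; [apply: r1P|apply: r2P|apply: r3P|apply: r4P]; exact: le_lt_trans yE _.
move=> s0 s01; apply: contrapT => nU.
pose tq := tp - s0 * tp.
have tq0 : 0 <= tq.
  by rewrite /tq; have : s0 * tp <= 1 * tp by [apply: ler_wpM2r => //; case/andP: s01]; lra.
have tqp : tq <= tp by rewrite gerBl mulr_ge0//; case/andP: s01.
pose c y := 2 + psi (r_ y).
pose P t y : R * R := (t, p.2 - y - (tp - t) * c y).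
have nUq : ~ U (P tq 0).
  apply: contra_not nU; rewrite /P /c /r_ subr0 -surjective_pairing /tq.
  by rewrite (_ : tp - (tp - s0 * tp) = s0 * tp) ?mulrA//; ring.
pose y1 := y2 / 2.
have y10 : 0 < y1 by rewrite divr_gt0.
have y12 : y1 < y2 by rewrite /y1; lra.
have cr y : {for y, continuous r_}.
  apply: continuous_pair; first exact: cvg_cst.
  by apply: cvgB; [exact: cvg_cst|exact: cvg_id].
have cc y : `|y| < y2 -> {for y, continuous c}.
  move=> /near[Ur _ _ _]; apply: cvgD; first exact: cvg_cst.
  by apply: continuous_comp; [exact: cr|exact: cpsi].
pose Z := [set ty : R * R | (tq <= ty.1 <= tp /\ 0 <= ty.2 <= y1) /\ ~ U (P ty.1 ty.2)].
have yy2 y : 0 <= y <= y1 -> `|y| < y2.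
  by move=> /andP[h1 h2]; rewrite ger0_norm//; exact: le_lt_trans y12.
have cptZ : compact Z.
  have cpt : compact (`[tq, tp] `*` `[0, y1]).
    by apply: compact_setX; exact: segment_compact.
  apply: (subclosed_compact _ cpt); last first.
    by move=> [t y] [[/= h1 h2] _]; split; rewrite /= in_itv.
  rewrite -[Z]setCK; apply: open_closedC; apply/open_epsP => -[t y] nZ.
  have /compact_closed clo := cpt.
  have [h|h] := pselect ((`[tq, tp] `*` `[0, y1]) (t, y)); last first.
    have /open_epsP/(_ _ h)[r r0 rP] := closed_openC (clo (@norm_hausdorff _ _)).
    exists r => // q /rP nq [[q1 q2] _]; apply: nq; split; by rewrite /= in_itv.
  case: h; rewrite /= !in_itv /= => h1 h2.
  have UP : U (P t y) by apply: contrapT => nUP; apply: nZ.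
  have cP : {for (t, y), continuous (fun ty => P ty.1 ty.2)}.
    apply: (@continuous_pair _ _ (fun ty => ty.1)
      (fun ty => p.2 - ty.2 - (tp - ty.1) * c ty.2)); first exact: cvg_fst.
    apply: cvgB; first by apply: cvgB; [exact: cvg_cst|exact: cvg_snd].
    apply: cvgM; first by apply: cvgB; [exact: cvg_cst|exact: cvg_fst].
    by apply: (@continuous_comp _ _ _ (fun ty : R * R => ty.2) c); [exact: cvg_snd|exact: cc (yy2 _ h2)].
  have [r r0 rP] := oUP UP.
  move/continuous_epsP/(_ _ r0): cP => [d d0 dP]; exists d => // q /dP /rP UPq [_]; exact.
(* The first bound keeps the curve inside the strip, the second keeps it timelike. *)
pose e0 := Num.min (y1 / (tp + 1)) (kap / (1 + tp * B)).
have tp1 : 0 < tp + 1 by rewrite ltr_wpDl.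
have tpB : 0 < 1 + tp * B by rewrite ltr_pwDl// mulr_ge0// ltW.
have e00 : 0 < e0 by rewrite lt_min; apply/andP; split; exact: divr_gt0.
have e0y : e0 * (tp + 1) <= y1 by rewrite -ler_pdivlMr// ge_min lexx.
have e0k : e0 * (1 + tp * B) <= kap by rewrite -ler_pdivlMr// ge_min lexx orbT.
have [||tyb] := @compact_EVT_max _ R (fun ty : R * R => ty.1 - ty.2 / e0) Z _ cptZ.
- exists (tq, 0); split => //=; split; first by rewrite lexx.
  by rewrite lexx ltW.
- apply: continuous_subspaceT => ty; apply: cvgB; first exact: cvg_fst.
  by apply: cvgM; [exact: cvg_snd|exact: cvg_cst].
rewrite inE; case: tyb => tb yb [[/= tb12 yb12] nUb] tymax.
have Zmax t y : tq <= t <= tp -> 0 <= y <= y1 -> tb - yb / e0 < t - y / e0 -> U (P t y).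
  move=> h1 h2 h3; apply: contrapT => nUP.
  have : t - y / e0 <= tb - yb / e0 by apply: (tymax (t, y)); rewrite inE.
  by rewrite leNgt h3.
case/andP: (tb12) => tqb tbp; case/andP: (yb12) => yb0 yb1.
have ybe : yb <= e0 * (tb - tq).
  have : tq - 0 / e0 <= tb - yb / e0.
    by apply: (tymax (tq, 0)); rewrite inE; split => //=; rewrite !lexx tqp ltW.
  rewrite mul0r subr0 => H; rewrite -ler_pdivrMl// mulrC; lra.
have tbp' : tb < tp.
  rewrite lt_neqAle tbp andbT; apply/eqP => E; apply: nUb.
  rewrite /P E subrr mul0r subr0.
  by have [] := near _ (yy2 _ yb12).
pose e' := e0 / 2.
have e'0 : 0 < e' by rewrite divr_gt0.
have e'e : e' < e0 by rewrite /e'; lra.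
pose yy t := yb + e' * (t - tb).
have yyr t : tb <= t <= tp -> 0 <= yy t <= y1.
  move=> /andP[h1 h2]; apply/andP; split; first by rewrite addr_ge0// mulr_ge0 ?subr_ge0// ltW.
  have : e' * (t - tb) <= e0 * (t - tb) by apply: ler_wpM2r; [rewrite subr_ge0|exact: ltW].
  have : e0 * (t - tq) <= e0 * (tp + 1) by apply: ler_wpM2l; [exact: ltW|lra].
  rewrite /yy; lra.
have inU t s : tb < t <= tp -> t <= s <= tp -> U (P s (yy t)).
  move=> /andP[h1 h2] /andP[h3 h4]; apply: Zmax.
  - by apply/andP; split => //; lra.
  - by apply: yyr; rewrite ltW.
  - have -> : yy t / e0 = yb / e0 + (t - tb) / 2.
      by rewrite /yy /e'; field; rewrite gt_eqF.
    lra.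
have psiP t : tb < t <= tp -> psi (P t (yy t)) = psi (r_ (yy t)).
  move=> h; have := @psi_line (r_ (yy t)) (tp - t).
  rewrite (_ : (_, _) = P t (yy t)); last by rewrite /P /r_ /c /=; congr (_, _); ring.
  apply => s /andP[h1 h2].
  have := inU t (tp - s * (tp - t)) h.
  rewrite /P /= (_ : tp - (tp - s * (tp - t)) = s * (tp - t)); last by ring.
  rewrite -mulrA; apply; case/andP: h => h3 h4.
  have : s * (tp - t) <= 1 * (tp - t) by apply: ler_wpM2r => //; rewrite subr_ge0.
  have : 0 <= s * (tp - t) by rewrite mulr_ge0// subr_ge0.
  move=> ? ?; apply/andP; split; lra.
pose x1 t := p.2 - yy t - (tp - t) * c (yy t).
pose dx1 t := - e' + c (yy t) + (tp - t) * (px (r_ (yy t)) * e').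
have dyy (t : R) : is_derive t 1 yy e'.
  have := is_deriveD (is_derive_cst yb t (1:R))
    (is_deriveZ e' (is_deriveB (is_derive_id t (1:R)) (is_derive_cst tb t (1:R)))).
  by rewrite subr0 add0r /GRing.scale /= mulr1.
have dx1E (t : R) : tb <= t <= tp -> is_derive t 1 x1 (dx1 t).
  move=> h; have [Ur _ _ _] := near _ (yy2 _ (yyr _ h)).
  have g1 : is_derive t 1 (fun t : R => p.2 - yy t) (- e').
    have := is_deriveB (is_derive_cst p.2 t (1:R)) (dyy t).
    by rewrite sub0r.
  have g2 : is_derive t 1 (fun t : R => c (yy t)) (- e' * px (r_ (yy t))).
    have := has_gradient_chain (grad Ur) (is_derive_cst tp t (1:R)) g1 erefl.
    by move=> /(is_deriveD (is_derive_cst (2:R) t (1:R))); rewrite mul0r !add0r.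
  have g3 : is_derive t 1 (fun t : R => tp - t) (- 1).
    have := is_deriveB (is_derive_cst tp t (1:R)) (is_derive_id t (1:R)).
    by rewrite sub0r.
  apply: (is_derive_eq (is_deriveB g1 (is_deriveM g3 g2))).
  by rewrite /dx1 /GRing.scale /=; ring.
have cdx1 t : tb <= t <= tp -> {for t, continuous dx1}.
  move=> h; have yl := yy2 _ (yyr _ h); have [Ur _ _ _] := near _ yl.
  have cyy : {for t, continuous yy} by exact: is_derive_continuous (dyy t).
  apply: cvgD; first by apply: cvgD; [exact: cvg_cst|apply: (@continuous_comp _ _ _ yy c); [exact: cyy|exact: cc]].
  apply: cvgM; first by apply: cvgB; [exact: cvg_cst|exact: cvg_id].
  apply: cvgM; last exact: cvg_cst.
  apply: (@continuous_comp _ _ _ (r_ \o yy) px); last exact: cx.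
  by apply: (@continuous_comp _ _ _ yy r_); [exact: cyy|exact: cr].
have slope t : tb <= t <= tp -> - 2 < dx1 t < 2 + psi (r_ (yy t)).
  move=> h; have [Ur f1 f2 f3] := near _ (yy2 _ (yyr _ h)).
  case/andP: h => h1 h2.
  pose j := 1 - (tp - t) * px (r_ (yy t)).
  have j0 : 0 < j.
    rewrite /j subr_gt0; case: (leP 0 (px (r_ (yy t)))) => sg.
      apply: le_lt_trans f1; apply: ler_wpM2r => //; lra.
    by apply: (@le_lt_trans _ _ 0) => //; rewrite mulr_ge0_le0 ?subr_ge0// ltW.
  have j1 : j <= 1 + tp * B.
    rewrite /j lerD2l -mulrN; apply: (@le_trans _ _ ((tp - t) * B)).
      by apply: ler_wpM2l; [rewrite subr_ge0|lra].
    by apply: ler_wpM2r; [exact: ltW|lra].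
  have -> : dx1 t = 2 + psi (r_ (yy t)) - e' * j by rewrite /dx1 /j /c; ring.
  have ej0 : 0 < e' * j by rewrite mulr_gt0.
  have ej1 : e' * j <= e0 * (1 + tp * B).
    by apply: ler_pM => //; exact: ltW.
  by apply/andP; split; lra.
(* Past the top of the strip the curve is continued by any timelike curve. *)
have tpI : tb <= tp <= tp by rewrite tbp lexx.
have [Ur1 _ _ _] := near _ (yy2 _ (yyr _ tpI)).
have [x2 [dx2 [x2E dx2E x2' cdx2 tl2]]] := timelike_extension Ur1 p0 (slope _ tpI).
have gl1 : x1 tp = x2 tp by rewrite x2E /x1 /= subrr mul0r subr0.
have gl2 : dx1 tp = dx2 tp by rewrite dx2E.
apply: (gh (x := fun t => if t <= tp then x1 t else x2 t)
  (dx := fun t => if t <= tp then dx1 t else dx2 t) (le_trans tq0 tqb) tbp').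
- move=> t ht; apply: (glue_derive gl1 gl2 _ (fun _ => x2' t)) => h.
  by apply: dx1E; rewrite ht h.
- move=> t ht; apply: (glue_continuous gl2 _ (fun _ => cdx2 t)) => h.
  by apply: cdx1; rewrite ht h.
- by rewrite tbp /x1 /yy subrr mulr0 addr0.
- by move=> t h; case/andP: (h) => h1 h2; rewrite h2; apply: (inU t t h); rewrite lexx.
- move=> t ht; case: (leP t tp) => [tt|/ltW tt] Ut; last by apply: tl2 => //; exact: le_trans p0 tt.
  have := slope t; rewrite (ltW ht) tt => /(_ isT) /andP[h1 h2].
  rewrite (_ : psi (t, x1 t) = psi (r_ (yy t))); last by apply: psiP; rewrite ht.
  by rewrite pmulr_rlt0; lra.
Qed.

(** The good points on an Lbar-segment from Sigma form an open and closed set. *)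
Theorem all_good p : U p -> 0 <= p.1 -> good p.
Proof.
move=> Up p0; pose v s : R * R := (s, p.2 + 2 * (p.1 - s)).
have Uv s : 0 <= s <= p.1 -> U (v s) by exact: vertical_segment.
have vd s s' : `|v s' - v s| <= 2 * `|s' - s|.
  rewrite norm_pair_le /=; apply/andP; split.
    by have := normr_ge0 (s' - s); lra.
  have -> : p.2 + 2 * (p.1 - s') - (p.2 + 2 * (p.1 - s)) = - (2 * (s' - s)) by ring.
  by rewrite normrN normrM ger0_norm.
suff : good (v p.1) by rewrite /v subrr mulr0 addr0 -surjective_pairing.
apply: (@segment_clopen R (good \o v) p.1 p0).
- by move=> s _; rewrite /= mulr0 mul0r mulr0 !subr0; exact: SU.
- move=> s s0 /good_open[r r0 rP]; exists (r / 2) => [|s' _ ss']; first by rewrite divr_gt0.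
  by apply: rP; apply: le_lt_trans (vd _ _) _; lra.
- move=> s s0 H; apply: good_closed => [||r r0]; [exact: Uv|by case/andP: s0|].
  have [|s' [s'0 ss' gs']] := H (r / 2); first by rewrite divr_gt0.
  exists (v s'); split => //; last by case/andP: s'0.
  by apply: le_lt_trans (vd _ _) _; lra.
Qed.

Theorem characteristic_solution p : U p -> 0 <= p.1 ->
  psi p = psi (0, foot p) /\ 0 < 1 + p.1 * px (0, foot p).
Proof.
by move=> Up p0; have gp := all_good Up p0; split; [exact: good_psi|exact: good_focus].
Qed.

End Uniqueness.

(** * The characteristics of the data - atan x *)

Section ExplicitGeometry.
Variable R : realType.
Implicit Types (t x y z a b m d : R) (p q : R * R).

Lemma atan_lt2 z : atan z < 2.
Proof. exact: lt_le_trans (atan_ltpi2 z) (@pi2_le2 R). Qed.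

Lemma atan_gtN2 z : - 2 < atan z.
Proof. by have := atan_lt2 (- z); rewrite atanN ltrNl. Qed.

Lemma atan_norm z : `|atan z| <= 2.
Proof. by rewrite ler_norml !ltW// ?atan_lt2// atan_gtN2. Qed.

Lemma oneDsqr_gt0' z : 0 < 1 + z ^+ 2. Proof. by rewrite ltr_pwDl// sqr_ge0. Qed.

Lemma oneDsqr_neq0' z : 1 + z ^+ 2 != 0. Proof. by rewrite gt_eqF// oneDsqr_gt0'. Qed.
Hint Resolve oneDsqr_gt0' oneDsqr_neq0' : core.

Lemma atan_ge0 z : 0 <= z -> 0 <= atan z.
Proof. by move=> z0; rewrite -(@atan0 R); exact: le_atan. Qed.

(** The characteristic with foot z is the line x = z + t (2 - atan z), on which x - 2 t = kap t z. *)
Definition kap t z : R := z - t * atan z.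

Lemma kapN t z : kap t (- z) = - kap t z.
Proof. by rewrite /kap atanN; ring. Qed.

Lemma kap0 t : kap t 0 = 0.
Proof. by rewrite /kap atan0 mulr0 subr0. Qed.

Lemma is_derive_kap t z : is_derive z 1 (kap t) ((1 + z ^+ 2 - t) / (1 + z ^+ 2)).
Proof.
apply: (is_derive_eq (is_deriveB (is_derive_id z (1:R)) (is_deriveZ t (is_derive1_atan z)))).
by rewrite /GRing.scale /=; field.
Qed.

Lemma continuous_kap t : continuous (kap t).
Proof. by move=> z; exact: is_derive_continuous (is_derive_kap t z). Qed.

Lemma kap_incr t a b : a < b -> (forall z, a < z < b -> t < 1 + z ^+ 2) -> kap t a < kap t b.
Proof.
move=> ab H; apply: (gtr0_derive_lt ab (fun z _ => is_derive_kap t z)) => z zab.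
by rewrite divr_gt0// subr_gt0 H.
Qed.

Lemma kap_shift t t' z : kap t z = kap t' z - (t - t') * atan z.
Proof. by rewrite /kap; ring. Qed.

Lemma is_derive_cube (c a z : R) :
  is_derive z 1 (fun z => c * (z ^+ 3 / 3 - a * z)) (c * (z ^+ 2 - a)).
Proof.
have h := is_deriveX 2 (is_derive_id z (1:R)).
apply: (is_derive_eq (is_deriveZ c (is_deriveB (is_deriveM (is_deriveX 3 (is_derive_id z (1:R)))
   (is_derive_cst (3^-1:R) z (1:R))) (is_deriveZ a (is_derive_id z (1:R)))))).
by rewrite /GRing.scale /=; field.
Qed.

(** On the branch z >= a the derivative (1 + z^2 - t) / (1 + z^2) of kap is at least
    (z^2 - a^2) / (1 + m^2); integrate this lower bound. *)
Lemma kap_cubic t a b m : 0 <= a -> a <= b -> b <= m -> t <= 1 + a ^+ 2 ->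
  (b - a) ^+ 2 * (b + 2 * a) <= 3 * (1 + m ^+ 2) * (kap t b - kap t a).
Proof.
move=> a0 ab bm ta; pose c := (1 + m ^+ 2)^-1.
have c0 : 0 < c by rewrite invr_gt0.
pose g z := c * (z ^+ 3 / 3 - a ^+ 2 * z).
have : kap t a - g a <= kap t b - g b.
  apply: (@ger0_derive_le _ (kap t - g)
    (fun z => (1 + z ^+ 2 - t) / (1 + z ^+ 2) - c * (z ^+ 2 - a ^+ 2)) a b ab).
    by move=> z _; exact: is_deriveB (is_derive_kap t z) (is_derive_cube c (a ^+ 2) z).
  move=> z /andP[az zb]; rewrite subr_ge0.
  apply: (@le_trans _ _ ((1 + z ^+ 2)^-1 * (z ^+ 2 - a ^+ 2))).
    apply: ler_wpM2r; first by rewrite subr_ge0 ler_sqr ?nnegrE; lra.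
    rewrite /c lef_pV2 ?posrE// lerD2l ler_sqr ?nnegrE; lra.
  by rewrite mulrC ler_pM2r ?invr_gt0//; lra.
move=> H; have : g b - g a <= kap t b - kap t a by lra.
have -> : g b - g a = c * ((b - a) ^+ 2 * (b + 2 * a) / 3) by rewrite /g; field.
rewrite /c mulrC ler_pdivrMr// ler_pdivrMr//; lra.
Qed.

(** For t <= 1 the two branches merge and the derivative of kap is at least z^2 / (1 + m^2). *)
Lemma kap_cubic1 t a b m : - m <= a -> a <= b -> b <= m -> t <= 1 ->
  (b - a) ^+ 3 <= 12 * (1 + m ^+ 2) * (kap t b - kap t a).
Proof.
move=> ma ab bm t1; pose c := (1 + m ^+ 2)^-1.
have c0 : 0 < c by rewrite invr_gt0.
pose g z := c * (z ^+ 3 / 3 - 0 * z).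
have : kap t a - g a <= kap t b - g b.
  apply: (@ger0_derive_le _ (kap t - g)
    (fun z => (1 + z ^+ 2 - t) / (1 + z ^+ 2) - c * (z ^+ 2 - 0)) a b ab).
    by move=> z _; exact: is_deriveB (is_derive_kap t z) (is_derive_cube c 0 z).
  move=> z /andP[az zb]; rewrite subr_ge0 subr0.
  apply: (@le_trans _ _ ((1 + z ^+ 2)^-1 * z ^+ 2)).
    apply: ler_wpM2r; first exact: sqr_ge0.
    rewrite /c lef_pV2 ?posrE// lerD2l.
    have : 0 <= (m - z) * (m + z) by apply: mulr_ge0; lra.
    by rewrite -subr_sqr subr_ge0.
  by rewrite mulrC ler_pM2r ?invr_gt0//; lra.
move=> H; have : g b - g a <= kap t b - kap t a by lra.
have -> : g b - g a = c * ((b ^+ 3 - a ^+ 3) / 3) by rewrite /g; field.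
rewrite /c mulrC ler_pdivrMr// => H'.
have : (b - a) ^+ 3 <= 4 * (b ^+ 3 - a ^+ 3).
  rewrite -subr_ge0.
  have -> : 4 * (b ^+ 3 - a ^+ 3) - (b - a) ^+ 3 = 3 * ((b - a) * (b + a) ^+ 2) by ring.
  by apply: mulr_ge0 => //; apply: mulr_ge0; [rewrite subr_ge0|exact: sqr_ge0].
lra.
Qed.

Lemma subr_atan_ge z m : 0 <= z -> z <= m -> z ^+ 3 <= 3 * (1 + m ^+ 2) * (z - atan z).
Proof.
move=> z0 zm; have l1 : (1:R) <= 1 + 0 ^+ 2 by rewrite lerDl sqr_ge0.
have := @kap_cubic 1 0 z m (lexx _) z0 zm l1.
by rewrite kap0 /kap !subr0 mul1r mulr0 addr0 -exprSr.
Qed.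

Lemma atan_le z : 0 <= z -> atan z <= z.
Proof.
move=> z0; have := subr_atan_ge z0 (lexx z); have := exprn_ge0 3 z0.
have p : 0 < 3 * (1 + z ^+ 2) by rewrite mulr_gt0.
by move=> /le_trans H /H; rewrite pmulr_rge0// subr_ge0.
Qed.

Lemma atan_ge z : 0 <= z -> z <= (1 + z ^+ 2) * atan z.
Proof.
move=> z0.
have : - kap (1 + 0 ^+ 2) 0 <= - kap (1 + z ^+ 2) z.
  apply: (@ger0_derive_le _ (fun z => - kap (1 + z ^+ 2) z) (fun z => 2 * z * atan z)) => //.
    move=> s _; have h := is_deriveM (is_deriveD (is_derive_cst (1:R) s (1:R))
      (is_deriveX 2 (is_derive_id s (1:R)))) (is_derive1_atan s).
    apply: (is_derive_eq (is_deriveN (is_deriveB (is_derive_id s (1:R)) h))).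
    by rewrite /GRing.scale /= !fctE; field.
  by move=> s /andP[s0 _]; rewrite !mulr_ge0 ?atan_ge0// ltW.
by rewrite kap0 oppr0 /kap; lra.
Qed.

(** Replacing t2 by t1 costs at most 2 |t1 - t2|, because |atan| <= 2; then kap_cubic applies. *)
Lemma branch_same t1 z1 t2 z2 m d : 0 <= z1 -> z1 <= z2 -> z2 <= m ->
  t1 <= 1 + z1 ^+ 2 -> `|t1 - t2| <= d -> `|kap t1 z1 - kap t2 z2| <= d ->
  (z2 - z1) ^+ 2 * (z2 + 2 * z1) <= 9 * (1 + m ^+ 2) * d.
Proof.
move=> z10 z12 z2m t1z td yd; apply: (le_trans (kap_cubic z10 z12 z2m t1z)).
have c0 : 0 <= 3 * (1 + m ^+ 2) by rewrite mulr_ge0// ltW.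
suff : kap t1 z2 - kap t1 z1 <= 3 * d by move=> /(ler_wpM2l c0); lra.
rewrite (kap_shift t1 t2 z2).
have : `|(t1 - t2) * atan z2| <= d * 2 by rewrite normrM; apply: ler_pM => //; exact: atan_norm.
by move: yd; rewrite !ler_norml => /andP[? ?] /andP[? ?]; lra.
Qed.

(** If one of the times is at most 1, kap_cubic1 applies at that time. If both exceed 1, the
    point with foot z2 lies above the line x + 2 t = 4 by (t2 - 1) (4 - atan z2) + (z2 - atan z2)
    and the other one does not lie above it; so d bounds t2 - 1 and z2^3, hence also t1 - 1 and,
    by the same formula for z1, the cube of z1. *)
Lemma branch_opposite t1 z1 t2 z2 m d : z1 <= 0 -> 0 <= z2 -> - m <= z1 -> z2 <= m ->
  t2 <= 1 + z2 ^+ 2 -> kap t1 z1 + 4 * t1 <= 4 ->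
  `|t1 - t2| <= d -> `|kap t1 z1 - kap t2 z2| <= d ->
  (z2 - z1) ^+ 3 <= 400 * (1 + m ^+ 2) * d.
Proof.
move=> z10 z20 mz1 z2m t2z u1 td yd.
have d0 : 0 <= d by exact: le_trans (normr_ge0 _) td.
set M := 1 + m ^+ 2; have M0 : 0 < M by exact: oneDsqr_gt0'.
have Md : 0 <= M * d by rewrite mulr_ge0// ltW.
have z12 : z1 <= z2 by lra.
have B z : `|(t1 - t2) * atan z| <= d * 2 by rewrite normrM; apply: ler_pM => //; exact: atan_norm.
have [t11|t11] := leP t1 1.
  apply: (le_trans (kap_cubic1 mz1 z12 z2m t11)).
  have : kap t1 z2 - kap t1 z1 <= 3 * d.
    rewrite (kap_shift t1 t2 z2); move: (B z2) yd; rewrite !ler_norml => /andP[? ?] /andP[? ?]; lra.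
  have c0 : 0 <= 12 * M by rewrite mulr_ge0// ltW.
  by move=> /(ler_wpM2l c0); rewrite -/M; lra.
have [t21|t21] := leP t2 1.
  apply: (le_trans (kap_cubic1 mz1 z12 z2m t21)).
  have : kap t2 z2 - kap t2 z1 <= 3 * d.
    rewrite (kap_shift t2 t1 z1) -[t2 - t1]opprB mulNr.
    move: (B z1) yd; rewrite !ler_norml => /andP[? ?] /andP[? ?]; lra.
  have c0 : 0 <= 12 * M by rewrite mulr_ge0// ltW.
  by move=> /(ler_wpM2l c0); rewrite -/M; lra.
have A1 := atan_lt2 z2; have A2 := atan_gtN2 z1.
have S2 := subr_atan_ge z20 z2m.
have nz1 : 0 <= - z1 by lra.
have mz1' : - z1 <= m by lra.
have S1 := subr_atan_ge nz1 mz1'.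
rewrite atanN in S1; rewrite -/M in S1 S2.
move: td yd; rewrite !ler_norml => /andP[td1 td2] /andP[yd1 yd2].
have E2 : kap t2 z2 + 4 * t2 - 4 = (t2 - 1) * (4 - atan z2) + (z2 - atan z2).
  by rewrite /kap; ring.
have E1 : - z1 - - atan z1 = 4 - (kap t1 z1 + 4 * t1) + (t1 - 1) * (4 - atan z1).
  by rewrite /kap; ring.
have F2 : 2 * (t2 - 1) <= (t2 - 1) * (4 - atan z2).
  by rewrite mulrC ler_pM2l ?subr_gt0//; lra.
have G2 : z2 - atan z2 >= 0 by rewrite subr_ge0 atan_le.
have F1 : (t1 - 1) * (4 - atan z1) <= (t1 - 1) * 6 by rewrite ler_pM2l ?subr_gt0//; lra.
have H2 : z2 - atan z2 <= 5 * d by lra.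
have H1 : - z1 - - atan z1 <= 26 * d by lra.
have M3 : 0 <= 3 * M by rewrite mulr_ge0// ltW.
have K2 : z2 ^+ 3 <= 15 * (M * d) by have := ler_wpM2l M3 H2; lra.
have K1 : (- z1) ^+ 3 <= 78 * (M * d) by have := ler_wpM2l M3 H1; lra.
have : (z2 - z1) ^+ 3 <= 4 * (z2 ^+ 3 + (- z1) ^+ 3).
  rewrite -subr_ge0.
  have -> : 4 * (z2 ^+ 3 + (- z1) ^+ 3) - (z2 - z1) ^+ 3 = 3 * ((z2 - z1) * (z2 + z1) ^+ 2) by ring.
  by apply: mulr_ge0 => //; apply: mulr_ge0; [lra|exact: sqr_ge0].
lra.
Qed.

(** ** The curve B and the domain Omega *)

(** The foot sqrt (t - 1) of the characteristic that focuses at time t, extended by 0 to t <= 1. *)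
Definition wB t : R := Num.sqrt (t - 1).
(** The curve B for t >= 1, continued by the line x = 2 t, along which the foot is 0. *)
Definition xB t : R := wB t + t * (2 - atan (wB t)).
Definition OmegaC : set (R * R) := [set p | p.2 + 2 * p.1 < 4 \/ xB p.1 < p.2].
Definition clOmegaC : set (R * R) := [set p | p.2 + 2 * p.1 <= 4 \/ xB p.1 <= p.2].

Lemma wB_ge0 t : 0 <= wB t. Proof. exact: sqrtr_ge0. Qed.

Lemma wB_le1 t : t <= 1 -> wB t = 0.
Proof. by move=> t1; rewrite /wB ler0_sqrtr// subr_le0. Qed.

Lemma wB_sqr t : 1 <= t -> wB t ^+ 2 = t - 1.
Proof. by move=> t1; rewrite sqr_sqrtr// subr_ge0. Qed.

Lemma wB_gt0 t : 1 < t -> 0 < wB t.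
Proof. by move=> t1; rewrite sqrtr_gt0 subr_gt0. Qed.

Lemma le_oneDwB t : t <= 1 + wB t ^+ 2.
Proof.
have [t1|/ltW t1] := leP t 1; last by rewrite wB_sqr//; lra.
by rewrite wB_le1// expr0n addr0.
Qed.

Lemma wB_le t z : 0 <= z -> t <= 1 + z ^+ 2 -> wB t <= z.
Proof. by move=> z0 tz; rewrite -[z](ger0_norm z0) -sqrtr_sqr ler_sqrt ?sqr_ge0//; lra. Qed.

Lemma wB_lt t z : 0 < z -> t < 1 + z ^+ 2 -> wB t < z.
Proof.
by move=> z0 tz; rewrite -[z](gtr0_norm z0) -sqrtr_sqr ltr_sqrt ?exprn_gt0//; lra.
Qed.

Lemma lt_oneDsqr t z : wB t < `|z| -> t < 1 + z ^+ 2.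
Proof.
move=> H; apply: le_lt_trans (le_oneDwB t) _.
by rewrite ltrD2l -[ltRHS]real_normK ?num_real// ltr_sqr ?nnegrE ?wB_ge0.
Qed.

Lemma kap_wB t : kap t (wB t) = xB t - 2 * t.
Proof. by rewrite /kap /xB; ring. Qed.

Lemma kap_right_incr t a b : wB t <= a -> a < b -> kap t a < kap t b.
Proof.
move=> wa ab; apply: kap_incr => // z /andP[az _]; apply: lt_oneDsqr.
by rewrite ger0_norm; [lra|have := wB_ge0 t; lra].
Qed.

Lemma kap_left_incr t a b : b <= - wB t -> a < b -> kap t a < kap t b.
Proof.
move=> bw ab; rewrite -ltrN2 -!kapN; apply: kap_right_incr; lra.
Qed.

Lemma xB_le1 t : t <= 1 -> xB t = 2 * t.
Proof. by move=> t1; rewrite /xB wB_le1// atan0; ring. Qed.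

(** With w = sqrt (t - 1), the difference is (w - atan w) + (t - 1) (4 - atan w): C and B
    separate immediately after S. *)
Lemma xB_above t : 1 < t -> 4 < xB t + 2 * t.
Proof.
move=> t1; have w0 := wB_gt0 t1; have wE := wB_sqr (ltW t1).
have -> : xB t + 2 * t = 4 + ((wB t - atan (wB t)) + (t - 1) * (4 - atan (wB t))).
  by rewrite /xB; ring.
have : 0 < (t - 1) * (4 - atan (wB t)).
  by rewrite mulr_gt0 ?subr_gt0//; have := atan_lt2 (wB t); lra.
have := atan_le (ltW w0); lra.
Qed.

Lemma kap_lower t z : 0 <= z -> z - 2 * `|t| <= kap t z.
Proof.
move=> z0; have : `|t * atan z| <= `|t| * 2 by rewrite normrM ler_wpM2l// atan_norm.
by rewrite /kap ler_norml => /andP[? ?]; lra.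
Qed.

Lemma kap_bound t z : `|z| <= `|kap t z| + 2 * `|t|.
Proof.
have -> : z = kap t z + t * atan z by rewrite /kap subrK.
apply: (le_trans (ler_normD _ _)); rewrite -/(kap t z) {2}/kap subrK lerD2l normrM mulrC.
by rewrite ler_wpM2r// atan_norm.
Qed.

Lemma right_root t y : xB t - 2 * t <= y -> exists2 z, wB t <= z & kap t z = y.
Proof.
rewrite -kap_wB => wy; pose Z := Num.max (wB t) (`|y| + 2 * `|t|).
have Z0 : 0 <= Z by rewrite le_max wB_ge0.
have wZ : wB t <= Z by rewrite le_max lexx.
have yZ : y <= kap t Z.
  apply: (le_trans _ (kap_lower t Z0)); rewrite lerBrDr le_max; apply/orP; right.
  by rewrite lerD2r ler_norm.
have [||z /andP[z1 _] zE] := @IVT0 _ (fun z => kap t z - y) (wB t) Z wZ.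
- by move=> s _; apply: cvgB; [exact: continuous_kap|exact: cvg_cst].
- by left; rewrite subr_le0 subr_ge0 wy.
- by exists z => //; apply/eqP; rewrite -subr_eq0 zE.
Qed.

Lemma left_root t y : y < kap t (- wB t) -> exists2 z, z < - wB t & kap t z = y.
Proof.
move=> yk; have [|z z1 zE] := @right_root t (- y).
  by rewrite -kap_wB -[kap _ _]opprK -kapN lerN2 ltW.
exists (- z); last by rewrite kapN zE opprK.
rewrite ltrN2 lt_neqAle z1 andbT; apply/eqP => E.
by move: yk; rewrite E kapN zE opprK ltxx.
Qed.

(** Up to the Cauchy horizon, the region to the left of B is covered by the left branch. *)
Lemma left_region t x : x + 2 * t <= 4 -> x < xB t -> x - 2 * t < kap t (- wB t).
Proof.
move=> u4 xb; have [t1|t1] := leP t 1.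
  by rewrite wB_le1// oppr0 kap0; rewrite xB_le1// in xb; lra.
have w0 := wB_gt0 t1; have wE := wB_sqr (ltW t1).
have := atan_ge (ltW w0); rewrite kapN /kap wE addrCA subrr addr0; lra.
Qed.

(** The foot of the characteristic through p: on the part of the closure of Omega to the right
    of B it is taken on the branch z >= w, elsewhere on the branch z < - w, with w as above;
    kap t is increasing on each of them. *)
Definition zC p : R := xget 0 [set z | kap p.1 z = p.2 - 2 * p.1 /\
  ((xB p.1 <= p.2 /\ wB p.1 <= z) \/ (p.2 < xB p.1 /\ z < - wB p.1))].

Lemma zCP p : clOmegaC p -> kap p.1 (zC p) = p.2 - 2 * p.1 /\
  ((xB p.1 <= p.2 /\ wB p.1 <= zC p) \/ (p.2 < xB p.1 /\ zC p < - wB p.1)).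
Proof.
move=> cp; rewrite /zC; case: xgetP => [z _ //|]; set A := [set _ | _] => A0.
exfalso; have [xb|xb] := leP (xB p.1) p.2.
  have [|z z1 zE] := @right_root p.1 (p.2 - 2 * p.1); first by rewrite lerD2r.
  by apply: (A0 z); split => //; left.
have [|z z1 zE] := @left_root p.1 (p.2 - 2 * p.1).
  by apply: left_region => //; case: cp => //; rewrite leNgt xb.
by apply: (A0 z); split => //; right.
Qed.

Lemma zC_kap p : clOmegaC p -> kap p.1 (zC p) = p.2 - 2 * p.1.
Proof. by move=> /zCP[]. Qed.

Lemma sub_OmegaC : OmegaC `<=` clOmegaC.
Proof. by move=> p [/ltW|/ltW]; [left|right]. Qed.

Lemma zC_le p : clOmegaC p -> p.1 <= 1 + zC p ^+ 2.
Proof.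
move=> /zCP[_ [[_ wz]|[_ wz]]].
  apply: le_trans (le_oneDwB _) _; rewrite lerD2l ler_sqr ?nnegrE ?wB_ge0//.
  exact: le_trans (wB_ge0 _) wz.
apply: ltW; apply: lt_oneDsqr; rewrite ltr0_norm; first lra.
by have := wB_ge0 p.1; lra.
Qed.

Lemma zC_lt p : OmegaC p -> p.1 < 1 + zC p ^+ 2.
Proof.
move=> Op; have cp := sub_OmegaC Op.
have [t1|t1] := ltP p.1 1; first by apply: (lt_le_trans t1); rewrite lerDl sqr_ge0.
apply: lt_oneDsqr; have [E [[xb wz]|[xb wz]]] := zCP cp; last first.
  by rewrite ltr0_norm; [lra|have := wB_ge0 p.1; lra].
rewrite ger0_norm; last exact: le_trans (wB_ge0 _) wz.
rewrite lt_neqAle wz andbT; apply/eqP => wE.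
have {}E : xB p.1 = p.2 by move: E; rewrite -wE kap_wB => /addIr.
case: Op; rewrite ?E ?ltxx// => u4.
have {}u4 : p.2 + 2 * p.1 < 4 by [].
have [t2|t2] := leP p.1 1; first by move: E; rewrite xB_le1//; lra.
by have := xB_above t2; rewrite E; lra.
Qed.

Lemma zC_right p : clOmegaC p -> xB p.1 <= p.2 -> wB p.1 <= zC p.
Proof. by move=> /zCP[_ [[//]|[]]]; rewrite leNgt => ->. Qed.

Lemma zC_left p : clOmegaC p -> p.2 < xB p.1 -> zC p < - wB p.1.
Proof. by move=> /zCP[_ [[]|[//]]]; rewrite leNgt => /negbTE->. Qed.

Lemma zC_left_u p : clOmegaC p -> zC p < 0 -> p.2 + 2 * p.1 <= 4 /\ p.2 < xB p.1.
Proof.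
move=> cp z0; have [_ [[_ wz]|[xb wz]]] := zCP cp.
  by have := wB_ge0 p.1; lra.
by split => //; case: cp => //; rewrite leNgt xb.
Qed.

Lemma right_uniq p z : 0 <= z -> p.1 <= 1 + z ^+ 2 -> kap p.1 z = p.2 - 2 * p.1 ->
  xB p.1 <= p.2 /\ zC p = z.
Proof.
move=> z0 tz E; have wz := wB_le z0 tz.
have xb : xB p.1 <= p.2.
  have : kap p.1 (wB p.1) <= kap p.1 z.
    by move: wz; rewrite le_eqVlt => /predU1P[->//|/(kap_right_incr (lexx _))/ltW].
  by rewrite kap_wB E lerD2r.
split => //; have cp : clOmegaC p by right.
have wz' := zC_right cp xb; have := zC_kap cp; rewrite -E.
by case: (ltgtP (zC p) z) => // [/(kap_right_incr wz')|/(kap_right_incr wz)] + E';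
  rewrite E' ltxx.
Qed.

Lemma left_uniq p z : z < 0 -> p.1 < 1 + z ^+ 2 -> kap p.1 z = p.2 - 2 * p.1 ->
  p.2 + 2 * p.1 <= 4 -> p.2 < xB p.1 /\ zC p = z.
Proof.
move=> z0 tz E u4.
have wz : z < - wB p.1 by rewrite ltrNr; apply: wB_lt; rewrite ?oppr_gt0// sqrrN.
have xb : p.2 < xB p.1.
  have [t1|t1] := leP p.1 1; last by have := xB_above t1; lra.
  have : kap p.1 z < kap p.1 (- wB p.1) by exact: kap_left_incr.
  by rewrite E wB_le1// oppr0 kap0 xB_le1//; lra.
split => //; have cp : clOmegaC p by left.
have wz' := zC_left cp xb; have := zC_kap cp; rewrite -E.
by case: (ltgtP (zC p) z) => // [/(kap_left_incr (ltW wz))|/(kap_left_incr (ltW wz'))] + E';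
  rewrite E' ltxx.
Qed.

Lemma right_OmegaC p z : 0 < z -> p.1 < 1 + z ^+ 2 -> kap p.1 z = p.2 - 2 * p.1 -> OmegaC p.
Proof.
move=> z0 tz E; right; have wz := wB_lt z0 tz.
by have := kap_right_incr (lexx _) wz; rewrite kap_wB E ltrD2r.
Qed.

Lemma zC_bound p : clOmegaC p -> `|zC p| <= 5 * `|p|.
Proof.
move=> cp; apply: le_trans (kap_bound p.1 _) _; rewrite zC_kap//.
have [h1 h2] : `|p.1| <= `|p| /\ `|p.2| <= `|p|.
  by apply/andP; rewrite -norm_pair_le.
have : `|p.2 - 2 * p.1| <= `|p.2| + 2 * `|p.1|.
  by apply: le_trans (ler_normB _ _) _; rewrite normrM ger0_norm.
by move: (`|p|) h1 h2 => n; lra.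
Qed.

(** A bound uniform over the closure of Omega, by the sign of the two feet; two nonpositive feet
    reduce to two nonnegative ones by the oddness of kap. *)
Lemma zC_cubic p q m : clOmegaC p -> clOmegaC q -> `|zC p| <= m -> `|zC q| <= m ->
  `|zC p - zC q| ^+ 3 <= 1200 * (1 + m ^+ 2) * `|p - q|.
Proof.
move=> cp cq; rewrite !ler_norml => /andP[pm1 pm2] /andP[qm1 qm2].
have : `|p - q| <= `|p - q| by []; rewrite norm_pair_le /= => /andP[h1 h2].
set d0 := `|p - q| in h1 h2 *; pose d := 3 * d0.
have d00 : 0 <= d0 by exact: normr_ge0.
have td : `|p.1 - q.1| <= d by rewrite /d; lra.
have yd : `|kap p.1 (zC p) - kap q.1 (zC q)| <= d.
  rewrite !zC_kap// (_ : _ - _ = (p.2 - q.2) - 2 * (p.1 - q.1)); last by ring.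
  by apply: le_trans (ler_normB _ _) _; rewrite normrM ger0_norm// /d; lra.
have -> : 1200 * (1 + m ^+ 2) * d0 = 400 * (1 + m ^+ 2) * d by rewrite /d; ring.
have td' : `|q.1 - p.1| <= d by rewrite distrC.
have yd' : `|kap q.1 (zC q) - kap p.1 (zC p)| <= d by rewrite distrC.
have Md : 0 <= (1 + m ^+ 2) * d by apply: mulr_ge0; [exact: ltW|rewrite /d; lra].
have same z1 z2 t1 t2 : 0 <= z1 -> z1 <= z2 -> z2 <= m -> t1 <= 1 + z1 ^+ 2 ->
    `|t1 - t2| <= d -> `|kap t1 z1 - kap t2 z2| <= d ->
    `|z1 - z2| ^+ 3 <= 400 * (1 + m ^+ 2) * d.
  move=> z10 z12 z2m t1z e1 e2; have := branch_same z10 z12 z2m t1z e1 e2.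
  rewrite distrC ger0_norm ?subr_ge0// exprSr => H.
  have : (z2 - z1) ^+ 2 * (z2 - z1) <= (z2 - z1) ^+ 2 * (z2 + 2 * z1).
    by rewrite ler_wpM2l ?sqr_ge0//; lra.
  lra.
have eN z1 t1 z2 t2 : `|kap t1 (- z1) - kap t2 (- z2)| = `|kap t1 z1 - kap t2 z2|.
  by rewrite !kapN -opprD normrN.
have eD (z1 z2 : R) : `|- z1 - - z2| = `|z1 - z2| by rewrite -opprD normrN.
have lp := zC_le cp; have lq := zC_le cq.
have [p0|p0] := leP 0 (zC p); have [q0|q0] := leP 0 (zC q).
- have [pq|/ltW pq] := leP (zC p) (zC q); first exact: (same _ _ p.1 q.1 p0 pq qm2 lp td yd).
  by rewrite distrC; exact: (same _ _ q.1 p.1 q0 pq pm2 lq td' yd').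
- have [uq _] := zC_left_u cq q0.
  rewrite ger0_norm; last lra.
  apply: (branch_opposite _ p0 qm1 pm2 lp _ td' yd'); first exact: ltW.
  by rewrite zC_kap//; lra.
- have [up _] := zC_left_u cp p0.
  rewrite distrC ger0_norm; last lra.
  apply: (branch_opposite _ q0 pm1 qm2 lq _ td yd); first exact: ltW.
  by rewrite zC_kap//; lra.
- rewrite -eD; have [pq|/ltW pq] := leP (- zC p) (- zC q).
    apply: (same _ _ p.1 q.1); rewrite ?eN ?sqrrN//; lra.
  rewrite distrC; apply: (same _ _ q.1 p.1); rewrite ?eN ?sqrrN//; lra.
Qed.

End ExplicitGeometry.

(** * The solution given by a foot function *)

Section SmoothClasses.
Variable R : realType.
Implicit Types (U : set (R * R)) (p q : R * R).

Lemma open_near U p : open U -> U p -> \forall q \near p, U q.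
Proof. by rewrite openE => oU /oU. Qed.

(** Smoothness of the explicit functions below is proved by exhibiting a class of continuous
    functions that contains them and is stable under both partial derivatives. *)
Section StableClass.
Variables (U : set (R * R)) (A : (R * R -> R) -> Prop).
Hypothesis oU : open U.
Hypothesis cA : forall f p, A f -> U p -> {for p, continuous f}.
Hypothesis dA : forall f i, A f -> exists2 g, A g & forall p, U p -> is_derive p (axis R i) f (g p).

Lemma pderiv_class s f : A f -> exists2 g, A g & forall p, U p -> pderiv s f p = g p.
Proof.
move=> Af; elim: s => [|i s [g Ag gE]]; first by exists f.
have [g' Ag' g'E] := dA i Ag; exists g' => // p Up /=.
have H := g'E _ Up; rewrite -(@derive_val _ _ _ _ _ _ _ H); apply: near_eq_derive.
by apply: filterS (open_near oU Up) => q /gE.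
Qed.

Lemma class_smooth f : A f -> smooth_on U f.
Proof.
move=> Af k; split=> [s i p _ Up|s p _ Up].
  have [g Ag gE] := pderiv_class s Af; have [g' Ag' g'E] := dA i Ag.
  have H := g'E _ Up; apply: (@ex_derive _ _ _ _ _ _ (g' p)).
  apply: near_eq_is_derive H.
  by apply: filterS (open_near oU Up) => q /gE.
have [g Ag gE] := pderiv_class s Af.
have Hp := gE _ Up.
have /continuous_epsP cg := cA Ag Up; apply/continuous_epsP => e /cg[d d0 dP].
have /open_epsP/(_ _ Up)[r r0 rP] := oU.
exists (Num.min d r) => [|q]; first by rewrite lt_min d0.
by rewrite lt_min => /andP[/dP qe /rP /gE ->]; rewrite Hp.
Qed.

End StableClass.

Lemma pderiv_eq (V : normedModType R) U (f g : R * R -> V) s p : open U ->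
  (forall q, U q -> f q = g q) -> U p -> pderiv s f p = pderiv s g p.
Proof.
move=> oU fg; elim: s p => [|i s IH] p Up; first exact: fg.
by apply: near_eq_derive; apply: filterS (open_near oU Up) => q /IH.
Qed.

Lemma smooth_on_eq (V : normedModType R) U (f g : R * R -> V) : open U ->
  (forall q, U q -> f q = g q) -> smooth_on U f -> smooth_on U g.
Proof.
move=> oU fg sf k; have [H1 H2] := sf k; split=> [s i p sk Up|s p sk Up].
  have := derivableP (H1 s i p sk Up) => H; apply: (@ex_derive _ _ _ _ _ _ ('D_(axis R i) (pderiv s f) p)).
  apply: near_eq_is_derive H.
  by apply: filterS (open_near oU Up) => q Uq; exact: pderiv_eq oU fg Uq.
have /continuous_epsP cg := H2 s p sk Up; apply/continuous_epsP => e /cg[d d0 dP].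
have /open_epsP/(_ _ Up)[r r0 rP] := oU.
exists (Num.min d r) => [|q]; first by rewrite lt_min d0.
by rewrite lt_min => /andP[/dP qe /rP Uq]; rewrite -!(pderiv_eq s oU fg).
Qed.

Lemma smooth_onS (V : normedModType R) U U' (f : R * R -> V) :
  U' `<=` U -> smooth_on U f -> smooth_on U' f.
Proof.
move=> U'U sf k; have [H1 H2] := sf k.
by split=> [s i p sk /U'U|s p sk /U'U]; [exact: H1|exact: H2].
Qed.

Section Pairs.
Variables V W : normedModType R.

Lemma is_derive_pair (f : R * R -> V) (g : R * R -> W) p v (a : V) (b : W) :
  is_derive p v f a -> is_derive p v g b -> is_derive p v (fun q => (f q, g q)) (a, b).
Proof.
move=> [df fE] [dg gE].
have H : (h^-1 *: ((fun q => (f q, g q)) (h *: v + p) - (f p, g p))) @[h --> (0:R)^'] --> (a, b).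
  have := cvg_pair df dg; rewrite -fE -gE; exact.
by apply: DeriveDef; [exact: (cvgP _ H)|exact: (cvg_lim (@norm_hausdorff _ _) H)].
Qed.

Lemma continuous_pair' (f : R * R -> V) (g : R * R -> W) p :
  {for p, continuous f} -> {for p, continuous g} -> {for p, continuous (fun q => (f q, g q))}.
Proof. by move=> cf cg; exact: cvg_pair. Qed.

Lemma pderiv_pair U (f : R * R -> V) (g : R * R -> W) s p : open U ->
  smooth_on U f -> smooth_on U g -> U p ->
  pderiv s (fun q => (f q, g q)) p = (pderiv s f p, pderiv s g p).
Proof.
move=> oU sf sg; elim: s p => [//|i s IH] p Up /=.
have [Hf _] := sf (size s).+1; have [Hg _] := sg (size s).+1.
have Df := derivableP (Hf s i p (ltnSn _) Up).
have Dg := derivableP (Hg s i p (ltnSn _) Up).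
rewrite -[RHS](@derive_val _ _ _ _ _ _ _ (is_derive_pair Df Dg)).
by apply: near_eq_derive; apply: filterS (open_near oU Up) => q /IH.
Qed.

Lemma smooth_on_pair U (f : R * R -> V) (g : R * R -> W) : open U ->
  smooth_on U f -> smooth_on U g -> smooth_on U (fun q => (f q, g q)).
Proof.
move=> oU sf sg k; have [Hf cf] := sf k; have [Hg cg] := sg k.
split=> [s i p sk Up|s p sk Up].
  have Df := derivableP (Hf s i p sk Up); have Dg := derivableP (Hg s i p sk Up).
  apply: (@ex_derive _ _ _ _ _ _ ('D_(axis R i) (pderiv s f) p, 'D_(axis R i) (pderiv s g) p)).
  apply: near_eq_is_derive (is_derive_pair Df Dg).
  by apply: filterS (open_near oU Up) => q Uq; rewrite (pderiv_pair s oU sf sg Uq).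
have /continuous_epsP cc := continuous_pair' (cf s p sk Up) (cg s p sk Up).
apply/continuous_epsP => e /cc[d d0 dP].
have /open_epsP/(_ _ Up)[r r0 rP] := oU.
exists (Num.min d r) => [|q]; first by rewrite lt_min d0.
by rewrite lt_min => /andP[/dP qe /rP Uq]; rewrite !(pderiv_pair s oU sf sg).
Qed.
End Pairs.

Lemma is_derive_left_inverse (F ze : R -> R) (s0 l : R) :
  (\forall s \near s0, F (ze s) = s) -> {for s0, continuous ze} ->
  is_derive (ze s0) 1 F l -> l != 0 -> is_derive s0 1 ze l^-1.
Proof.
move=> /nbhs_ballP[r /= r0 rP] /continuous_epsP cz /is_derive_epsP dF l0.
have nl0 : 0 < `|l| by rewrite normr_gt0.
have near s : `|s - s0| < r -> F (ze s) = s.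
  by move=> H; apply: rP; rewrite -ball_normE /= distrC.
apply/is_derive_epsP => e e0.
pose e1 := Num.min (`|l| / 2) (e * `|l| ^+ 2 / 2).
have e10 : 0 < e1.
  by rewrite lt_min; apply/andP; split; rewrite divr_gt0// mulr_gt0// exprn_gt0.
have e11 : e1 <= `|l| / 2 by rewrite ge_min lexx.
have e12 : e1 <= e * `|l| ^+ 2 / 2 by rewrite ge_min lexx orbT.
have [d d0 dP] := dF _ e10; have [d' d'0 d'P] := cz _ d0.
exists (Num.min r d') => [|h]; first by rewrite lt_min r0.
rewrite lt_min => /andP[hr hd'].
have E0 : F (ze s0) = s0 by apply: near; rewrite subrr normr0.
have Eh : F (ze (s0 + h)) = s0 + h by apply: near; rewrite addrAC subrr add0r.
set y := ze (s0 + h) - ze s0.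
have yd : `|y| < d by apply: d'P; rewrite addrAC subrr add0r.
have := dP _ yd; rewrite (_ : ze s0 + y = ze (s0 + h)); last by rewrite /y; ring.
rewrite Eh E0 [s0 + h - s0]addrAC subrr add0r => H.
have yb : `|l| / 2 * `|y| <= `|h|.
  have : `|y * l| <= `|h| + `|h - y * l|.
    by rewrite -[X in `|X|](subKr h (y * l)); exact: ler_normB.
  rewrite normrM => H2.
  have := ler_wpM2r (normr_ge0 y) e11; lra.
rewrite (_ : y - h * l^-1 = - ((h - y * l) / l)); last by field.
rewrite normrN normrM normfV ler_pdivrMr//; apply: (le_trans H).
apply: (@le_trans _ _ (e * `|l| * (`|l| / 2 * `|y|))).
  apply: le_trans (ler_wpM2r (normr_ge0 y) e12) _.
  by rewrite le_eqVlt; apply/orP; left; apply/eqP; field.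
have el : 0 <= e * `|l| by rewrite mulr_ge0// ltW.
have := ler_wpM2l el yb; lra.
Qed.

End SmoothClasses.

Section SolutionFormula.
Variable R : realType.
Implicit Types (p q : R * R) (z t : R).

Lemma fourB_gt0 z : 0 < 4 - atan z :> R.
Proof. by have := atan_lt2 z; lra. Qed.

(** With a = atan z: mf = 1 / (4 - a) and lnf = ln (4 - a) come from the gap 4 + Psi between the
    two characteristic slopes, qf = 1 / (1 + z^2) from the derivative of atan. *)
Definition mf z : R := (4 - atan z)^-1.
Definition lnf z : R := ln (4 - atan z).
Definition qf z : R := (1 + z ^+ 2)^-1.

Lemma is_derive_fourB z : is_derive z 1 (fun z : R => 4 - atan z) (- qf z).
Proof.
have := is_deriveB (is_derive_cst (4:R) z (1:R)) (is_derive1_atan z).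
by rewrite sub0r.
Qed.

Lemma is_derive_mf z : is_derive z 1 mf (mf z ^+ 2 * qf z).
Proof.
have h : 4 - atan z != 0 by rewrite gt_eqF// fourB_gt0.
have K := @is_deriveV R (fun z => 4 - atan z) z _ 1 h (is_derive_fourB z).
apply: (is_derive_eq K).
by rewrite /mf /GRing.scale /= -exprVn; ring.
Qed.

Lemma is_derive_lnf z : is_derive z 1 lnf (- qf z * mf z).
Proof.
have := @is_derive1_comp R (@ln R) (fun z => 4 - atan z) z _ _ (is_derive1_ln (fourB_gt0 z)) (is_derive_fourB z).
by rewrite mulrC.
Qed.

Lemma is_derive_qf z : is_derive z 1 qf (- 2 * z * qf z ^+ 2).
Proof.
have h : 1 + z ^+ 2 != 0 by exact: oneDsqr_neq0'.
have d : is_derive z 1 (fun z : R => 1 + z ^+ 2) (2 * z).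
  apply: (is_derive_eq (is_deriveD (is_derive_cst (1:R) z (1:R)) (is_deriveX 2 (is_derive_id z (1:R))))).
  by rewrite /GRing.scale /=; ring.
have K := @is_deriveV R (fun z => 1 + z ^+ 2) z _ 1 h d.
apply: (is_derive_eq K).
by rewrite /qf /GRing.scale /= -exprVn; ring.
Qed.

Lemma continuous_gf : continuous (fun z : R => z * qf z * mf z).
Proof.
move=> z; apply: (@continuousM _ _ (fun z => z * qf z) mf).
  apply: (@continuousM _ _ id qf); first exact: cvg_id.
  exact: is_derive_continuous (is_derive_qf z).
exact: is_derive_continuous (is_derive_mf z).
Qed.

(** A primitive without elementary closed form; only its derivative matters. *)
Definition Hf : R -> R := sval (cid2 (antiderivative continuous_gf)).

Lemma is_derive_Hf z : is_derive z 1 Hf (z * qf z * mf z).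
Proof. by rewrite /Hf; case: cid2. Qed.

(** The ring of functions generated by those entering the solution; it is stable under d/dz. *)
Inductive elem1 : (R -> R) -> Prop :=
| elem1_cst c : elem1 (fun=> c)
| elem1_id : elem1 id
| elem1_atan : elem1 atan
| elem1_qf : elem1 qf
| elem1_mf : elem1 mf
| elem1_lnf : elem1 lnf
| elem1_Hf : elem1 Hf
| elem1_add f g : elem1 f -> elem1 g -> elem1 (fun z => f z + g z)
| elem1_mul f g : elem1 f -> elem1 g -> elem1 (fun z => f z * g z).

Lemma elem1_derive f : elem1 f -> exists2 g, elem1 g & forall z, is_derive z 1 f (g z).
Proof.
elim=> [c|||||||{}f g _ [f' Ef' Df] _ [g' Eg' Dg]|{}f g Ef [f' Ef' Df] Eg [g' Eg' Dg]].
- by exists (fun=> 0); [exact: elem1_cst|move=> z; exact: is_derive_cst].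
- by exists (fun=> 1); [exact: elem1_cst|move=> z; exact: is_derive_id].
- by exists qf; [exact: elem1_qf|move=> z; exact: is_derive1_atan].
- exists (fun z => - 2 * z * (qf z * qf z)).
    apply: elem1_mul; apply: elem1_mul; by [exact: elem1_cst|exact: elem1_id|exact: elem1_qf].
  by move=> z; apply: (is_derive_eq (is_derive_qf z)); rewrite expr2.
- exists (fun z => mf z * mf z * qf z).
    apply: elem1_mul; [apply: elem1_mul|]; by [exact: elem1_mf|exact: elem1_qf].
  by move=> z; apply: (is_derive_eq (is_derive_mf z)); rewrite expr2.
- exists (fun z => - 1 * qf z * mf z).
    apply: elem1_mul; [apply: elem1_mul|]; by [exact: elem1_cst|exact: elem1_mf|exact: elem1_qf].
  by move=> z; apply: (is_derive_eq (is_derive_lnf z)); rewrite mulN1r.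
- exists (fun z => z * qf z * mf z); last by move=> z; exact: is_derive_Hf.
  apply: elem1_mul; [apply: elem1_mul|]; by [exact: elem1_id|exact: elem1_mf|exact: elem1_qf].
- exists (fun z => f' z + g' z); first exact: elem1_add.
  by move=> z; exact: is_deriveD (Df z) (Dg z).
- exists (fun z => f z * g' z + g z * f' z); first by apply: elem1_add; exact: elem1_mul.
  by move=> z; exact: is_deriveM (Df z) (Dg z).
Qed.

Definition ucoord p : R := p.2 + 2 * p.1.

(** The potential with foot function z. It is found by integrating Psi = - atan z along the lines
    u = x + 2 t = const from the initial line, where z = u; in d Phi the coefficient of dz
    vanishes by the relation u = z + t (4 - atan z), so the gradient depends on u and z alone. *)
Definition Phi_of (z : R * R -> R) p : R :=
  - p.1 * atan (z p) - ucoord p * (lnf (z p) - lnf (ucoord p)) - (Hf (z p) - Hf (ucoord p)).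

Definition Phix_of (z : R * R -> R) p : R := lnf (ucoord p) - lnf (z p).
Definition Phit_of (z : R * R -> R) p : R := - atan (z p) + 2 * Phix_of z p.

Section FootFunction.
Variables (U : set (R * R)) (z : R * R -> R).
Hypothesis oU : open U.
Hypothesis zE : forall p, U p -> kap p.1 (z p) = p.2 - 2 * p.1.
Hypothesis zlt : forall p, U p -> p.1 < 1 + z p ^+ 2.
Hypothesis cz : forall p, U p -> {for p, continuous z}.

(** z_x = (1 + z^2) rf, which blows up where the characteristics focus. *)
Definition rf p : R := (1 + z p ^+ 2 - p.1)^-1.

Lemma rf_gt0 p : U p -> 0 < rf p.
Proof. by move=> Up; rewrite invr_gt0 subr_gt0 zlt. Qed.

Let rf_neq0 p : U p -> 1 + z p ^+ 2 - p.1 != 0.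
Proof. by move=> Up; rewrite gt_eqF// subr_gt0 zlt. Qed.

Let near_slice i p : U p -> \forall s \near coord i p, U (if i then (p.1, s) else (s, p.2)).
Proof.
move=> Up; have /open_epsP/(_ _ Up)[r r0 rP] := oU; apply/nbhs_ballP.
exists r => //= s; rewrite -ball_normE /= distrC => sr; apply: rP.
by case: i sr => /= sr; rewrite norm_pair_lt /= subrr normr0 r0 ?andbT.
Qed.

Let slice_continuous i p : U p -> {for coord i p, continuous (slice i z p)}.
Proof.
move=> Up; have /continuous_epsP H := cz Up; apply/continuous_epsP => e /H[d d0 dP].
exists d => // s sd; case: i sd => /= sd; rewrite -surjective_pairing; apply: dP;
by rewrite norm_pair_lt /= subrr normr0 d0 ?andbT.
Qed.

(** On a line t = const the foot function inverts kap t. *)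
Lemma is_derive_zx p : U p -> is_derive p (axis R true) z ((1 + z p ^+ 2) * rf p).
Proof.
move=> Up; apply/is_derive_axisP.
have D := @is_derive_left_inverse R (fun y => kap p.1 y + 2 * p.1) (slice true z p) p.2
   ((1 + z p ^+ 2 - p.1) / (1 + z p ^+ 2)).
rewrite /rf -[X in is_derive _ _ _ X]invrK invfM invrK mulrC; refine (D _ _ _ _).
- apply: filterS (near_slice true Up) => s Us.
  by have := zE Us; rewrite /slice /= => ->; rewrite subrK.
- exact: (@slice_continuous true p Up).
- rewrite /slice -surjective_pairing.
  have := is_deriveD (is_derive_kap p.1 (z p)) (is_derive_cst (2 * p.1) (z p) (1:R)).
  by rewrite addr0.
- by rewrite mulf_neq0 ?invr_neq0 ?rf_neq0 ?oneDsqr_neq0'.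
Qed.

(** On a line x = const the relation can be solved for t as a function of the foot. *)
Lemma is_derive_zt p : U p ->
  is_derive p (axis R false) z (- (2 - atan (z p)) * ((1 + z p ^+ 2) * rf p)).
Proof.
move=> Up; apply/is_derive_axisP.
have tb y : 2 - atan y != 0 :> R by rewrite gt_eqF// subr_gt0 atan_lt2.
have sE q : U q -> (q.2 - z q) / (2 - atan (z q)) = q.1.
  move=> Uq; have := zE Uq; rewrite /kap => E.
  have -> : q.2 - z q = q.1 * (2 - atan (z q)) by rewrite mulrBr; lra.
  by rewrite mulfK.
have D := @is_derive_left_inverse R (fun y => (p.2 - y) / (2 - atan y)) (slice false z p) p.1
   (- (1 + z p ^+ 2 - p.1) / (1 + z p ^+ 2) / (2 - atan (z p))).
rewrite (_ : - (2 - atan (z p)) * ((1 + z p ^+ 2) * rf p) =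
  (- (1 + z p ^+ 2 - p.1) / (1 + z p ^+ 2) / (2 - atan (z p)))^-1); last first.
  by rewrite /rf; field; rewrite tb rf_neq0 ?oneDsqr_neq0'.
refine (D _ _ _ _).
- by apply: filterS (near_slice false Up) => s /sE.
- exact: (@slice_continuous false p Up).
- rewrite /slice -surjective_pairing.
  have h1 : is_derive (z p) 1 (fun y : R => p.2 - y) (- 1).
    by have := is_deriveB (is_derive_cst p.2 (z p) (1:R)) (is_derive_id (z p) (1:R)); rewrite sub0r.
  have h2 : is_derive (z p) 1 (fun y : R => 2 - atan y) (- (1 + z p ^+ 2)^-1).
    by have := is_deriveB (is_derive_cst (2:R) (z p) (1:R)) (is_derive1_atan (z p)); rewrite sub0r.
  have h3 := @is_deriveV R (fun y => 2 - atan y) (z p) _ 1 (tb (z p)) h2.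
  apply: (is_derive_eq (is_deriveM h1 h3)).
  rewrite /GRing.scale /=.
  have -> : p.2 - z p = p.1 * (2 - atan (z p)).
    by have := zE Up; rewrite /kap mulrBr => E; lra.
  by field; rewrite tb ?oneDsqr_neq0'.
- by rewrite !mulf_neq0 ?oppr_eq0 ?invr_neq0 ?rf_neq0 ?oneDsqr_neq0'.
Qed.

Let dz i p : R := (if i then 1 else - (2 - atan (z p))) * ((1 + z p ^+ 2) * rf p).

Let is_derive_z i p : U p -> is_derive p (axis R i) z (dz i p).
Proof.
by rewrite /dz; case: i => Up; [rewrite mul1r; exact: is_derive_zx|exact: is_derive_zt].
Qed.

Lemma is_derive_compz (f f' : R -> R) i p : U p -> (forall y : R, is_derive y 1 f (f' y)) ->
  is_derive p (axis R i) (fun q => f (z q)) (f' (z p) * dz i p).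
Proof.
move=> Up df; apply/is_derive_axisP.
have := is_derive_z i Up; move=> /is_derive_axisP H.
have E : slice i z p (coord i p) = z p by case: i {H}; rewrite /slice /= -surjective_pairing.
have H2 : is_derive (slice i z p (coord i p)) 1 f (f' (z p)) by rewrite E.
have := is_derive1_comp H2 H; by case: i {H E H2}.
Qed.

Lemma is_derive_ucoord i p : is_derive p (axis R i) ucoord (if i then 1 else 2).
Proof.
apply/is_derive_axisP; case: i; rewrite /slice /ucoord /=.
  have := is_deriveD (is_derive_id p.2 (1:R)) (is_derive_cst (2 * p.1) p.2 (1:R)).
  by rewrite addr0.
have := is_deriveD (is_derive_cst p.2 p.1 (1:R)) (is_deriveZ 2 (is_derive_id p.1 (1:R))).
by rewrite add0r /GRing.scale /= mulr1.
Qed.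

Lemma is_derive_compu (f f' : R -> R) i p : (forall y : R, is_derive y 1 f (f' y)) ->
  is_derive p (axis R i) (fun q => f (ucoord q)) (f' (ucoord p) * (if i then 1 else 2)).
Proof.
move=> df; apply/is_derive_axisP.
have := is_derive_ucoord i p; move=> /is_derive_axisP H.
have E : slice i ucoord p (coord i p) = ucoord p by case: i {H}; rewrite /slice /= -surjective_pairing.
have H2 : is_derive (slice i ucoord p (coord i p)) 1 f (f' (ucoord p)) by rewrite E.
have := is_derive1_comp H2 H; by case: i {H E H2}.
Qed.

Lemma is_derive_fst i p : is_derive p (axis R i) (fun q => q.1) (if i then 0 else 1).
Proof.
by apply/is_derive_axisP; case: i; [exact: is_derive_cst|exact: is_derive_id].
Qed.

(** The stable class on U: its only generator beyond those of one variable is rf. *)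
Inductive elem2 : (R * R -> R) -> Prop :=
| elem2_z f : elem1 f -> elem2 (fun p => f (z p))
| elem2_u f : elem1 f -> elem2 (fun p => f (ucoord p))
| elem2_t : elem2 (fun p => p.1)
| elem2_r : elem2 rf
| elem2_add f g : elem2 f -> elem2 g -> elem2 (fun p => f p + g p)
| elem2_mul f g : elem2 f -> elem2 g -> elem2 (fun p => f p * g p).

Lemma elem2_cst c : elem2 (fun=> c).
Proof. exact: (elem2_u (elem1_cst c)). Qed.

Lemma elem2_dz i : elem2 (dz i).
Proof.
have zz : elem2 (fun p => 1 + z p ^+ 2).
  have -> : (fun p => 1 + z p ^+ 2) = (fun p => 1 + z p * z p) by [].
  apply: (@elem2_z (fun y => 1 + y * y)).
  by apply: elem1_add; [exact: elem1_cst|apply: elem1_mul; exact: elem1_id].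
rewrite /dz; apply: elem2_mul; last by apply: elem2_mul => //; exact: elem2_r.
case: i; first exact: elem2_cst.
have -> : (fun p => - (2 - atan (z p))) = (fun p => - 2 + atan (z p)).
  by apply/funext => p; ring.
apply: (@elem2_z (fun y => - 2 + atan y)).
by apply: elem1_add; [exact: elem1_cst|exact: elem1_atan].
Qed.

Lemma elem2_derive f i : elem2 f ->
  exists2 g, elem2 g & forall p, U p -> is_derive p (axis R i) f (g p).
Proof.
elim=> [{}f /elem1_derive[f' Ef' Df]|{}f /elem1_derive[f' Ef' Df]|||
  {}f g Ef [f' Ef' Df] Eg [g' Eg' Dg]|{}f g Ef [f' Ef' Df] Eg [g' Eg' Dg]].
- exists (fun p => f' (z p) * dz i p); first by apply: elem2_mul; [exact: elem2_z|exact: elem2_dz].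
  by move=> p Up; exact: is_derive_compz.
- exists (fun p => f' (ucoord p) * (if i then 1 else 2)).
    by apply: elem2_mul; [exact: elem2_u|exact: elem2_cst].
  by move=> p _; exact: is_derive_compu.
- exists (fun=> if i then 0 else 1); first exact: elem2_cst.
  by move=> p _; exact: is_derive_fst.
- exists (fun p => - 1 * (rf p * rf p) * (2 * z p * dz i p + - 1 * (if i then 0 else 1))).
    apply: elem2_mul; first by apply: elem2_mul; [exact: elem2_cst|apply: elem2_mul; exact: elem2_r].
    apply: elem2_add; last exact: elem2_cst.
    apply: elem2_mul; last exact: elem2_dz.
    apply: (@elem2_z (fun y => 2 * y)).
    by apply: elem1_mul; [exact: elem1_cst|exact: elem1_id].
  move=> p Up; have dsq (y : R) : is_derive y 1 (fun y : R => 1 + y ^+ 2) (2 * y).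
    apply: (is_derive_eq (is_deriveD (is_derive_cst (1:R) y (1:R)) (is_deriveX 2 (is_derive_id y (1:R))))).
    by rewrite /GRing.scale /=; ring.
  have H := is_deriveB (is_derive_compz i Up dsq) (is_derive_fst i p).
  apply/is_derive_axisP; move/is_derive_axisP: H => H.
  have h0 : slice i ((fun q => 1 + z q ^+ 2) - (fun q => q.1)) p (coord i p) != 0.
    by case: i {H}; rewrite /slice /= -surjective_pairing; exact: rf_neq0.
  have K := is_deriveV h0 H.
  have E : slice i rf p = (fun y => (slice i ((fun q => 1 + z q ^+ 2) - (fun q => q.1)) p y)^-1).
    by apply/funext => y; case: i {H h0 K}.
  rewrite E; apply: (is_derive_eq K).
  have -> : slice i ((fun q => 1 + z q ^+ 2) - (fun q => q.1)) p (coord i p) = 1 + z p ^+ 2 - p.1.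
    by case: i {H h0 K E}; rewrite /slice /= -surjective_pairing.
  rewrite /rf /GRing.scale /= -exprVn.
  by move: (dz i p) (if i then 0 else 1) (_^-1) => a b c; ring.
- exists (fun p => f' p + g' p); first exact: elem2_add.
  by move=> p Up; exact: is_deriveD (Df p Up) (Dg p Up).
- exists (fun p => f p * g' p + g p * f' p); first by apply: elem2_add; exact: elem2_mul.
  by move=> p Up; exact: is_deriveM (Df p Up) (Dg p Up).
Qed.

Lemma elem1_continuous f : elem1 f -> continuous f.
Proof. by move=> /elem1_derive[f' _ Df] x; exact: is_derive_continuous (Df x). Qed.

Lemma continuous_ucoord : continuous ucoord.
Proof.
move=> p; apply: cvgD; first exact: cvg_snd.
by apply: cvgM; [exact: cvg_cst|exact: cvg_fst].
Qed.

Lemma elem2_continuous f p : elem2 f -> U p -> {for p, continuous f}.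
Proof.
move=> Ef Up; elim: Ef => [{}f /elem1_continuous cf|{}f /elem1_continuous cf|||
  {}f g _ cf _ cg|{}f g _ cf _ cg].
- by apply: (@continuous_comp _ _ _ z f); [exact: cz|exact: cf].
- by apply: (@continuous_comp _ _ _ ucoord f); [exact: continuous_ucoord|exact: cf].
- exact: cvg_fst.
- apply: cvgV; first exact: rf_neq0.
  apply: cvgB; last exact: cvg_fst.
  by apply: cvgD; [exact: cvg_cst|apply: cvgM; exact: cz].
- exact: continuousD.
- exact: continuousM.
Qed.

Lemma elem2_smooth f : elem2 f -> smooth_on U f.
Proof.
apply: (@class_smooth R U elem2 oU) => [g p|g i]; [exact: elem2_continuous|exact: elem2_derive].
Qed.

Lemma is_derive_Phi_x p : U p -> is_derive p (axis R true) (Phi_of z) (Phix_of z p).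
Proof.
move=> Up.
have a1 := is_derive_compz true Up (fun y => is_derive1_atan y).
have a2 := is_derive_compz true Up is_derive_lnf.
have a3 := is_derive_compz true Up is_derive_Hf.
have b2 := is_derive_compu true p is_derive_lnf.
have b3 := is_derive_compu true p is_derive_Hf.
have c1 := is_derive_fst true p.
have d1 := is_derive_ucoord true p.
apply: (is_derive_eq (is_deriveB (is_deriveB (is_deriveM (is_deriveN c1) a1)
  (is_deriveM d1 (is_deriveB a2 b2))) (is_deriveB a3 b3))).
rewrite /GRing.scale /= !fctE /Phix_of /dz /qf.
have := zE Up; rewrite /kap => E.
have -> : ucoord p = z p + p.1 * (4 - atan (z p)) by rewrite /ucoord; lra.
rewrite /mf; field.
by rewrite ?oneDsqr_neq0' ?(gt_eqF (fourB_gt0 _)).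
Qed.

Lemma is_derive_Phi_t p : U p -> is_derive p (axis R false) (Phi_of z) (Phit_of z p).
Proof.
move=> Up.
have a1 := is_derive_compz false Up (fun y => is_derive1_atan y).
have a2 := is_derive_compz false Up is_derive_lnf.
have a3 := is_derive_compz false Up is_derive_Hf.
have b2 := is_derive_compu false p is_derive_lnf.
have b3 := is_derive_compu false p is_derive_Hf.
have c1 := is_derive_fst false p.
have d1 := is_derive_ucoord false p.
apply: (is_derive_eq (is_deriveB (is_deriveB (is_deriveM (is_deriveN c1) a1)
  (is_deriveM d1 (is_deriveB a2 b2))) (is_deriveB a3 b3))).
rewrite /GRing.scale /= !fctE /Phit_of /Phix_of /dz /qf.
have := zE Up; rewrite /kap => E.
have -> : ucoord p = z p + p.1 * (4 - atan (z p)) by rewrite /ucoord; lra.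
rewrite /mf; field.
by rewrite ?oneDsqr_neq0' ?(gt_eqF (fourB_gt0 _)).
Qed.

End FootFunction.
End SolutionFormula.

(** * The solution on Omega *)

Section TheSolution.
Variable R : realType.
Implicit Types (p q : R * R) (z t : R).

Lemma continuous_wB : continuous (@wB R).
Proof.
move=> t; apply: (@continuous_comp _ _ _ (fun t => t - 1) Num.sqrt).
  by apply: cvgB; [exact: cvg_id|exact: cvg_cst].
exact: sqrt_continuous.
Qed.

Lemma continuous_xB : continuous (@xB R).
Proof.
move=> t; apply: cvgD; first exact: continuous_wB.
apply: cvgM; first exact: cvg_id.
apply: cvgB; first exact: cvg_cst.
by apply: (@continuous_comp _ _ _ (@wB R) atan); [exact: continuous_wB|exact: continuous_atan].
Qed.

Lemma continuous_xBp : continuous (fun p => p.2 - xB p.1).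
Proof.
move=> p; apply: cvgB; first exact: cvg_snd.
by apply: (@continuous_comp _ _ _ fst (@xB R)); [exact: cvg_fst|exact: continuous_xB].
Qed.

Lemma open_sublevel (f : R * R -> R) (c : R) : continuous f -> open [set p | f p < c].
Proof.
move=> cf; apply/open_epsP => p /= fp.
by have [r r0 rP] := continuous_near_lt (cf p) fp; exists r.
Qed.

Lemma open_superlevel (f : R * R -> R) (c : R) : continuous f -> open [set p | c < f p].
Proof.
move=> cf; apply/open_epsP => p /= fp.
by have [r r0 rP] := continuous_near_gt (cf p) fp; exists r.
Qed.

Lemma open_OmegaC : open (@OmegaC R).
Proof.
have -> : @OmegaC R = [set p | ucoord p < 4] `|` [set p | 0 < p.2 - xB p.1].
  by apply/seteqP; split => p /=; rewrite subr_gt0.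
apply: openU; first exact: open_sublevel (@continuous_ucoord R).
exact: open_superlevel continuous_xBp.
Qed.

Lemma closed_clOmegaC : closed (@clOmegaC R).
Proof.
have -> : @clOmegaC R = ~` ([set p | 4 < ucoord p] `&` [set p | p.2 - xB p.1 < 0]).
  apply/seteqP; split => p /=; rewrite subr_lt0.
    by move=> [h|h] [/= h1 h2]; [move: h1|move: h2]; rewrite ltNge h.
  move=> H; have [h|h] := leP (p.2 + 2 * p.1) 4; [by left|right].
  by rewrite leNgt; apply/negP => h'; apply: H.
apply: open_closedC; apply: openI.
  exact: open_superlevel (@continuous_ucoord R).
exact: open_sublevel continuous_xBp.
Qed.

Lemma zC_continuous_cl p : clOmegaC p -> forall e : R, 0 < e -> exists2 d : R, 0 < d &
  forall q, clOmegaC q -> `|q - p| < d -> `|zC q - zC p| < e.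
Proof.
move=> cp e e0; pose m := 5 * (`|p| + 1).
have [C C0 HC] : exists2 C : R, 0 < C & forall q, clOmegaC q -> `|zC q| <= m ->
    `|zC q - zC p| ^+ 3 <= C * `|q - p|.
  exists (1200 * (1 + m ^+ 2)); first by apply: mulr_gt0; [rewrite ltr0n|exact: oneDsqr_gt0'].
  move=> q cq qm; apply: zC_cubic => //.
  by apply: le_trans (zC_bound cp) _; rewrite /m ler_wpM2l// lerDl.
exists (Num.min 1 (e ^+ 3 / C)) => [|q cq]; first by rewrite lt_min ltr01 divr_gt0// exprn_gt0.
rewrite lt_min => /andP[q1 qe].
have qm : `|zC q| <= m.
  apply: le_trans (zC_bound cq) _; rewrite /m ler_wpM2l//.
  rewrite -[X in `|X|](subrK p q) addrC; apply: (le_trans (ler_normD _ _)).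
  by rewrite lerD2l ltW.
rewrite -(@ltr_pXn2r R 3%N)// ?nnegrE//; last exact: ltW.
by apply: (le_lt_trans (HC _ cq qm)); rewrite mulrC -ltr_pdivlMr.
Qed.

Lemma zC_continuous p : OmegaC p -> {for p, continuous (@zC R)}.
Proof.
move=> Op; apply/continuous_epsP => e e0.
have [d d0 dP] := zC_continuous_cl (sub_OmegaC Op) e0.
have /open_epsP/(_ _ Op)[r r0 rP] := open_OmegaC.
exists (Num.min d r) => [|q]; first by rewrite lt_min d0.
by rewrite lt_min => /andP[qd /rP/sub_OmegaC cq]; exact: dP.
Qed.

(** The acoustical metric, expressed by the foot function through Psi = - atan z. *)
Definition metric_of (z : R * R -> R) p : R * R * R := acoustical_form (- atan (z p)).

Definition form_tt z : R := - 8 * (2 + (- 1) * atan z) * (mf z * mf z).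
Definition form_tx z : R := 2 * atan z * (mf z * mf z).
Definition form_xx z : R := 4 * (mf z * mf z).

Lemma acoustical_formE z :
  acoustical_form (- atan z) = (form_tt z, form_tx z, form_xx z) :> R * R * R.
Proof.
rewrite /acoustical_form /form_tt /form_tx /form_xx /mf -exprVn.
by congr (_, _, _); ring.
Qed.

Lemma elem1_form_tt : elem1 form_tt.
Proof.
apply: elem1_mul; last by apply: elem1_mul; exact: elem1_mf.
apply: elem1_mul; first exact: elem1_cst.
apply: elem1_add; first exact: elem1_cst.
by apply: elem1_mul; [exact: elem1_cst|exact: elem1_atan].
Qed.

Lemma elem1_form_tx : elem1 form_tx.
Proof.
apply: elem1_mul; last by apply: elem1_mul; exact: elem1_mf.
by apply: elem1_mul; [exact: elem1_cst|exact: elem1_atan].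
Qed.

Lemma elem1_form_xx : elem1 form_xx.
Proof. by apply: elem1_mul; [exact: elem1_cst|apply: elem1_mul; exact: elem1_mf]. Qed.

Section OnDomain.
Variables (U : set (R * R)) (z : R * R -> R).
Hypothesis oU : open U.
Hypothesis zE : forall p, U p -> kap p.1 (z p) = p.2 - 2 * p.1.
Hypothesis zlt : forall p, U p -> p.1 < 1 + z p ^+ 2.
Hypothesis cz : forall p, U p -> {for p, continuous z}.

Lemma Phi_of_smooth : smooth_on U (Phi_of z).
Proof.
have -> : Phi_of z = (fun p => (- 1 * p.1) * atan (z p) + ((- 1) * ((fun y => y) (ucoord p)) *
    (lnf (z p) + (- 1) * lnf (ucoord p)) + ((- 1) * Hf (z p) + Hf (ucoord p)))).
  by apply/funext => p; rewrite /Phi_of; ring.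
apply: (elem2_smooth oU zE zlt cz).
apply: elem2_add.
  apply: elem2_mul; last by apply: elem2_z; exact: elem1_atan.
  by apply: elem2_mul; [exact: elem2_cst|exact: elem2_t].
apply: elem2_add; last first.
  apply: elem2_add; last by apply: elem2_u; exact: elem1_Hf.
  by apply: elem2_mul; [exact: elem2_cst|apply: elem2_z; exact: elem1_Hf].
apply: elem2_mul.
  by apply: elem2_mul; [exact: elem2_cst|apply: (@elem2_u _ z id); exact: elem1_id].
apply: elem2_add; first by apply: elem2_z; exact: elem1_lnf.
by apply: elem2_mul; [exact: elem2_cst|apply: elem2_u; exact: elem1_lnf].
Qed.

Lemma metric_of_smooth : smooth_on U (metric_of z).
Proof.
have -> : metric_of z = (fun p => (form_tt (z p), form_tx (z p), form_xx (z p))).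
  by apply/funext => p; rewrite /metric_of acoustical_formE.
have sm f : elem1 f -> smooth_on U (fun p => f (z p)).
  by move=> ef; apply: (elem2_smooth oU zE zlt cz); exact: elem2_z.
apply: smooth_on_pair => //; first apply: smooth_on_pair => //.
- exact: sm elem1_form_tt.
- exact: sm elem1_form_tx.
- exact: sm elem1_form_xx.
Qed.

Lemma derive_Phi_x p : U p -> 'D_(e_x R) (Phi_of z) p = Phix_of z p.
Proof. by move=> Up; rewrite -(@derive_val _ _ _ _ _ _ _ (is_derive_Phi_x oU zE zlt cz Up)). Qed.

Lemma derive_Phi_t p : U p -> 'D_(e_t R) (Phi_of z) p = Phit_of z p.
Proof. by move=> Up; rewrite -(@derive_val _ _ _ _ _ _ _ (is_derive_Phi_t oU zE zlt cz Up)). Qed.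

Lemma Psi_Phi p : U p -> Psi (Phi_of z) p = - atan (z p).
Proof. by move=> Up; rewrite /Psi derive_Phi_x// derive_Phi_t// /Phit_of addrK. Qed.

Definition dzv i p : R := (if i then 1 else - (2 - atan (z p))) * ((1 + z p ^+ 2) * rf z p).

Lemma is_derive_Phix i p : U p -> is_derive p (axis R i) (Phix_of z)
  (- qf (ucoord p) * mf (ucoord p) * (if i then 1 else 2) - - qf (z p) * mf (z p) * dzv i p).
Proof.
move=> Up; exact: is_deriveB (is_derive_compu i p (@is_derive_lnf R))
  (is_derive_compz oU zE zlt cz i Up (@is_derive_lnf R)).
Qed.

Lemma is_derive_Phit i p : U p -> is_derive p (axis R i) (Phit_of z)
  (- (qf (z p) * dzv i p) + 2 * (- qf (ucoord p) * mf (ucoord p) * (if i then 1 else 2) -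
     - qf (z p) * mf (z p) * dzv i p)).
Proof.
move=> Up; apply: (is_derive_eq (is_deriveD
  (is_deriveN (is_derive_compz oU zE zlt cz i Up (fun y => is_derive1_atan y)))
  (is_deriveZ 2 (is_derive_Phix i Up)))).
by rewrite /GRing.scale.
Qed.

Lemma derive2_x i p : U p -> 'D_(axis R i) ('D_(e_x R) (Phi_of z)) p =
  - qf (ucoord p) * mf (ucoord p) * (if i then 1 else 2) - - qf (z p) * mf (z p) * dzv i p.
Proof.
move=> Up; rewrite -(@derive_val _ _ _ _ _ _ _ (is_derive_Phix i Up)).
by apply: near_eq_derive; apply: filterS (open_near oU Up) => q /derive_Phi_x.
Qed.

Lemma derive2_t i p : U p -> 'D_(axis R i) ('D_(e_t R) (Phi_of z)) p =
  - (qf (z p) * dzv i p) + 2 * (- qf (ucoord p) * mf (ucoord p) * (if i then 1 else 2) -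
     - qf (z p) * mf (z p) * dzv i p).
Proof.
move=> Up; rewrite -(@derive_val _ _ _ _ _ _ _ (is_derive_Phit i Up)).
by apply: near_eq_derive; apply: filterS (open_near oU Up) => q /derive_Phi_t.
Qed.

(** Since z_t = - (2 - atan z) z_x, every second derivative is a multiple of z_x plus a function of
    u. The functions of u cancel, and so do the multiples of z_x, because mf (4 - atan z) = 1. *)
Lemma Phi_of_wave p : U p -> wave_equation (Phi_of z) p.
Proof.
move=> Up; rewrite /wave_equation; have := Psi_Phi Up; rewrite /Psi => ->.
rewrite (derive2_t false Up : 'D_(e_t R) _ p = _) (derive2_x false Up : 'D_(e_t R) _ p = _).
rewrite (derive2_x true Up : 'D_(e_x R) _ p = _) /dzv.
have E : qf (z p) = qf (z p) * mf (z p) * (4 - atan (z p)).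
  by rewrite -mulrA mulVf ?mulr1// gt_eqF// fourB_gt0.
move: E; move: (qf (z p)) (mf (z p)) (atan (z p)) ((1 + z p ^+ 2) * rf z p)
  (qf (ucoord p)) (mf (ucoord p)) => qz mz a r qu mu E.
rewrite {1}E; ring.
Qed.

End OnDomain.

Definition PhiC : R * R -> R := Phi_of (@zC R).

Lemma zC_kapO p : OmegaC p -> kap p.1 (zC p) = p.2 - 2 * p.1.
Proof. by move=> /sub_OmegaC; exact: zC_kap. Qed.

Lemma OmegaC_le0 p : p.1 <= 0 -> OmegaC p.
Proof.
move=> t0; have [u4|u4] := ltP (p.2 + 2 * p.1) 4; [by left|right].
by rewrite xB_le1; lra.
Qed.

Lemma Sigma_OmegaC : Sigma `<=` @OmegaC R.
Proof. by move=> p p0; apply: OmegaC_le0; rewrite p0. Qed.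

Lemma zC_init x : zC (0, x) = x :> R.
Proof.
have l (y : R) : 0 < 1 + y ^+ 2 by exact: oneDsqr_gt0'.
have E : kap 0 x = x - 2 * 0 by rewrite /kap; ring.
have [x0|x0] := leP 0 x.
  by have [] := @right_uniq R (0, x) x x0 (ltW (l x)) E.
by have [] := @left_uniq R (0, x) x x0 (l x) E; rewrite //=; lra.
Qed.

Lemma Psi_PhiC p : OmegaC p -> Psi PhiC p = - atan (zC p).
Proof. exact: (Psi_Phi open_OmegaC zC_kapO (@zC_lt R) zC_continuous). Qed.

Lemma metric_PhiC p : OmegaC p -> acoustical_metric PhiC p = metric_of (@zC R) p.
Proof. by move=> Op; rewrite /acoustical_metric Psi_PhiC. Qed.

Lemma PhiC_smooth : smooth_on (@OmegaC R) PhiC.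
Proof. exact: (Phi_of_smooth open_OmegaC zC_kapO (@zC_lt R) zC_continuous). Qed.

Lemma PhiC_init : initial_data PhiC.
Proof.
move=> x; have O0 : OmegaC (0, x) by exact: Sigma_OmegaC.
split; first by rewrite /PhiC /Phi_of zC_init /ucoord /= mulr0 addr0; ring.
rewrite /PhiC (derive_Phi_t open_OmegaC zC_kapO (@zC_lt R) zC_continuous O0).
by rewrite /Phit_of /Phix_of zC_init /ucoord /= mulr0 addr0 subrr mulr0 addr0.
Qed.

Lemma PhiC_classical : classical_solution (@OmegaC R) PhiC.
Proof.
split.
- exact: open_OmegaC.
- exact: Sigma_OmegaC.
- exact: PhiC_smooth.
- exact: (Phi_of_wave open_OmegaC zC_kapO (@zC_lt R) zC_continuous).
- exact: PhiC_init.
Qed.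

Lemma lorentzian_acoustical (psi : R) : psi <> - 4 -> lorentzian (acoustical_form psi).
Proof.
move=> /eqP psi4; have n4 : 4 + psi != 0 by rewrite addrC addr_eq0.
exists (1, psi / 2), (0, (4 + psi) / 2); split; rewrite /form_app /acoustical_form /=;
by field.
Qed.

Lemma natanN4 z : - atan z <> - 4 :> R.
Proof. by move=> E; have := atan_lt2 z; lra. Qed.

Lemma metric_smooth_lorentzian :
  smooth_lorentzian_metric (@OmegaC R) (acoustical_metric PhiC).
Proof.
split=> [|p Op].
  apply: (@smooth_on_eq _ _ _ (metric_of (@zC R))); first exact: open_OmegaC.
    by move=> q /metric_PhiC.
  exact: (metric_of_smooth open_OmegaC zC_kapO (@zC_lt R) zC_continuous).
by rewrite metric_PhiC//; apply: lorentzian_acoustical; exact: natanN4.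
Qed.

End TheSolution.

(** * Omega is globally hyperbolic *)

Section Curves.
Variable R : realType.
Implicit Types (I : set R) (g : R -> R * R) (v : R * R).

Lemma deriv_within_eps I g (s : R) v : deriv_within I g s v ->
  forall e : R, 0 < e -> exists2 d : R, 0 < d & forall h, I (s + h) -> `|h| < d ->
    `|g (s + h) - g s - h *: v| <= e * `|h|.
Proof.
move=> H e e0; move/cvgrPdist_lt/(_ _ e0): H.
rewrite /prop_near1 /within /= => /nbhs_ballP[d /= d0 dP].
have {}dP (r : R) : `|s - r| < d -> r != s -> I r -> `|v - (r - s)^-1 *: (g r - g s)| < e.
  by move=> rd rs Ir; move: (dP r); rewrite -ball_normE /=; apply.
exists d => // h Ih hd; have [->|h0] := eqVneq h 0.
  by rewrite addr0 subrr scale0r subrr !normr0 mulr0.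
have sh : s + h - s = h by ring.
have := dP (s + h); rewrite opprD addrA subrr sub0r normrN sh; move=> K.
have {}K := K hd (_ : s + h != s) Ih.
have {}K : `|v - h^-1 *: (g (s + h) - g s)| < e.
  by apply: K; rewrite -subr_eq0 sh.
have -> : g (s + h) - g s - h *: v = - (h *: (v - h^-1 *: (g (s + h) - g s))).
  by rewrite scalerBr scalerKV ?unitfE// opprB.
by rewrite normrN normrZ mulrC ler_pM2r ?normr_gt0//; exact: ltW.
Qed.

Lemma deriv_within_of_eps I g (s : R) v :
  (forall e : R, 0 < e -> exists2 d : R, 0 < d & forall h, I (s + h) -> `|h| < d ->
    `|g (s + h) - g s - h *: v| <= e * `|h|) -> deriv_within I g s v.
Proof.
move=> H; apply/cvgrPdist_lt => e e0.
have [|d d0 dP] := H (e / 2); first by rewrite divr_gt0.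
rewrite /prop_near1 /within /=; apply/nbhs_ballP; exists d => //= r.
rewrite -ball_normE /= distrC => rd rs Ir; set h := r - s in rd.
have h0 : h != 0 by rewrite subr_eq0.
have rE : r = s + h by rewrite /h; ring.
have := dP h; rewrite -rE => /(_ Ir rd) K.
have -> : v - h^-1 *: (g r - g s) = - (h^-1 *: (g r - g s - h *: v)).
  by rewrite [in RHS]scalerBr scalerK ?unitfE// opprB.
rewrite normrN normrZ normfV mulrC ltr_pdivrMr ?normr_gt0//.
apply: (le_lt_trans K); rewrite ltr_pM2r ?normr_gt0//.
by rewrite ltr_pdivrMr// ltr_pMr// ltrDl.
Qed.

Lemma deriv_within_components I g (s : R) v (r : R) : 0 < r ->
  (forall s', `|s' - s| < r -> I s') -> deriv_within I g s v ->
  is_derive s 1 (fun s => (g s).1) v.1 /\ is_derive s 1 (fun s => (g s).2) v.2.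
Proof.
move=> r0 rI /deriv_within_eps H.
have K e : 0 < e -> exists2 d : R, 0 < d & forall h, `|h| < d ->
    `|(g (s + h)).1 - (g s).1 - h * v.1| <= e * `|h| /\
    `|(g (s + h)).2 - (g s).2 - h * v.2| <= e * `|h|.
  move=> /H[d d0 dP]; exists (Num.min r d) => [|h]; first by rewrite lt_min r0.
  rewrite lt_min => /andP[hr hd]; have := dP h; rewrite norm_pair_le => K.
  by apply/andP; apply: K => //; apply: rI; rewrite addrAC subrr add0r.
by split; apply/is_derive_epsP => e /K[d d0 dP]; exists d => // h /dP[].
Qed.

Lemma deriv_within_pair I (g1 g2 : R -> R) (s d1 d2 : R) :
  is_derive s 1 g1 d1 -> is_derive s 1 g2 d2 ->
  deriv_within I (fun s => (g1 s, g2 s)) s (d1, d2).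
Proof.
move=> /is_derive_epsP H1 /is_derive_epsP H2; apply: deriv_within_of_eps => e e0.
have [r1 r10 r1P] := H1 _ e0; have [r2 r20 r2P] := H2 _ e0.
exists (Num.min r1 r2) => [|h _]; first by rewrite lt_min r10.
by rewrite lt_min norm_pair_le => /andP[/r1P h1 /r2P h2] /=; apply/andP.
Qed.

Lemma deriv_within_limit I g (s : R) v : deriv_within I g s v ->
  forall e : R, 0 < e -> exists2 d : R, 0 < d & forall s', I s' -> `|s' - s| < d ->
    `|g s' - g s| < e.
Proof.
move=> /deriv_within_eps/(_ 1 ltr01)[d d0 dP] e e0.
have v0 : 0 < 1 + `|v| by rewrite ltr_pwDl.
exists (Num.min d (e / (1 + `|v|))) => [|s' Is']; first by rewrite lt_min d0 divr_gt0.
rewrite lt_min ltr_pdivlMr// => /andP[sd se]; set h := s' - s in sd se.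
have sE : s' = s + h by rewrite /h; ring.
have := dP h; rewrite -sE mul1r => /(_ Is' sd) K.
rewrite -(subrK (h *: v) (g s' - g s)); apply: (le_lt_trans (ler_normD _ _)).
by rewrite normrZ; apply: le_lt_trans se; rewrite mulrDr mulr1 lerD2r.
Qed.

#[export] Instance from_left_proper (b : \bar R) : ProperFilter (from_left b).
Proof. by case: b => [b||] /=; apply: _. Qed.

#[export] Instance from_right_proper (a : \bar R) : ProperFilter (from_right a).
Proof. by case: a => [a||] /=; apply: _. Qed.

Lemma from_left_mem (a b : \bar R) (s0 : R) : (a < s0%:E < b)%E ->
  from_left b [set s | s0 < s /\ (s%:E < b)%E].
Proof.
case: b => [b||] /andP[_ sb] //=.
  rewrite lte_fin in sb; apply: filterS2 (nbhs_left_gt sb) (nbhs_left_lt b) => s h1 h2.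
  by split; rewrite ?lte_fin.
by exists s0; split; [exact: num_real|move=> s h; rewrite /= ltry].
Qed.

Lemma from_right_mem (a b : \bar R) (s0 : R) : (a < s0%:E < b)%E ->
  from_right a [set s | s < s0 /\ (a < s%:E)%E].
Proof.
case: a => [a||] /andP[sa _] //=.
  rewrite lte_fin in sa; apply: filterS2 (nbhs_right_lt sa) (nbhs_right_gt a) => s h1 h2.
  by split; rewrite ?lte_fin.
by exists s0; split; [exact: num_real|move=> s h; rewrite /= ltNyr].
Qed.

Lemma ereal_mid (a b : \bar R) : (a < b)%E -> exists s : R, (a < s%:E < b)%E.
Proof.
case: a => [a||]; case: b => [b||] //= ab.
- by exists ((a + b) / 2); rewrite !lte_fin in ab *; apply/andP; split; lra.
- by exists (a + 1); rewrite lte_fin ltry ltrDl ltr01.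
- by exists (b - 1); rewrite lte_fin ltNyr gtrBl ltr01.
- by exists 0; rewrite ltNyr ltry.
Qed.

Lemma ereal_open (a b : \bar R) (s : R) : (a < s%:E < b)%E ->
  exists2 r : R, 0 < r & forall s', `|s' - s| < r -> (a < s'%:E < b)%E.
Proof.
move=> /andP[as_ sb].
have [r1 r10 r1P] : exists2 r : R, 0 < r & forall s', `|s' - s| < r -> (a < s'%:E)%E.
  case: a as_ => [a||] //= as_; last by exists 1 => // s' _; rewrite ltNyr.
  rewrite lte_fin in as_; exists (s - a) => [|s']; first by rewrite subr_gt0.
  by rewrite lte_fin ltr_norml => /andP[]; lra.
have [r2 r20 r2P] : exists2 r : R, 0 < r & forall s', `|s' - s| < r -> (s'%:E < b)%E.
  case: b sb => [b||] //= sb; last by exists 1 => // s' _; rewrite ltry.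
  rewrite lte_fin in sb; exists (b - s) => [|s']; first by rewrite subr_gt0.
  by rewrite lte_fin ltr_norml => /andP[]; lra.
exists (Num.min r1 r2) => [|s']; first by rewrite lt_min r10.
by rewrite lt_min => /andP[/r1P -> /r2P ->].
Qed.

Lemma ereal_between (a b : \bar R) (s1 s2 s : R) : (a < s1%:E < b)%E -> (a < s2%:E < b)%E ->
  s1 <= s <= s2 -> (a < s%:E < b)%E.
Proof.
move=> /andP[h1 _] /andP[_ h2] /andP[h3 h4].
by apply/andP; split; [apply: lt_le_trans h1 _|apply: le_lt_trans h2]; rewrite lee_fin.
Qed.

(** A curve that contains one of its endpoints is extendible, so the parameters of an
    inextendible curve are interior. *)
Lemma inextendible_open (Om : set (R * R)) (a b : \bar R) I g dg :
  interval_with_endpoints a b I -> C1_curve I g dg ->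
  (forall s, I s -> Om (g s)) -> ~ extendible_in Om a b g ->
  forall s, I s -> (a < s%:E < b)%E.
Proof.
move=> [ab Iin Iout] [dg1 _] Omg next s Is; have /andP[as_ sb] := Iout _ Is.
have [m mab] := ereal_mid ab.
have lim := deriv_within_limit (dg1 _ Is).
apply/andP; split; rewrite lt_neqAle ?as_ ?sb andbT; apply/eqP => E; apply: next.
  exists (g s); [exact: Omg|left; apply/cvgrPdist_lt => e /lim[d d0 dP]].
  have sd : (a < (Num.min m (s + d))%:E < b)%E.
    case/andP: mab => h1 h2; rewrite E lte_fin lt_min ltrDl d0 -lte_fin -E h1 /=.
    by apply: le_lt_trans h2; rewrite lee_fin ge_min lexx.
  apply: filterS (from_right_mem sd) => s' [s's as'].
  rewrite distrC; apply: dP.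
    apply: Iin; rewrite as' /=; case/andP: mab => _; apply: lt_trans.
    by rewrite lte_fin; apply: (lt_le_trans s's); rewrite ge_min lexx.
  have : s < s' by rewrite -lte_fin -E.
  move: s's; rewrite lt_min => /andP[_ ?] ?; rewrite gtr0_norm ?subr_gt0//; lra.
exists (g s); [exact: Omg|right; apply/cvgrPdist_lt => e /lim[d d0 dP]].
have sd : (a < (Num.max m (s - d))%:E < b)%E.
  case/andP: mab => h1 h2; rewrite -E lte_fin gt_max gtrBl d0 -lte_fin E h2 /= andbT.
  by apply: lt_le_trans h1 _; rewrite lee_fin le_max lexx.
apply: filterS (from_left_mem sd) => s' [s's s'b].
rewrite distrC; apply: dP.
  apply: Iin; rewrite s'b andbT; case/andP: mab => h1 _; apply: (lt_trans h1).
  by rewrite lte_fin; apply: le_lt_trans s's; rewrite le_max lexx.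
have : s' < s by rewrite -lte_fin E.
move: s's; rewrite gt_max => /andP[_ ?] ?; rewrite distrC gtr0_norm ?subr_gt0//; lra.
Qed.

Lemma monotone_end (a b : \bar R) (f : R -> R) (M s1 : R) : (a < s1%:E < b)%E ->
  (forall s s', (a < s%:E < b)%E -> (a < s'%:E < b)%E -> s <= s' -> f s <= f s') ->
  (forall s, (a < s%:E < b)%E -> s1 <= s -> f s <= M) ->
  exists l, (forall s, (a < s%:E < b)%E -> f s <= l) /\
    forall e : R, 0 < e -> exists2 s0 : R, (a < s0%:E < b)%E &
      forall s, (a < s%:E < b)%E -> s0 <= s -> `|f s - l| < e.
Proof.
move=> s1ab mono fM; pose A := [set f s | s in [set s : R | (a < s%:E < b)%E]].
have A0 : A !=set0 by exists (f s1); exists s1.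
have ubA : has_ubound A.
  exists M => _ [s sab <-]; have [h|/ltW h] := leP s1 s; first exact: fM.
  exact: le_trans (mono _ _ sab s1ab h) (fM _ s1ab (lexx _)).
have ub s : (a < s%:E < b)%E -> f s <= sup A.
  by move=> sab; apply: ub_le_sup => //; exists s.
exists (sup A); split => // e e0.
have [_ [s0 s0ab <-] s0e] := sup_adherent e0 (conj A0 ubA).
exists s0 => // s sab s0s; have := mono _ _ s0ab sab s0s; have := ub _ sab.
by move: (sup A) s0e => S ? ? ?; rewrite ltr_norml; apply/andP; split; lra.
Qed.

Lemma monotone_start (a b : \bar R) (f : R -> R) (M s1 : R) : (a < s1%:E < b)%E ->
  (forall s s', (a < s%:E < b)%E -> (a < s'%:E < b)%E -> s <= s' -> f s <= f s') ->
  (forall s, (a < s%:E < b)%E -> s <= s1 -> M <= f s) ->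
  exists l, (forall s, (a < s%:E < b)%E -> l <= f s) /\
    forall e : R, 0 < e -> exists2 s0 : R, (a < s0%:E < b)%E &
      forall s, (a < s%:E < b)%E -> s <= s0 -> `|f s - l| < e.
Proof.
move=> s1ab mono fM; pose A := [set f s | s in [set s : R | (a < s%:E < b)%E]].
have A0 : A !=set0 by exists (f s1); exists s1.
have lbA : has_lbound A.
  exists M => _ [s sab <-]; have [h|/ltW h] := leP s s1; first exact: fM.
  exact: le_trans (fM _ s1ab (lexx _)) (mono _ _ s1ab sab h).
have lb s : (a < s%:E < b)%E -> inf A <= f s.
  by move=> sab; apply: ge_inf => //; exists s.
exists (inf A); split => // e e0.
have [_ [s0 s0ab <-] s0e] := inf_adherent e0 (conj A0 lbA).
exists s0 => // s sab s0s; have := mono _ _ sab s0ab s0s; have := lb _ sab.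
by move: (inf A) s0e => S ? ? ?; rewrite ltr_norml; apply/andP; split; lra.
Qed.

End Curves.

Section GloballyHyperbolic.
Variable R : realType.
Implicit Types (a b : \bar R) (g d : R -> R).

(** The acoustical quadratic form splits into the two linear forms that annihilate Lbar and L. *)
Lemma form_acoustical (psi : R) (v : R * R) : psi <> - 4 ->
  form_app (acoustical_form psi) v v =
  4 / (4 + psi) ^+ 2 * ((v.2 + 2 * v.1) * (v.2 - (2 + psi) * v.1)).
Proof.
move=> /eqP psi4; have n4 : 4 + psi != 0 by rewrite addrC addr_eq0.
by rewrite /form_app /acoustical_form /=; field.
Qed.

Lemma timelike_acoustical (psi : R) (v : R * R) : psi <> - 4 ->
  timelike (acoustical_form psi) v <-> (v.2 + 2 * v.1) * (v.2 - (2 + psi) * v.1) < 0.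
Proof.
move=> psi4; rewrite /timelike form_acoustical// pmulr_rlt0//.
move/eqP: psi4 => psi4; have n4 : 4 + psi != 0 by rewrite addrC addr_eq0.
by rewrite divr_gt0// exprn_even_gt0.
Qed.

Definition limit_end a b (g1 g2 : R -> R) (q : R * R) := forall e : R, 0 < e ->
  exists2 s0 : R, (a < s0%:E < b)%E & forall s, (a < s%:E < b)%E -> s0 <= s ->
    `|(g1 s, g2 s) - q| < e.

Definition limit_start a b (g1 g2 : R -> R) (q : R * R) := forall e : R, 0 < e ->
  exists2 s0 : R, (a < s0%:E < b)%E & forall s, (a < s%:E < b)%E -> s <= s0 ->
    `|(g1 s, g2 s) - q| < e.

Lemma pair_close (x y l1 l e : R) : `|x - l1| < e / 4 -> `|(y + 2 * x) - l| < e / 4 ->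
  `|(x, y) - (l1, l - 2 * l1)| < e.
Proof.
rewrite norm_pair_lt /= !ltr_norml => /andP[? ?] /andP[? ?].
by apply/andP; split; apply/andP; split; lra.
Qed.

(** Along a future directed timelike curve t, x + 2 t and 4 t - x increase. If the curve avoids
    Sigma, then either t < 0 throughout and t and x + 2 t converge at the end, or t > 0
    throughout and they converge at the start. The first limit lies in Omega, which contains
    the half plane t <= 0. So does the second one if x + 2 t < 4 somewhere. Otherwise the curve
    is to the right of B, its foot is positive and decreases, and the past limit, with a
    time no later and a foot no smaller, satisfies t < 1 + z^2 as well. *)
Lemma timelike_meets_Sigma a b (g1 g2 d1 d2 : R -> R) : (a < b)%E ->
  (forall s : R, (a < s%:E < b)%E -> is_derive s 1 g1 (d1 s)) ->
  (forall s : R, (a < s%:E < b)%E -> is_derive s 1 g2 (d2 s)) ->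
  (forall s, (a < s%:E < b)%E -> OmegaC (g1 s, g2 s)) ->
  (forall s, (a < s%:E < b)%E -> - 2 * d1 s < d2 s < (2 - atan (zC (g1 s, g2 s))) * d1 s) ->
  [\/ exists2 s, (a < s%:E < b)%E & g1 s = 0,
      exists2 q, OmegaC q & limit_end a b g1 g2 q |
      exists2 q, OmegaC q & limit_start a b g1 g2 q].
Proof.
move=> ab D1 D2 inO tl; have [m mab] := ereal_mid ab.
have [ex|nex] := pselect (exists2 s, (a < s%:E < b)%E & g1 s = 0); first by constructor 1.
have D0 s : (a < s%:E < b)%E -> 0 < d1 s.
  move=> /tl /andP[h1 h2]; have := lt_trans h1 h2; rewrite -subr_gt0.
  set z := zC _; have -> : (2 - atan z) * d1 s - -2 * d1 s = (4 - atan z) * d1 s by ring.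
  by rewrite pmulr_rgt0// fourB_gt0.
have mono (f df : R -> R) (s s' : R) : (forall s : R, (a < s%:E < b)%E -> is_derive s 1 f (df s)) ->
    (forall s, (a < s%:E < b)%E -> 0 < df s) ->
    (a < s%:E < b)%E -> (a < s'%:E < b)%E -> s <= s' -> f s <= f s'.
  move=> Df df0 sab s'ab ss'; apply: (ger0_derive_le ss' (df := df)).
    by move=> r rs; apply: Df; exact: ereal_between sab s'ab rs.
  by move=> r /andP[r1 r2]; apply: ltW; apply: df0; apply: (ereal_between sab s'ab); rewrite !ltW.
pose u s := g2 s + 2 * g1 s; pose w s := 4 * g1 s - g2 s.
have Du (s : R) : (a < s%:E < b)%E -> is_derive s 1 u (d2 s + 2 * d1 s).
  by move=> h; exact: is_deriveD (D2 s h) (is_deriveZ 2 (D1 s h)).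
have Dw (s : R) : (a < s%:E < b)%E -> is_derive s 1 w (4 * d1 s - d2 s).
  by move=> h; exact: is_deriveB (is_deriveZ 4 (D1 s h)) (D2 s h).
have mg1 s s' := @mono g1 d1 s s' D1 D0.
have mu s s' : (a < s%:E < b)%E -> (a < s'%:E < b)%E -> s <= s' -> u s <= u s'.
  by apply: (mono u _ s s' Du) => r /tl /andP[]; lra.
have mw s s' : (a < s%:E < b)%E -> (a < s'%:E < b)%E -> s <= s' -> w s <= w s'.
  apply: (mono w _ s s' Dw) => r h; have /andP[_ h2] := tl _ h; have h1 := D0 _ h.
  have : (2 - atan (zC (g1 r, g2 r))) * d1 r < 4 * d1 r.
    by rewrite ltr_pM2r//; have := atan_gtN2 (zC (g1 r, g2 r)); lra.
  lra.
have sign s s' : (a < s%:E < b)%E -> (a < s'%:E < b)%E -> g1 s < 0 -> 0 < g1 s' -> False.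
  move=> h h' n p; have ss' : s <= s'.
    by rewrite leNgt; apply/negP => /ltW/(mg1 _ _ h' h); lra.
  have [||c csab c0] := @IVT0 _ g1 s s' ss'.
  - by move=> r rs; exact: is_derive_continuous (D1 _ (ereal_between h h' rs)).
  - by left; rewrite !ltW.
  - by apply: nex; exists c => //; exact: ereal_between h h' csab.
have n0 s : (a < s%:E < b)%E -> g1 s != 0.
  by move=> h; apply/eqP => E; apply: nex; exists s.
have [neg|pos] : g1 m < 0 \/ 0 < g1 m.
  by case: (ltgtP (g1 m) 0) (n0 _ mab) => // _ _; [left|right].
- constructor 2; have allneg s : (a < s%:E < b)%E -> g1 s <= 0.
    by move=> h; rewrite leNgt; apply/negP => p; exact: sign mab h neg p.
  have [|l1 [l1ub l1lim]] := @monotone_end _ a b g1 0 m mab mg1.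
    by move=> s h _; exact: allneg.
  have [|l [lub llim]] := @monotone_end _ a b u (- w m) m mab mu.
    move=> s h ms; have := mw _ _ mab h ms; have := allneg _ h.
    by rewrite /u /w; lra.
  have l10 : l1 <= 0.
    apply/ler_addgt0Pl => e /l1lim[s0 s0ab H]; have := H _ s0ab (lexx _).
    by have := allneg _ s0ab; rewrite ltr_norml => ? /andP[]; lra.
  exists (l1, l - 2 * l1); first exact: OmegaC_le0.
  move=> e e0; have e40 : 0 < e / 4 by rewrite divr_gt0.
  have [sa saab saP] := l1lim _ e40; have [sb sbab sbP] := llim _ e40.
  exists (Num.max sa sb); first by rewrite /Num.max; case: ifP.
  by move=> s h; rewrite ge_max => /andP[h1 h2]; apply: pair_close; [exact: saP|exact: sbP].
- constructor 3; have allpos s : (a < s%:E < b)%E -> 0 <= g1 s.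
    by move=> h; rewrite leNgt; apply/negP => n; exact: sign h mab n pos.
  have [|l1 [l1lb l1lim]] := @monotone_start _ a b g1 0 m mab mg1.
    by move=> s h _; exact: allpos.
  have [|l [llb llim]] := @monotone_start _ a b u (- w m) m mab mu.
    move=> s h ms; have := mw _ _ h mab ms; have := allpos _ h.
    by rewrite /u /w; lra.
  set q := (l1, l - 2 * l1).
  have lim : limit_start a b g1 g2 q.
    move=> e e0; have e40 : 0 < e / 4 by rewrite divr_gt0.
    have [sa saab saP] := l1lim _ e40; have [sb sbab sbP] := llim _ e40.
    exists (Num.min sa sb); first by rewrite /Num.min; case: ifP.
    by move=> s h; rewrite le_min => /andP[h1 h2]; apply: pair_close; [exact: saP|exact: sbP].
  exists q => //.
  have [left|right] := pselect (exists2 s, (a < s%:E < b)%E & u s < 4).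
    case: left => s h us; left; rewrite /q /=.
    by have := llb _ h; lra.
  have {}right s : (a < s%:E < b)%E -> 4 <= u s.
    by move=> h; rewrite leNgt; apply/negP => us; apply: right; exists s.
  pose z s := zC (g1 s, g2 s).
  have xb s : (a < s%:E < b)%E -> xB (g1 s) < g2 s.
    by move=> h; case: (inO _ h) => //= us; have := right _ h; rewrite /u; lra.
  have zpos s : (a < s%:E < b)%E -> 0 < z s.
    move=> h; have h' := sub_OmegaC (inO _ h); have /= wz := zC_right h' (ltW (xb _ h)).
    rewrite lt_neqAle (le_trans (wB_ge0 _) wz) andbT; apply/eqP => z0.
    have := zC_lt (inO _ h); have := zC_kap h'; rewrite -/(z s) -z0 /= kap0 => E t1.
    move: t1; rewrite expr0n addr0 => t1.
    by have := right _ h; rewrite /u; lra.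
  have Dz (s : R) : (a < s%:E < b)%E -> is_derive s 1 z
      (((1 + z s ^+ 2) * rf (@zC R) (g1 s, g2 s)) * (d2 s - (2 - atan (z s)) * d1 s)).
    move=> h; have Oh := inO _ h.
    have zx p (Op : OmegaC p) := is_derive_zx (@open_OmegaC R) (@zC_kapO R) (@zC_lt R) (@zC_continuous R) Op.
    have zt p (Op : OmegaC p) := is_derive_zt (@open_OmegaC R) (@zC_kapO R) (@zC_lt R) (@zC_continuous R) Op.
    have e2 f : elem2 (@zC R) f -> {for (g1 s, g2 s), continuous f}.
      by move=> Ef; exact: (elem2_continuous (@zC_lt R) (@zC_continuous R) Ef Oh).
    have cx : {for (g1 s, g2 s), continuous (fun p => (1 + zC p ^+ 2) * rf (@zC R) p)}.
      have := e2 _ (elem2_dz (@zC R) true).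
      by rewrite (_ : (fun p => _) = (fun p => (1 + zC p ^+ 2) * rf (@zC R) p))//;
        apply/funext => p; rewrite mul1r.
    have ct : {for (g1 s, g2 s), continuous (fun p => - (2 - atan (zC p)) * ((1 + zC p ^+ 2) * rf (@zC R) p))}.
      exact: e2 _ (elem2_dz (@zC R) false).
    have G := C1_has_gradient (@open_OmegaC R) Oh zt zx ct cx.
    apply: (is_derive_eq (has_gradient_chain G (D1 _ h) (D2 _ h) erefl)).
    by rewrite -/(z s); ring.
  have zdec s s' : (a < s%:E < b)%E -> (a < s'%:E < b)%E -> s <= s' -> z s' <= z s.
    move=> h h' ss'; rewrite -lerN2.
    apply: (mono (- z) _ s s' (fun r hr => is_deriveN (Dz r hr))) => // r hr.
    rewrite oppr_gt0 pmulr_rlt0; last first.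
      by rewrite mulr_gt0 ?oneDsqr_gt0'//; exact: rf_gt0 (@zC_lt R) _ (inO _ hr).
    by have /andP[] := tl _ hr; rewrite -/(z r); lra.
  have cq : clOmegaC q.
    apply: closed_clOmegaC => B /nbhs_ballP[r /= r0 rB]; have [s0 s0ab sP] := lim _ r0.
    exists (g1 s0, g2 s0); split; first exact: sub_OmegaC (inO _ s0ab).
    by apply: rB; rewrite -ball_normE /= distrC; exact: sP.
  have zq : z m <= zC q.
    apply/ler_addgt0Pl => e e0; have [d d0 dP] := zC_continuous_cl cq e0.
    have [s0 s0ab sP] := lim _ d0; pose s := Num.min s0 m.
    have sab : (a < s%:E < b)%E by rewrite /s /Num.min; case: ifP.
    have sm : s <= m by rewrite ge_min lexx orbT.
    have ss0 : s <= s0 by rewrite ge_min lexx.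
    have := dP _ (sub_OmegaC (inO _ sab)) (sP _ sab ss0); rewrite -/(z s).
    have := zdec _ _ sab mab sm; rewrite ltr_norml => ? /andP[]; lra.
  have zm := zpos _ mab.
  apply: (@right_OmegaC R q (zC q)); [lra| |exact: zC_kap].
  apply: (@le_lt_trans _ _ (g1 m)); first exact: l1lb.
  apply: (lt_le_trans (zC_lt (inO _ mab))); rewrite lerD2l -/(z m).
  by rewrite ler_sqr ?nnegrE; lra.
Qed.

Lemma limit_end_cvg a b (g : R -> R * R) q : (a < b)%E ->
  limit_end a b (fun s => (g s).1) (fun s => (g s).2) q -> g @ from_left b --> q.
Proof.
move=> ab H.
apply/cvgrPdist_lt => e /H[s0 s0ab sP].
apply: filterS (from_left_mem s0ab) => s [ss sb].
rewrite distrC; have := sP s; rewrite -surjective_pairing; apply; last exact: ltW.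
by rewrite sb andbT; case/andP: s0ab => h _; apply: (lt_trans h); rewrite lte_fin.
Qed.

Lemma limit_start_cvg a b (g : R -> R * R) q : (a < b)%E ->
  limit_start a b (fun s => (g s).1) (fun s => (g s).2) q -> g @ from_right a --> q.
Proof.
move=> ab H.
apply/cvgrPdist_lt => e /H[s0 s0ab sP].
apply: filterS (from_right_mem s0ab) => s [ss sa].
rewrite distrC; have := sP s; rewrite -surjective_pairing; apply; last exact: ltW.
by rewrite sa /=; case/andP: s0ab => _; apply: lt_trans; rewrite lte_fin.
Qed.

(** An inextendible timelike curve is a graph over t, up to orientation; so it meets Sigma at most
    once, and by timelike_meets_Sigma at least once. *)
Theorem OmegaC_globally_hyperbolic :
  globally_hyperbolic (@OmegaC R) (acoustical_metric (@PhiC R)).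
Proof.
split; [exact: open_OmegaC|exact: Sigma_OmegaC|exact: metric_smooth_lorentzian|].
move=> a b I g dg iv cg inO tl next.
have Iopen := inextendible_open iv cg inO next.
case: iv => ab Iin _; case: cg => dg1 cdg.
have {}inO s : (a < s%:E < b)%E -> OmegaC (g s) by move=> /Iin/inO.
have comp s : (a < s%:E < b)%E -> is_derive s 1 (fun s => (g s).1) (dg s).1 /\
    is_derive s 1 (fun s => (g s).2) (dg s).2.
  move=> h; have [r r0 rP] := ereal_open h.
  by apply: (deriv_within_components r0 _ (dg1 _ (Iin _ h))) => s' /rP/Iin.
have c1 s : (a < s%:E < b)%E -> {for s, continuous (fun s => (dg s).1)}.
  move=> h; have [r r0 rP] := ereal_open h.
  have : {for s, continuous dg}.
    have Is : nbhs s I.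
      by apply/nbhs_ballP; exists r => //= s'; rewrite -ball_normE /= distrC => /rP/Iin.
    by have := cdg s; rewrite /continuous_at -(nbhs_subspace_interior Is).
  by move=> K; apply: (@continuous_comp _ _ _ dg fst); [exact: K|exact: cvg_fst].
have tl' s : (a < s%:E < b)%E -> ((dg s).2 + 2 * (dg s).1) *
    ((dg s).2 - (2 - atan (zC (g s))) * (dg s).1) < 0.
  move=> h; have := tl _ (Iin _ h); rewrite metric_PhiC; last exact: inO.
  by move/timelike_acoustical => /(_ (@natanN4 R _)).
have d0 s : (a < s%:E < b)%E -> (dg s).1 != 0.
  move=> h; apply/eqP => E; have := tl' _ h; rewrite E !mulr0 addr0 subr0.
  by rewrite -expr2 ltNge sqr_ge0.
have [m mab] := ereal_mid ab.
have same s s' : (a < s%:E < b)%E -> (a < s'%:E < b)%E -> 0 < (dg s).1 -> 0 < (dg s').1.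
  move=> h h' p; rewrite ltNge; apply/negP => n.
  have [ss|/ltW ss] := leP s s'.
    have [||c cs c0] := @IVT0 _ (fun s => (dg s).1) s s' ss.
    - by move=> r rs; apply: c1; exact: ereal_between h h' rs.
    - by right; rewrite n ltW.
    - by have := d0 _ (ereal_between h h' cs); rewrite c0 eqxx.
  have [||c cs c0] := @IVT0 _ (fun s => (dg s).1) s' s ss.
  - by move=> r rs; apply: c1; exact: ereal_between h' h rs.
  - by left; rewrite n ltW.
  - by have := d0 _ (ereal_between h' h cs); rewrite c0 eqxx.
suff [s sab s0] : exists2 s, (a < s%:E < b)%E & (g s).1 = 0.
  exists s; split; first by split; [exact: Iin|].
  move=> s' [/Iopen s'ab s'0]; apply: contrapT => ne.
  have key (r r' : R) : (a < r%:E < b)%E -> (a < r'%:E < b)%E ->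
      (g r).1 = 0 -> (g r').1 = 0 -> r < r' -> False.
    move=> h h' e e' rr; have [c cr E] := mean_value rr
      (fun t ht => (comp _ (ereal_between h h' ht)).1).
    have cab : (a < c%:E < b)%E by apply: (ereal_between h h'); case/andP: cr => *; rewrite !ltW.
    move: E; rewrite e e' subrr => /esym/eqP; rewrite mulf_eq0 subr_eq0.
    by rewrite (negbTE (d0 _ cab)) (gt_eqF rr).
  by case: (ltgtP s s') => [/(key _ _ sab s'ab s0 s'0)|/(key _ _ s'ab sab s'0 s0)|].
have slope s : (a < s%:E < b)%E -> 0 < (dg s).1 ->
    - 2 * (dg s).1 < (dg s).2 < (2 - atan (zC (g s))) * (dg s).1.
  move=> h p; have := tl' _ h; have := fourB_gt0 (zC (g s)).
  move: (atan _) (dg s).1 (dg s).2 p => A x y x0 A0 H.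
  have Ax : 0 < (4 - A) * x by rewrite mulr_gt0.
  have [yl|yl] := ltP (-2 * x) y.
    rewrite /=; have : y - (2 - A) * x < 0 by rewrite -(pmulr_rlt0 _ (_ : 0 < y + 2 * x))//; lra.
    lra.
  have : 0 <= (y + 2 * x) * (y - (2 - A) * x) by apply: mulr_le0; lra.
  lra.
have slopeN s : (a < s%:E < b)%E -> (dg s).1 < 0 ->
    - 2 * - (dg s).1 < - (dg s).2 < (2 - atan (zC (g s))) * - (dg s).1.
  move=> h p; have := tl' _ h; have := fourB_gt0 (zC (g s)).
  move: (atan _) (dg s).1 (dg s).2 p => A x y x0 A0 H.
  have Ax : 0 < (4 - A) * - x by rewrite mulr_gt0// oppr_gt0.
  have [yl|yl] := ltP (-2 * - x) (- y).
    rewrite /=; have : 0 < y - (2 - A) * x by rewrite -(nmulr_rlt0 _ (_ : y + 2 * x < 0))//; lra.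
    lra.
  have : 0 <= (y + 2 * x) * (y - (2 - A) * x) by apply: mulr_ge0; lra.
  lra.
have [pos|neg] : 0 < (dg m).1 \/ (dg m).1 < 0.
  by case: (ltgtP (dg m).1 0) (d0 _ mab) => // _ _; [right|left].
- have D0 s : (a < s%:E < b)%E -> 0 < (dg s).1 by move=> h; exact: same mab h pos.
  case: (@timelike_meets_Sigma a b (fun s => (g s).1) (fun s => (g s).2)
    (fun s => (dg s).1) (fun s => (dg s).2) ab).
  + by move=> s /comp[].
  + by move=> s /comp[].
  + by move=> s /inO; rewrite -surjective_pairing.
  + by move=> s h; rewrite -surjective_pairing; apply: slope => //; exact: D0.
  + by [].
  + by move=> [q Oq /(limit_end_cvg ab) H]; exfalso; apply: next; exists q => //; right.
  + by move=> [q Oq /(limit_start_cvg ab) H]; exfalso; apply: next; exists q => //; left.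
- have D0 s : (a < s%:E < b)%E -> (dg s).1 < 0.
    move=> h; have := d0 _ h; rewrite neq_lt => /orP[//|p].
    by have := same _ _ h mab p; lra.
  have ioN s : (- b < s%:E < - a)%E -> (a < (- s)%:E < b)%E.
    by rewrite EFinN => /andP[h1 h2]; rewrite lteNr h2 lteNl h1.
  have oiN s : (a < s%:E < b)%E -> (- b < (- s)%:E < - a)%E.
    by rewrite EFinN => /andP[h1 h2]; rewrite !lteN2 h1 h2.
  have Dr (f df : R -> R) (s : R) : is_derive (- s) 1 f (df (- s)) ->
      is_derive s 1 (fun s => f (- s)) (- df (- s)).
    move=> H; have := @is_derive1_comp R f -%R s _ _ H (is_deriveNid s (1:R)).
    by rewrite mulrN1.
  have abN : (- b < - a)%E by rewrite lteN2.
  (* A past directed curve is traversed backwards. *)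
  case: (@timelike_meets_Sigma (- b)%E (- a)%E (fun s => (g (- s)).1) (fun s => (g (- s)).2)
    (fun s => - (dg (- s)).1) (fun s => - (dg (- s)).2) abN).
  + by move=> s /ioN/comp[H _]; exact: (Dr (fun s => (g s).1) (fun s => (dg s).1)).
  + by move=> s /ioN/comp[_ H]; exact: (Dr (fun s => (g s).2) (fun s => (dg s).2)).
  + by move=> s /ioN/inO; rewrite -surjective_pairing.
  + by move=> s /ioN h; rewrite -surjective_pairing; apply: slopeN => //; exact: D0.
  + by move=> [s /ioN h E]; exists (- s).
  + move=> [q Oq H]; exfalso; apply: next; exists q => //; left; apply: (limit_start_cvg ab).
    move=> e /H[s0 /ioN s0ab sP]; exists (- s0) => // s /oiN h ss0.
    by have := sP _ h; rewrite opprK; apply; rewrite lerNr.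
  + move=> [q Oq H]; exfalso; apply: next; exists q => //; right; apply: (limit_end_cvg ab).
    move=> e /H[s0 /ioN s0ab sP]; exists (- s0) => // s /oiN h ss0.
    by have := sP _ h; rewrite opprK; apply; rewrite lerNl.
Qed.

Theorem PhiC_GHD : GHD (@OmegaC R) (@PhiC R).
Proof.
split; [exact: PhiC_classical|exact: PhiC_smooth| |exact: OmegaC_globally_hyperbolic].
by move=> p Op; rewrite Psi_PhiC//; exact: natanN4.
Qed.

End GloballyHyperbolic.

(** * Every development is contained in Omega *)

Section GraphCurves.
Variable R : realType.

(** Cut the graph where it leaves U for the first time, or at + oo. At neither end has it a limit
    in U, so the piece over t > a >= 0 is an inextendible timelike curve that misses Sigma. *)
Lemma no_past_endpoint (U : set (R * R)) (psi : R * R -> R) : open U -> Sigma `<=` U ->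
  (forall p, U p -> psi p <> - 4) ->
  (forall a b I gamma dgamma,
     interval_with_endpoints a b I -> C1_curve I gamma dgamma ->
     (forall s, I s -> U (gamma s)) ->
     (forall s, I s -> timelike (acoustical_form (psi (gamma s))) (dgamma s)) ->
     ~ extendible_in U a b gamma ->
     exists! s, I s /\ Sigma (gamma s)) ->
  forall (x dx : R -> R) (a t1 : R), 0 <= a -> a < t1 ->
  (forall t : R, a <= t -> is_derive t 1 x (dx t)) ->
  (forall t, a <= t -> {for t, continuous dx}) ->
  ~ U (a, x a) -> (forall s, a < s <= t1 -> U (s, x s)) ->
  (forall s, a < s -> U (s, x s) -> (dx s + 2) * (dx s - (2 + psi (s, x s))) < 0) ->
  False.
Proof.
move=> oU SU psi4 gh x dx a t1 a0 at1 x' cdx nUa Uat tl.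
have cx t : a <= t -> {for t, continuous x} by move=> /x' H; exact: is_derive_continuous H.
have cg t : a <= t -> {for t, continuous (fun s => (s, x s))}.
  by move=> /cx H; apply: continuous_pair; [exact: cvg_id|].
have [b [ab Ub limb]] : exists b : \bar R, [/\ (a%:E < b)%E,
    forall s, (a%:E < s%:E < b)%E -> U (s, x s) &
    forall q, (fun s => (s, x s)) @ from_left b --> q -> ~ U q].
  have [[s1 ts1 nU1]|nex] := pselect (exists2 s1, t1 <= s1 & ~ U (s1, x s1)).
    have Ut1 : U (t1, x t1) by apply: Uat; rewrite at1 lexx.
    have [|b [b1 b2 b3 b4]] := @first_exit _ (fun s => U (s, x s)) t1 s1 _ ts1 Ut1 nU1.
      move=> s /andP[s1' _]; apply: continuous_curve_open => //; apply: cx.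
      exact: le_trans (ltW at1) s1'.
    have ab : a < b by exact: lt_trans b2.
    exists b%:E; split; first by rewrite lte_fin.
      move=> s; rewrite !lte_fin => /andP[h1 h2].
      by have [h3|h3] := leP s t1; [apply: Uat; rewrite h1|apply: b4; rewrite ltW].
    move=> q lq Uq; apply: b3.
    have lb : (fun s => (s, x s)) @ b^'- --> (b, x b).
      by apply: cvg_at_left_filter; exact: cg (ltW ab).
    by rewrite -(cvg_unique (@norm_hausdorff _ _) lq lb).
  exists +oo%E; split; first by rewrite ltry.
    move=> s; rewrite lte_fin => /andP[h1 _].
    have [h3|h3] := leP s t1; first by apply: Uat; rewrite h1.
    by apply: contrapT => nU; apply: nex; exists s => //; exact: ltW.
  move=> q lq _; move/cvgrPdist_lt/(_ _ ltr01): lq => /= H.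
  have H2 : \forall s \near +oo, q.1 + 1 < s by exists (q.1 + 1); split; [exact: num_real|].
  have [s [s1 s2]] := filter_ex (filterI H H2).
  move: s1; rewrite norm_pair_lt /= => /andP[]; rewrite ltr_norml => /andP[]; lra.
pose I := [set s : R | (a%:E < s%:E < b)%E].
have Ia s : I s -> a < s by rewrite /I /= lte_fin => /andP[].
have [|||||s [[Is s0] _]] := gh a%:E b I (fun s => (s, x s)) (fun s => (1, dx s)).
- split => // s /andP[h1 h2]; by rewrite !ltW.
- split=> [s Is|].
    exact: (@deriv_within_pair R I id x s 1 (dx s) (is_derive_id s (1:R)) (x' s (ltW (Ia _ Is)))).
  apply: continuous_in_subspaceT => s; rewrite inE => Is.
  by apply: continuous_pair; [exact: cvg_cst|exact: cdx (ltW (Ia _ Is))].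
- by move=> s; exact: Ub.
- move=> s Is; have Us := Ub _ Is; apply/timelike_acoustical; first exact: psi4.
  by rewrite /= !mulr1; apply: tl => //; exact: Ia.
- move=> [q Uq [lq|lq]]; last exact: limb lq Uq.
  have la : (fun s => (s, x s)) @ a^'+ --> (a, x a).
    by apply: cvg_at_right_filter; exact: cg (lexx a).
  by apply: nUa; rewrite -(cvg_unique (@norm_hausdorff _ _) lq la).
by have := Ia _ Is; move: s0; rewrite /Sigma /= => ->; rewrite ltNge a0.
Qed.

(** The reflection (t, x) -> (- t, - x) preserves the Burgers equation and turns the past of Sigma
    into its future. *)
Lemma reflect_curves (U : set (R * R)) (psi : R * R -> R) :
  (forall a b I gamma dgamma,
     interval_with_endpoints a b I -> C1_curve I gamma dgamma ->
     (forall s, I s -> U (gamma s)) ->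
     (forall s, I s -> timelike (acoustical_form (psi (gamma s))) (dgamma s)) ->
     ~ extendible_in U a b gamma ->
     exists! s, I s /\ Sigma (gamma s)) ->
  forall a b I gamma dgamma,
     interval_with_endpoints a b I -> C1_curve I gamma dgamma ->
     (forall s, I s -> U (- gamma s)) ->
     (forall s, I s -> timelike (acoustical_form (psi (- gamma s))) (dgamma s)) ->
     ~ extendible_in [set p | U (- p)] a b gamma ->
     exists! s, I s /\ Sigma (gamma s).
Proof.
move=> gh a b I g dg iv [dg1 cdg] inU tl next.
have [||||s [[Is s0] un]] := gh a b I (fun s => - g s) (fun s => - dg s) iv.
- split=> [s Is|].
    apply: deriv_within_of_eps => e e0.
    have [d d0 dP] := deriv_within_eps (dg1 _ Is) e0; exists d => // h h1 h2.
    by rewrite scalerN -!opprD normrN; exact: dP.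
  by move=> s; apply: (@continuous_comp _ _ _ (dg : subspace I -> _) -%R);
    [exact: cdg|exact: opp_continuous].
- by [].
- move=> s Is; have := tl _ Is; rewrite /timelike /form_app /=.
  by rewrite !mulrNN.
- move=> [q Uq lq]; apply: next; exists (- q); first by rewrite /= opprK.
  have E : g = (fun s => - - g s) by apply/funext => s; rewrite opprK.
  by case: lq => lq; [left|right]; rewrite E; exact: cvgN lq.
exists s; split.
  by split => //; move: s0; rewrite /Sigma /= => /eqP; rewrite oppr_eq0 => /eqP.
by move=> s' [Is' s'0]; apply: un; split => //; rewrite /Sigma /= s'0 oppr0.
Qed.

End GraphCurves.

Section HalfSpace.
Variable R : realType.

Lemma future_half (U : set (R * R)) (psi pt px : R * R -> R) : open U -> Sigma `<=` U ->
  (forall p, U p -> is_derive p (axis R false) psi (pt p)) ->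
  (forall p, U p -> is_derive p (axis R true) psi (px p)) ->
  (forall p, U p -> {for p, continuous pt}) ->
  (forall p, U p -> {for p, continuous px}) ->
  (forall p, U p -> pt p + (2 + psi p) * px p = 0) ->
  (forall p, U p -> psi p <> - 4) ->
  (forall x, - 4 < psi (0, x)) ->
  (forall a b I gamma dgamma,
     interval_with_endpoints a b I -> C1_curve I gamma dgamma ->
     (forall s, I s -> U (gamma s)) ->
     (forall s, I s -> timelike (acoustical_form (psi (gamma s))) (dgamma s)) ->
     ~ extendible_in U a b gamma ->
     exists! s, I s /\ Sigma (gamma s)) ->
  forall p, U p -> 0 <= p.1 ->
  [/\ psi p = psi (0, foot psi p), 0 < 1 + p.1 * px (0, foot psi p) &
      forall s, 0 <= s <= p.1 -> U (s, p.2 + 2 * (p.1 - s))].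
Proof.
move=> oU SU dt dx ct cx bu p4 ini gh p Up p0.
have gh' := no_past_endpoint oU SU p4 gh.
have SU' x : U (0, x) by exact: SU.
have [h1 h2] := characteristic_solution oU SU' dt dx ct cx bu p4 ini gh' Up p0.
split => // s sp; exact: (vertical_segment oU dt dx ct cx p4 ini gh' Up sp).
Qed.

End HalfSpace.

Section AnyDevelopment.
Variable R : realType.
Variables (U : set (R * R)) (Phi : R * R -> R).
Hypothesis ghd : GHD U Phi.

Let oU : open U. Proof. by case: ghd => -[]. Qed.
Let SU : Sigma `<=` U. Proof. by case: ghd => -[]. Qed.
Let smo : smooth_on U Phi. Proof. by case: ghd. Qed.
Let psi := Psi Phi.
Let psi4 p : U p -> psi p <> - 4. Proof. by case: ghd => _ _ H _; exact: H. Qed.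
Let pd (s : seq bool) := pderiv s Phi.

Let dpd s i p : U p -> is_derive p (axis R i) (pd s) (pd (i :: s) p).
Proof.
by move=> Up; apply: derivableP; have [H _] := smo (size s).+1; exact: H.
Qed.

Let cpd s p : U p -> {for p, continuous (pd s)}.
Proof. by move=> Up; have [_ H] := smo (size s); exact: H. Qed.

Let dpsi i p : U p -> is_derive p (axis R i) psi (pd [:: i; false] p - 2 * pd [:: i; true] p).
Proof. by move=> Up; exact: is_deriveB (dpd [:: false] i Up) (is_deriveZ 2 (dpd [:: true] i Up)). Qed.

Let pt p := pd [:: false; false] p - 2 * pd [:: false; true] p.
Let px p := pd [:: true; false] p - 2 * pd [:: true; true] p.

Let cpp i p : U p -> {for p, continuous (fun p => pd [:: i; false] p - 2 * pd [:: i; true] p)}.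
Proof.
move=> Up; apply: cvgB; first exact: cpd.
by apply: cvgM; [exact: cvg_cst|exact: cpd].
Qed.

(** The wave equation reads - L Lbar Phi = 0, where Lbar Phi = Psi, by symmetry of the second
    derivatives. *)
Let burgers p : U p -> pt p + (2 + psi p) * px p = 0.
Proof.
move=> Up; have [[_ _ _ /(_ _ Up) W _] _ _ _] := ghd.
have C : pd [:: true; false] p = pd [:: false; true] p.
  apply: (clairaut oU Up (f := Phi) (ft := pd [:: false]) (fx := pd [:: true])).
  - by move=> q; exact: (@dpd [::] false).
  - by move=> q; exact: (@dpd [::] true).
  - by move=> q; exact: (@dpd [:: false] true).
  - by move=> q; exact: (@dpd [:: true] false).
  - exact: cpd.
  - exact: cpd.
have {}W : - pd [:: false; false] p - psi p * pd [:: false; true] p +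
  2 * (2 + psi p) * pd [:: true; true] p = 0 by exact: W.
rewrite /pt /px C; move: (pd [:: false; false] p) (pd [:: false; true] p)
  (pd [:: true; true] p) (psi p) W => a b c d W.
have -> : a - 2 * b + (2 + d) * (b - 2 * c) = - (- a - d * b + 2 * (2 + d) * c) by ring.
by rewrite W oppr0.
Qed.

Let init0 x : psi (0, x) = - atan x.
Proof.
have [[_ _ _ _ ini] _ _ _] := ghd; have [_ e2] := ini x.
have U0 : U (0, x) by exact: SU.
have D := @dpd [::] true (0, x) U0.
have E : pd [:: true] (0, x) = 0.
  rewrite -(@derive_val _ _ _ _ _ _ _ D) derive_axisE /slice /coord /=.
  rewrite (_ : (fun s => Phi (0, s)) = cst 0); first exact: derive_cst.
  by apply/funext => y; have [] := ini y.
rewrite /psi /Psi e2 -[X in _ - 2 * X]/(pd [:: true] (0, x)) E.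
by rewrite mulr0 subr0.
Qed.

Let px0 x : px (0, x) = - (1 + x ^+ 2)^-1.
Proof.
have U0 : U (0, x) by exact: SU.
have /is_derive_axisP D := @dpsi true (0, x) U0.
rewrite /px -(@derive_val _ _ _ _ _ _ _ D) /coord /=.
have -> : slice true psi (0, x) = - @atan R.
  by apply/funext => y; rewrite /slice /= init0.
exact: (@derive_val _ _ _ _ _ _ _ (is_deriveN (is_derive1_atan x))).
Qed.

Let init4 x : - 4 < psi (0, x).
Proof. by rewrite init0; have := atan_lt2 x; lra. Qed.

Let gh : forall a b I gamma dgamma,
  interval_with_endpoints a b I -> C1_curve I gamma dgamma ->
  (forall s, I s -> U (gamma s)) ->
  (forall s, I s -> timelike (acoustical_form (psi (gamma s))) (dgamma s)) ->
  ~ extendible_in U a b gamma ->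
  exists! s, I s /\ Sigma (gamma s).
Proof. by case: ghd => _ _ _ []. Qed.

Let fut p : U p -> 0 <= p.1 ->
  [/\ psi p = psi (0, foot psi p), 0 < 1 + p.1 * px (0, foot psi p) &
      forall s, 0 <= s <= p.1 -> U (s, p.2 + 2 * (p.1 - s))].
Proof.
exact: (@future_half R U psi pt px oU SU (@dpsi false) (@dpsi true) (@cpp false) (@cpp true)
  burgers psi4 init4 gh).
Qed.

Let V : set (R * R) := [set p : R * R | U (- p)].

Let derive_reflect (f : R * R -> R) i (p : R * R) (d : R) : is_derive (- p) (axis R i) f d ->
  is_derive p (axis R i) (fun q : R * R => f (- q)) (- d).
Proof.
move=> /is_derive_axisP H; apply/is_derive_axisP.
have E : coord i (- p) = - coord i p by case: i {H}.
rewrite E in H; have := @is_derive1_comp R (slice i f (- p)) -%R (coord i p) _ _ H (is_deriveNid _ (1:R)).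
by rewrite mulrN1; case: i {H E}.
Qed.

Let continuous_reflect (f : R * R -> R) (p : R * R) : {for - p, continuous f} ->
  {for p, continuous (fun q : R * R => f (- q))}.
Proof.
move=> /continuous_epsP H; apply/continuous_epsP => e /H[d d0 dP]; exists d => // q qd.
by apply: dP; rewrite -opprD normrN.
Qed.

Let past p : U p -> p.1 <= 0 ->
  psi p = psi (0, foot psi p) /\ forall s, p.1 <= s <= 0 -> U (s, p.2 + 2 * (p.1 - s)).
Proof.
move=> Up p0.
have [||||||||||||h1 _ h3] := @future_half R V (fun p : R * R => psi (- p)) (fun p : R * R => - pt (- p))
  (fun p : R * R => - px (- p)) _ _ _ _ _ _ _ _ _ _ (- p).
- apply/open_epsP => q Vq; have /open_epsP/(_ _ Vq)[r r0 rP] := oU; exists r => // q' h.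
  by apply: rP; rewrite -opprD normrN.
- by move=> q; rewrite /Sigma /V /= => q0; apply: SU; rewrite /Sigma /= q0 oppr0.
- by move=> q Vq; apply: derive_reflect; exact: (@dpsi false).
- by move=> q Vq; apply: derive_reflect; exact: (@dpsi true).
- by move=> q Vq; apply: cvgN; apply: continuous_reflect; exact: (@cpp false).
- by move=> q Vq; apply: cvgN; apply: continuous_reflect; exact: (@cpp true).
- by move=> q Vq; rewrite mulrN -opprD burgers// oppr0.
- by move=> q Vq; exact: psi4.
- move=> x; rewrite (_ : - (0, x) = (0, - x)); first exact: init4.
  by rewrite -[LHS]/(- 0, - x) oppr0.
- exact: reflect_curves gh.
- by rewrite /V /= opprK.
- by rewrite /= oppr_ge0.
have oppE (a b : R) : - ((a, b) : R * R) = (- a, - b) by [].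
have fE : - ((0, foot (fun q : R * R => psi (- q)) (- p)) : R * R) = (0, foot psi p).
  by rewrite oppE oppr0 /foot opprK /=; congr (_, _); ring.
split; first by move: h1; rewrite fE opprK.
move=> s /andP[s1 s2]; have := h3 (- s); rewrite /V /= => H.
have := H _; rewrite oppE opprK (_ : - (- p.2 + _) = p.2 + 2 * (p.1 - s)); last by ring.
by apply; rewrite oppr_ge0 s2 lerN2.
Qed.

Let footE p : U p -> [/\ psi p = - atan (foot psi p), kap p.1 (foot psi p) = p.2 - 2 * p.1 &
  p.1 < 1 + foot psi p ^+ 2].
Proof.
move=> Up; have l := oneDsqr_gt0' (foot psi p).
have [psiE lt] : psi p = - atan (foot psi p) /\ p.1 < 1 + foot psi p ^+ 2.
  have [p0|/ltW p0] := leP 0 p.1.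
    have [-> h _] := fut Up p0; rewrite init0; split => //.
    move: h; rewrite px0 mulrN subr_gt0 ltr_pdivrMr// mul1r; exact.
  have [-> _] := past Up p0; rewrite init0; split => //.
  exact: le_lt_trans p0 l.
by split => //; rewrite /kap {1}/foot psiE; ring.
Qed.

Let cpsi p : U p -> {for p, continuous psi}.
Proof.
move=> Up; apply: cvgB; first exact: (@cpd [:: false]).
by apply: cvgM; [exact: cvg_cst|exact: (@cpd [:: true])].
Qed.

(** To the right of the line x + 2 t = 4, the foot stays positive along the Lbar-lines: it could
    only vanish at a time where the characteristics through it have already focused. *)
Let foot_pos p : U p -> 4 <= p.2 + 2 * p.1 -> 0 < p.1 -> 0 < foot psi p.
Proof.
move=> Up u4 p0; rewrite ltNge; apply/negP => z0.
have [_ _ ver] := fut Up (ltW p0).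
pose v s : R * R := (s, p.2 + 2 * (p.1 - s)).
have cv s : {for s, continuous v}.
  apply: continuous_pair; first exact: cvg_id.
  apply: cvgD; first exact: cvg_cst.
  apply: cvgM; first exact: cvg_cst.
  by apply: cvgB; [exact: cvg_cst|exact: cvg_id].
have cf q : U q -> {for q, continuous (foot psi)}.
  move=> Uq; apply: cvgB; first exact: cvg_snd.
  apply: cvgM; first exact: cvg_fst.
  by apply: cvgD; [exact: cvg_cst|exact: cpsi].
have [||s sp s0] := @IVT0 _ (fun s => foot psi (v s)) 0 p.1 (ltW p0).
- by move=> s /ver Us; apply: (@continuous_comp _ _ _ v (foot psi)); [exact: cv|exact: cf].
- right; rewrite /v subrr mulr0 addr0 -surjective_pairing z0 /=.
  by rewrite /foot /= mul0r subr0 subr0; lra.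
have [_ k lt] := footE (ver _ sp).
move: k lt; rewrite -/(v s) s0 kap0 expr0n addr0 /= => k lt; lra.
Qed.

(** A point of U is the end of an unfocused characteristic, and Omega consists of the points
    for which the branch of the foot is thereby determined. *)
Let in_OmegaC p : U p -> OmegaC p /\ zC p = foot psi p.
Proof.
move=> Up; have [_ k lt] := footE Up; set z := foot psi p in k lt *.
have [z0|z0] := leP 0 z.
  have [_ zE] := right_uniq z0 (ltW lt) k; split => //.
  have [t0|t0] := leP p.1 0; first exact: OmegaC_le0.
  have [u4|u4] := ltP (p.2 + 2 * p.1) 4; first by left.
  by apply: right_OmegaC lt k; exact: foot_pos.
have u4 : p.2 + 2 * p.1 < 4.
  have [t0|t0] := leP p.1 0.
    have : atan z < 0 by rewrite -(@atan0 R); exact: lt_atan.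
    move: k; rewrite /kap => k a0.
    have : 0 <= p.1 * atan z by rewrite mulr_le0// ltW.
    lra.
  rewrite ltNge; apply/negP => u4; have := foot_pos Up u4 t0; rewrite -/z; lra.
by have [_ zE] := left_uniq z0 lt k (ltW u4); split => //; left.
Qed.

Lemma GHD_subset : U `<=` @OmegaC R.
Proof. by move=> p /in_OmegaC[]. Qed.

Let psiE p : U p -> psi p = Psi (@PhiC R) p.
Proof.
by move=> Up; have [inO zE] := in_OmegaC Up; have [pE _ _] := footE Up; rewrite pE Psi_PhiC// zE.
Qed.

(** Psi = Lbar Phi determines Phi along the lines x + 2 t = const. *)
Let phi_line (s0 x0 s : R) : U (s, x0 + 2 * (s0 - s)) ->
  is_derive s 1 (fun s => Phi (s, x0 + 2 * (s0 - s)) - (@PhiC R) (s, x0 + 2 * (s0 - s))) 0.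
Proof.
set v := (s, _) => Uv; have Ov := GHD_subset Uv.
have d1 : is_derive s 1 (fun s : R => s) 1 by exact: is_derive_id.
have d2 : is_derive s 1 (fun s : R => x0 + 2 * (s0 - s)) (- 2).
  have := is_deriveD (is_derive_cst x0 s (1:R)) (is_deriveZ 2
    (is_deriveB (is_derive_cst s0 s (1:R)) (is_derive_id s (1:R)))).
  by rewrite add0r sub0r /GRing.scale /= mulrN1.
have G1 : has_gradient Phi v (pd [:: false] v) (pd [:: true] v).
  apply: (C1_has_gradient oU Uv); try exact: cpd.
    by move=> q; exact: (@dpd [::] false).
  by move=> q; exact: (@dpd [::] true).
have sO := @PhiC_smooth R.
have dO i q : OmegaC q -> is_derive q (axis R i) (@PhiC R) (pderiv [:: i] (@PhiC R) q).
  by move=> Oq; apply: derivableP; have [H _] := sO 1%N; exact: (H [::]).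
have cO i q : OmegaC q -> {for q, continuous (pderiv [:: i] (@PhiC R))}.
  by move=> Oq; have [_ H] := sO 1%N; exact: H.
have G2 := C1_has_gradient (@open_OmegaC R) Ov (@dO false) (@dO true) (cO false _ Ov) (cO true _ Ov).
have K := is_deriveB (has_gradient_chain G1 d1 d2 erefl) (has_gradient_chain G2 d1 d2 erefl).
apply: (is_derive_eq K).
have := psiE Uv; rewrite /psi /Psi.
rewrite -[X in X - _ = _]/(pd [:: false] v) -[X in _ - 2 * X = _]/(pd [:: true] v).
rewrite -[X in _ = X - _]/(pderiv [:: false] (@PhiC R) v).
rewrite -[X in _ = _ - 2 * X]/(pderiv [:: true] (@PhiC R) v) => E.
move: (pd [:: false] v) (pd [:: true] v) (pderiv [:: false] _ v) (pderiv [:: true] _ v) E.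
by move=> a b c d E; rewrite !mul1r !mulNr; lra.
Qed.

Lemma GHD_eq p : U p -> Phi p = @PhiC R p.
Proof.
move=> Up; pose D s := Phi (s, p.2 + 2 * (p.1 - s)) - (@PhiC R) (s, p.2 + 2 * (p.1 - s)).
have D0 : D 0 = 0.
  have [[_ _ _ _ ini] _ _ _] := ghd.
  have [e1 _] := ini (p.2 + 2 * (p.1 - 0)).
  have [e2 _] := PhiC_init (p.2 + 2 * (p.1 - 0)).
  by rewrite /D e1 e2 subrr.
suff : D p.1 = 0.
  by rewrite /D subrr mulr0 addr0 -surjective_pairing => /eqP; rewrite subr_eq0 => /eqP.
have [p0|/ltW p0] := leP 0 p.1.
  have [_ _ ver] := fut Up p0.
  by rewrite -[RHS]D0; exact: (derive_eq0_cst p0 (fun s h => phi_line (ver s h))).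
have [_ ver] := past Up p0.
by rewrite -[RHS]D0; exact: esym (derive_eq0_cst p0 (fun s h => phi_line (ver s h))).
Qed.

End AnyDevelopment.

Section MaximalDevelopment.
Variable R : realType.

Theorem PhiC_MGHD : MGHD (@OmegaC R) (@PhiC R).
Proof.
split=> [|[U [Phi [ghd sub ne _]]]]; first exact: PhiC_GHD.
by apply: ne; apply/seteqP; split => //; exact: GHD_subset ghd.
Qed.

Theorem MGHD_unique (U : set (R * R)) (Phi : R * R -> R) : MGHD U Phi ->
  U = @OmegaC R /\ forall p, OmegaC p -> Phi p = PhiC p.
Proof.
move=> [ghd max].
have UE : U = @OmegaC R.
  apply: contrapT => ne; apply: max; exists (@OmegaC R), (@PhiC R); split => //.
  - exact: PhiC_GHD.
  - exact: GHD_subset ghd.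
  - by move=> p Up; rewrite (GHD_eq ghd Up).
by split => // p; rewrite -UE; exact: GHD_eq.
Qed.

End MaximalDevelopment.

(** * The boundary *)

Section Boundary.
Variable R : realType.
Implicit Types (p q : R * R) (t z : R).

Definition Bset : set (R * R) := [set sing z | z in [set z : R | 0 < z]].
Definition Sset : set (R * R) := [set sing 0].
Definition Cset : set (R * R) := [set p | p.2 + 2 * p.1 = 4 /\ 1 < p.1].

Lemma wB_oneDsqr z : 0 <= z -> wB (1 + z ^+ 2) = z.
Proof. by move=> z0; rewrite /wB addrAC subrr add0r sqrtr_sqr ger0_norm. Qed.

Lemma sing_xB z : 0 <= z -> sing z = (1 + z ^+ 2, xB (1 + z ^+ 2)).
Proof. by move=> z0; rewrite /sing /xB wB_oneDsqr//; congr (_, _); ring. Qed.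

Lemma xB1 : xB 1 = 2 :> R. Proof. by rewrite xB_le1// mulr1. Qed.

Lemma sing0 : sing 0 = (1, 2) :> R * R.
Proof. by rewrite sing_xB// expr0n addr0 xB1. Qed.

Lemma BsetE : Bset = [set p | 1 < p.1 /\ p.2 = xB p.1].
Proof.
apply/seteqP; split => [_ [z /= z0 <-]|[t x] /= [t1 ->]].
  by rewrite sing_xB ?ltW//=; split => //; rewrite ltrDl exprn_gt0.
exists (wB t); first exact: wB_gt0.
by rewrite sing_xB ?wB_ge0// wB_sqr ?ltW// addrC subrK.
Qed.

Lemma xB_lower t : 1 <= t -> 4 <= xB t + 2 * t.
Proof.
by rewrite le_eqVlt => /predU1P[<-|/xB_above/ltW//]; rewrite xB1; lra.
Qed.

Lemma closure_OmegaC : closure (@OmegaC R) = @clOmegaC R.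
Proof.
apply/seteqP; split => p.
  by move=> /(closureS (@sub_OmegaC R)) ?; exact: closed_clOmegaC.
move=> cp B /nbhs_ballP[r /= r0 rB].
have shift (x : R) : `|x - p.2| < r -> ball p r (p.1, x).
  by move=> h; rewrite -ball_normE /= distrC norm_pair_lt /= subrr normr0 r0.
case: cp => h.
  exists (p.1, p.2 - r / 2); split; first by left => /=; lra.
  apply: rB; apply: shift; rewrite addrAC subrr add0r normrN gtr0_norm ?divr_gt0//; lra.
exists (p.1, p.2 + r / 2); split; first by right => /=; lra.
apply: rB; apply: shift; rewrite addrAC subrr add0r gtr0_norm ?divr_gt0//; lra.
Qed.

Lemma boundaryE : boundary (@OmegaC R) = Bset `|` Sset `|` Cset.
Proof.
rewrite /boundary closure_OmegaC (interior_id _).1; last exact: open_OmegaC.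
rewrite BsetE /Sset sing0; apply/seteqP; split => [[t x] [cp nO]|[t x]].
  have u4 : 4 <= x + 2 * t by rewrite leNgt; apply/negP => h; apply: nO; left.
  have xb : x <= xB t by rewrite leNgt; apply/negP => h; apply: nO; right.
  have t1 : 1 <= t.
    rewrite leNgt; apply/negP => t1.
    by have xb2 : x <= 2 * t; [rewrite -xB_le1// ltW|lra].
  move: t1; rewrite le_eqVlt => /predU1P[t1|t1].
    move: u4 xb; rewrite -t1 xB1 => u4 xb; left; right => /=.
    by congr (_, _); lra.
  case: cp => /= h; first by right; split => //=; lra.
  by left; left => /=; split => //; apply/eqP; rewrite eq_le xb.
have nO : 4 <= x + 2 * t -> x <= xB t -> ~ OmegaC (t, x).
  by move=> h1 h2 [/=|/=]; rewrite ltNge; [rewrite h1|rewrite h2].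
move=> [[/= [t1 xb]|/= [t1 x2]]|[/= u4 t1]].
- split; first by right => /=; rewrite xb.
  by apply: nO; rewrite xb//; exact: xB_lower (ltW t1).
- split; first by right => /=; rewrite t1 x2 xB1.
  by apply: nO; rewrite t1 x2 ?xB1//; lra.
- have := xB_above t1 => xa; split; first by left => /=; rewrite u4.
  by apply: nO; [rewrite u4|lra].
Qed.

Lemma BS_disjoint : Bset `&` Sset = set0.
Proof.
rewrite BsetE /Sset sing0; apply/seteqP; split => // p [/= [p1 _] pE].
by move: p1; rewrite pE /= ltxx.
Qed.

Lemma BC_disjoint : Bset `&` Cset = set0.
Proof.
rewrite BsetE; apply/seteqP; split => // p [/= [p1 pE] [u4 _]].
by have := xB_above p1; rewrite -pE; lra.
Qed.

Lemma SC_disjoint : Sset `&` Cset = set0.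
Proof.
rewrite /Sset sing0; apply/seteqP; split => // p [/= pE [_ p1]].
by move: p1; rewrite pE /= ltxx.
Qed.

(** ** Connectedness *)

Definition curveB t : R * R := (t, xB t).
Definition curveC t : R * R := (t, 4 - 2 * t).

Lemma continuous_curveB : continuous curveB.
Proof.
by move=> t; apply: (@continuous_pair R R id (@xB R) t); [exact: cvg_id|exact: continuous_xB].
Qed.

Lemma continuous_curveC : continuous curveC.
Proof.
move=> t; apply: (@continuous_pair R R id (fun t => 4 - 2 * t) t); first exact: cvg_id.
by apply: cvgB; [exact: cvg_cst|apply: cvgM; [exact: cvg_cst|exact: cvg_id]].
Qed.

Lemma Bset_image : Bset = curveB @` [set` `]1, +oo[ ].
Proof.
rewrite BsetE; apply/seteqP; split => [[t x] /= [t1 ->]|_ [t /= t1 <-]].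
  by exists t => //=; rewrite in_itv /= t1.
by split => //=; move: t1; rewrite in_itv /= andbT.
Qed.

Lemma Cset_image : Cset = curveC @` [set` `]1, +oo[ ].
Proof.
apply/seteqP; split => [[t x] [/= u4 t1]|_ [t /= t1 <-]].
  exists t => /=; first by rewrite in_itv /= t1.
  by rewrite /curveC; congr (_, _); lra.
by split => /=; [ring|move: t1; rewrite in_itv /= andbT].
Qed.

Lemma closedB_image : Bset `|` Sset = curveB @` [set` `[1, +oo[ ].
Proof.
rewrite BsetE /Sset sing0; apply/seteqP; split => [[t x] /= [[t1 ->]|[-> ->]]|_ [t /= t1 <-]].
- by exists t => //=; rewrite in_itv /= andbT ltW.
- by exists 1 => /=; [rewrite in_itv /= lexx|rewrite /curveB xB1].
- move: t1; rewrite in_itv /= andbT le_eqVlt => /predU1P[<-|t1]; last by left.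
  by right; rewrite /curveB xB1.
Qed.

Lemma closedC_image : Cset `|` Sset = curveC @` [set` `[1, +oo[ ].
Proof.
rewrite /Sset sing0; apply/seteqP; split => [[t x] /= [[/= u4 t1]|[-> ->]]|_ [t /= t1 <-]].
- exists t => /=; first by rewrite in_itv /= andbT ltW.
  by rewrite /curveC; congr (_, _); lra.
- exists 1 => /=; first by rewrite in_itv /= lexx.
  by rewrite /curveC; congr (_, _); ring.
- move: t1; rewrite in_itv /= andbT le_eqVlt => /predU1P[<-|t1].
    by right; rewrite /curveC; congr (_, _); ring.
  by left; split => /=; [ring|].
Qed.

Lemma connected_curve (c : R -> R * R) (i : interval R) : continuous c ->
  connected (c @` [set` i]).
Proof.
move=> cc; apply: connected_continuous_connected; last exact: continuous_subspaceT.
by apply/connected_intervalP; exact: interval_is_interval.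
Qed.

Lemma connected_Bset : connected Bset.
Proof. by rewrite Bset_image; apply: connected_curve; exact: continuous_curveB. Qed.

Lemma connected_Sset : connected Sset.
Proof. exact: connected1. Qed.

Lemma connected_Cset : connected Cset.
Proof. by rewrite Cset_image; apply: connected_curve; exact: continuous_curveC. Qed.

Lemma connected_boundary : connected (boundary (@OmegaC R)).
Proof.
rewrite boundaryE.
have -> : Bset `|` Sset `|` Cset = (Bset `|` Sset) `|` (Cset `|` Sset).
  by rewrite [Cset `|` _]setUC setUA -[in RHS](setUA Bset) setUid.
apply: connectedU; first by exists (sing 0); split; right.
  by rewrite closedB_image; apply: connected_curve; exact: continuous_curveB.
by rewrite closedC_image; apply: connected_curve; exact: continuous_curveC.
Qed.

(** ** Closures *)

Lemma closure_ray (c f : R -> R) (E : set (R * R)) :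
  (E = (fun t => (t, f t)) @` [set` `]1, +oo[ ]) -> continuous f ->
  ~ E (1, f 1) -> closure E `\` E = [set (1, f 1)].
Proof.
move=> EE cf nE; apply/seteqP; split => [[t x] [cE nEt]|_ ->].
  have cl : closed [set p : R * R | 1 <= p.1 /\ p.2 = f p.1].
    have -> : [set p : R * R | 1 <= p.1 /\ p.2 = f p.1] =
        ~` ([set p | p.1 < 1] `|` ([set p | p.2 - f p.1 < 0] `|` [set p | 0 < p.2 - f p.1])).
      apply/seteqP; split => p /=.
        by move=> [p1 ->] [|[|]]; rewrite ?subrr ?ltxx// ltNge p1.
      move=> H; split; first by rewrite leNgt; apply/negP => h; apply: H; left.
      apply/eqP; rewrite eq_le; apply/andP; split; rewrite leNgt; apply/negP => h; apply: H; right.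
        by right; rewrite subr_gt0.
      by left; rewrite subr_lt0.
    have cg : continuous (fun p : R * R => p.2 - f p.1).
      move=> p; apply: cvgB; first exact: cvg_snd.
      by apply: (@continuous_comp _ _ _ fst f); [exact: cvg_fst|exact: cf].
    apply: open_closedC; apply: openU; last apply: openU.
    - by apply: open_sublevel => p; exact: cvg_fst.
    - exact: open_sublevel.
    - exact: open_superlevel.
  have EF : E `<=` [set p : R * R | 1 <= p.1 /\ p.2 = f p.1].
    by rewrite EE => _ [s /= s1 <-] /=; move: s1; rewrite in_itv /= andbT => /ltW.
  have [/= t1 xE] := cl _ (closureS EF cE).
  move: t1; rewrite le_eqVlt => /predU1P[t1|t1]; first by rewrite /= xE -t1.
  by exfalso; apply: nEt; rewrite EE; exists t => /=; [rewrite in_itv /= t1|rewrite xE].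
split => // B /nbhs_ballP[r /= r0 rB].
have /continuous_epsP/(_ _ r0)[d d0 dP] := cf 1.
pose s := 1 + Num.min r d / 2.
have m0 : 0 < Num.min r d by rewrite lt_min r0.
have m2 : Num.min r d / 2 < Num.min r d by rewrite ltr_pdivrMr// ltr_pMr// ltrDl.
have s1 : `|s - 1| = Num.min r d / 2.
  by rewrite /s addrAC subrr add0r gtr0_norm// divr_gt0.
have [mr md] : Num.min r d / 2 < r /\ Num.min r d / 2 < d.
  by apply/andP; rewrite -lt_min.
exists (s, f s); split.
  by rewrite EE; exists s => //=; rewrite in_itv /= andbT /s ltrDl divr_gt0.
apply: rB; rewrite -ball_normE /= distrC norm_pair_lt /= s1 mr /=.
by apply: dP; rewrite s1.
Qed.

Lemma closure_Cset : closure Cset `\` Cset = Sset.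
Proof.
have E : (1, 4 - 2 * 1) = sing 0 :> R * R by rewrite sing0; congr (_, _); ring.
rewrite (@closure_ray id (fun t => 4 - 2 * t) Cset Cset_image) ?E//.
  by move=> t; apply: cvgB; [exact: cvg_cst|apply: cvgM; [exact: cvg_cst|exact: cvg_id]].
by move=> CS; have : (Sset `&` Cset) (sing 0) by []; rewrite SC_disjoint.
Qed.

Lemma closure_Bset : closure Bset `\` Bset = Sset.
Proof.
have E : (1, xB 1) = sing 0 :> R * R by rewrite sing0 xB1.
rewrite (@closure_ray id (@xB R) Bset Bset_image) ?E//; first exact: continuous_xB.
by move=> BS; have : (Bset `&` Sset) (sing 0) by []; rewrite BS_disjoint.
Qed.

(** ** Submanifolds *)

Lemma affine_smooth (U : set (R * R)) (a b c : R) : open U ->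
  smooth_on U (fun p => a * p.1 + b * p.2 + c).
Proof.
move=> oU; apply: (@class_smooth R U (fun f => exists a b c, f = fun p => a * p.1 + b * p.2 + c) oU).
- move=> _ p [a' [b' [c' ->]]] _; apply: cvgD; last exact: cvg_cst.
  by apply: cvgD; apply: cvgM; (try exact: cvg_cst); [exact: cvg_fst|exact: cvg_snd].
- move=> _ i [a' [b' [c' ->]]]; exists (fun=> if i then b' else a').
    by exists 0, 0, (if i then b' else a'); apply/funext => p; rewrite !mul0r !add0r.
  move=> p _; apply/is_derive_axisP; case: i; rewrite /slice /coord.
    apply: (is_derive_eq (is_deriveD (is_deriveD (is_derive_cst (a' * p.1) p.2 (1:R))
      (is_deriveZ b' (is_derive_id p.2 (1:R)))) (is_derive_cst c' p.2 (1:R)))).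
    by rewrite add0r addr0 /GRing.scale /= mulr1.
  apply: (is_derive_eq (is_deriveD (is_deriveD (is_deriveZ a' (is_derive_id p.1 (1:R)))
    (is_derive_cst (b' * p.2) p.1 (1:R))) (is_derive_cst c' p.1 (1:R)))).
  by rewrite !addr0 /GRing.scale /= mulr1.
- by exists a, b, c.
Qed.

Lemma pderiv_affine (a b c : R) i p :
  pderiv [:: i] (fun p : R * R => a * p.1 + b * p.2 + c) p = if i then b else a.
Proof.
suff H : is_derive p (axis R i) (fun p : R * R => a * p.1 + b * p.2 + c) (if i then b else a).
  exact: (@derive_val _ _ _ _ _ _ _ H).
apply/is_derive_axisP; case: i; rewrite /slice /coord.
  apply: (is_derive_eq (is_deriveD (is_deriveD (is_derive_cst (a * p.1) p.2 (1:R))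
    (is_deriveZ b (is_derive_id p.2 (1:R)))) (is_derive_cst c p.2 (1:R)))).
  by rewrite add0r addr0 /GRing.scale /= mulr1.
apply: (is_derive_eq (is_deriveD (is_deriveD (is_deriveZ a (is_derive_id p.1 (1:R)))
  (is_derive_cst (b * p.2) p.1 (1:R))) (is_derive_cst c p.1 (1:R)))).
by rewrite !addr0 /GRing.scale /= mulr1.
Qed.

Lemma open_t1 : open [set p : R * R | 1 < p.1].
Proof. by apply: open_superlevel => p; exact: cvg_fst. Qed.

Lemma submanifold_Cset : submanifold 1 Cset.
Proof.
move=> p [u4 p1]; exists [set p : R * R | 1 < p.1], (fun _ p => 2 * p.1 + 1 * p.2 + (- 4)).
split.
- by split; [exact: open_t1|].
- by move=> i; apply: affine_smooth; exact: open_t1.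
- move=> q /= q1; split=> [[e _] _|/(_ ord0) e]; first lra.
  by split => //; lra.
- move=> q _ c /(_ true); rewrite big_ord1 pderiv_affine mulr1 => c0 i.
  by rewrite [i]ord1.
Qed.

Lemma submanifold_Sset : submanifold 2 Sset.
Proof.
move=> p _; exists setT, (fun i p => (if i == ord0 then 1 else 0) * p.1 +
  (if i == ord0 then 0 else 1) * p.2 + (if i == ord0 then - 1 else - 2)).
split.
- by split; [exact: openT|].
- by move=> i; apply: affine_smooth; exact: openT.
- move=> [t x] _; rewrite /Sset sing0 /=; split=> [[-> ->] i|H].
    by case: eqP => _; ring.
  by have := H ord0; have := H ord_max; rewrite /= => h1 h2; congr (_, _); lra.
- move=> q _ c H i.
  have := H false; rewrite !big_ord_recl big_ord0 !pderiv_affine /= mulr1 mulr0 !addr0 => c0.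
  have := H true; rewrite !big_ord_recl big_ord0 !pderiv_affine /= mulr1 mulr0 add0r addr0 => c1.
  case: i => [[|[|//]]] Hi; [rewrite -c0|rewrite -c1]; congr c; exact: val_inj.
Qed.

Lemma is_derive_wB t : 1 < t -> is_derive t 1 (@wB R) (2^-1 * (wB t)^-1).
Proof.
move=> t1; have H : is_derive t 1 (fun t : R => t - 1) 1.
  by have := is_deriveB (is_derive_id t (1:R)) (is_derive_cst (1:R) t (1:R)); rewrite subr0.
have t10 : 0 < t - 1 by rewrite subr_gt0.
have := @is_derive1_comp R Num.sqrt (fun t => t - 1) t _ _ (is_derive1_sqrt t10) H.
by rewrite mulr1 invfM.
Qed.

(** Along B the curve has slope 2 + Psi: it is an integral curve of L. *)
Lemma is_derive_xB t : 1 < t -> is_derive t 1 (@xB R) (2 - atan (wB t)).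
Proof.
move=> t1; have w0 := wB_gt0 t1; have wE := wB_sqr (ltW t1).
have dw := is_derive_wB t1.
have da := @is_derive1_comp R atan (@wB R) t _ _ (is_derive1_atan (wB t)) dw.
apply: (is_derive_eq (is_deriveD dw (is_deriveM (is_derive_id t (1:R))
  (is_deriveB (is_derive_cst (2:R) t (1:R)) da)))).
rewrite /GRing.scale /= sub0r.
have -> : (cst (2:R) - (atan \o @wB R)) t = 2 - atan (wB t) by [].
have tE : t = 1 + wB t ^+ 2 by rewrite wE; ring.
move: w0 tE; set w := wB t => w0 ->. field.
by rewrite gt_eqF// oneDsqr_neq0'.
Qed.

(** The stable class of functions that makes x - xB t a smooth defining function of B. *)
Inductive elemW : (R * R -> R) -> Prop :=
| elemW_w f : elem1 f -> elemW (fun p => f (wB p.1))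
| elemW_i : elemW (fun p => (wB p.1)^-1)
| elemW_t : elemW (fun p => p.1)
| elemW_x : elemW (fun p => p.2)
| elemW_add f g : elemW f -> elemW g -> elemW (fun p => f p + g p)
| elemW_mul f g : elemW f -> elemW g -> elemW (fun p => f p * g p).

Lemma elemW_cst c : elemW (fun=> c).
Proof. exact: (elemW_w (elem1_cst c)). Qed.

Lemma is_derive_slice_t (f : R -> R) (d : R) i p : is_derive p.1 1 f d ->
  is_derive p (axis R i) (fun p => f p.1) (if i then 0 else d).
Proof. by move=> H; apply/is_derive_axisP; case: i; rewrite /slice /coord //; exact: (is_derive_cst (f p.1) p.2 (1:R)). Qed.

Lemma elemW_smooth f : elemW f -> smooth_on [set p : R * R | 1 < p.1] f.
Proof.
apply: (@class_smooth R _ elemW open_t1) => {}f.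
  move=> p Ef p1; elim: Ef => [{}f /elem1_continuous cf||||{}f g _ cf _ cg|{}f g _ cf _ cg].
  - apply: (@continuous_comp _ _ _ (fun p => wB p.1) f); last exact: cf.
    by apply: (@continuous_comp _ _ _ fst (@wB R)); [exact: cvg_fst|exact: continuous_wB].
  - apply: cvgV; first by rewrite gt_eqF// wB_gt0.
    by apply: (@continuous_comp _ _ _ fst (@wB R)); [exact: cvg_fst|exact: continuous_wB].
  - exact: cvg_fst.
  - exact: cvg_snd.
  - exact: continuousD.
  - exact: continuousM.
move=> i; elim=> [{}f /elem1_derive[f' Ef' Df]||||{}f g Ef [f' Ef' Df] Eg [g' Eg' Dg]
  |{}f g Ef [f' Ef' Df] Eg [g' Eg' Dg]].
- exists (fun p => (if i then 0 else 1) * (f' (wB p.1) * (2^-1 * (wB p.1)^-1))).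
    apply: elemW_mul; first exact: elemW_cst.
    apply: elemW_mul; first exact: elemW_w.
    by apply: elemW_mul; [exact: elemW_cst|exact: elemW_i].
  move=> p /= p1; have K := @is_derive1_comp R f (@wB R) p.1 _ _ (Df (wB p.1)) (is_derive_wB p1).
  apply: (is_derive_eq (is_derive_slice_t i K)).
  by case: i; rewrite ?mul0r ?mul1r.
- exists (fun p => (if i then 0 else 1) * (- 2^-1 * ((wB p.1)^-1 * ((wB p.1)^-1 * (wB p.1)^-1)))).
    apply: elemW_mul; first exact: elemW_cst.
    apply: elemW_mul; first exact: elemW_cst.
    by apply: elemW_mul; [|apply: elemW_mul]; exact: elemW_i.
  move=> p /= p1; have w0 : wB p.1 != 0 by rewrite gt_eqF// wB_gt0.
  have K := @is_deriveV R (@wB R) p.1 _ 1 w0 (is_derive_wB p1).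
  apply: (is_derive_eq (is_derive_slice_t i K)).
  case: i; rewrite ?mul0r ?mul1r// /GRing.scale /=.
  by field.
- exists (fun=> if i then 0 else 1); first exact: elemW_cst.
  by move=> p _; exact: is_derive_slice_t (is_derive_id p.1 (1:R)).
- exists (fun=> if i then 1 else 0); first exact: elemW_cst.
  by move=> p _; apply/is_derive_axisP; case: i; [exact: is_derive_id|exact: is_derive_cst].
- exists (fun p => f' p + g' p); first exact: elemW_add.
  by move=> p p1; exact: is_deriveD (Df p p1) (Dg p p1).
- exists (fun p => f p * g' p + g p * f' p); first by apply: elemW_add; exact: elemW_mul.
  by move=> p p1; exact: is_deriveM (Df p p1) (Dg p p1).
Qed.

Lemma submanifold_Bset : submanifold 1 Bset.
Proof.
rewrite BsetE => p [p1 pE]; exists [set p : R * R | 1 < p.1], (fun _ p => p.2 - xB p.1).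
split.
- by split; [exact: open_t1|].
- move=> i.
  have -> : (fun p : R * R => p.2 - xB p.1) = (fun p => p.2 + - 1 * ((fun y => y) (wB p.1) +
      p.1 * (2 + - 1 * atan (wB p.1)))).
    by apply/funext => q; rewrite /xB; ring.
  apply: elemW_smooth; apply: elemW_add; first exact: elemW_x.
  apply: elemW_mul; first exact: elemW_cst.
  apply: elemW_add; first exact: (@elemW_w id (elem1_id R)).
  apply: elemW_mul; first exact: elemW_t.
  apply: elemW_add; first exact: elemW_cst.
  by apply: elemW_mul; [exact: elemW_cst|exact: (@elemW_w atan (elem1_atan R))].
- move=> q /= q1; split=> [[_ ->] _|/(_ ord0) e]; first by rewrite subrr.
  by split => //; apply/eqP; rewrite -subr_eq0 e.
- move=> q _ c /(_ true); rewrite big_ord1.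
  have H : is_derive q (axis R true) (fun p : R * R => p.2 - xB p.1) 1.
    apply/is_derive_axisP; rewrite /slice /coord.
    by have := is_deriveB (is_derive_id q.2 (1:R)) (is_derive_cst (xB q.1) q.2 (1:R)); rewrite subr0.
  rewrite [pderiv _ _ _](@derive_val _ _ _ _ _ _ _ H) mulr1 => c0 i.
  by rewrite [i]ord1.
Qed.

End Boundary.

(** * Hoelder regularity up to the boundary *)

Section BoundaryRegularity.
Variable R : realType.
Implicit Types (p q : R * R) (t z : R) (U : set (R * R)).

(** ** Continuity up to the boundary *)

Lemma foot_cvg (A : set (R * R)) (f : R -> R) p : A `<=` @clOmegaC R -> A p -> continuous f ->
  f (zC q) @[q --> within A (nbhs p)] --> f (zC p).
Proof.
move=> AO Ap cf; apply: (@continuous_cvg _ _ _ _ _ (@zC R) f); first exact: cf.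
apply/cvgrPdist_lt => e e0; have [d d0 dP] := zC_continuous_cl (AO _ Ap) e0.
rewrite /prop_near1 /within /=; apply/nbhs_ballP; exists d => //= q.
by rewrite -ball_normE /= distrC => qd /AO cq; rewrite distrC; exact: dP.
Qed.

Lemma ucoord_cvg (A : set (R * R)) (f : R -> R) p : continuous f ->
  f (ucoord q) @[q --> within A (nbhs p)] --> f (ucoord p).
Proof.
move=> cf; apply: (@continuous_cvg _ _ _ _ _ (@ucoord R) f); first exact: cf.
apply: (@cvg_trans _ (@ucoord R @ nbhs p)); last exact: continuous_ucoord.
by apply: cvg_app; exact: cvg_within.
Qed.

Lemma PhiC_cvg (A : set (R * R)) p : A `<=` @clOmegaC R -> A p ->
  @PhiC R q @[q --> within A (nbhs p)] --> @PhiC R p.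
Proof.
move=> AO Ap; have cln := elem1_continuous (elem1_lnf R).
have cH := elem1_continuous (elem1_Hf R).
rewrite /PhiC /Phi_of; apply: cvgB; last by apply: cvgB; [exact: foot_cvg|exact: ucoord_cvg].
apply: cvgB; last first.
  apply: cvgM; first by apply: (@ucoord_cvg A id) => y; exact: cvg_id.
  by apply: cvgB; [exact: foot_cvg|exact: ucoord_cvg].
apply: cvgM; last by apply: foot_cvg => //; exact: continuous_atan.
apply: cvgN; apply: (@cvg_trans _ (fst @ nbhs p)); last exact: cvg_fst.
by apply: cvg_app; exact: cvg_within.
Qed.

(** ** Hoelder bounds *)

(** The mean value theorem, with a derivative that is continuous on [-m, m]. *)
Lemma elem1_lipschitz (f : R -> R) m : elem1 f -> exists2 C : R, 0 <= C &
  forall a b, `|a| <= m -> `|b| <= m -> `|f a - f b| <= C * `|a - b|.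
Proof.
move=> /elem1_derive[f' /elem1_continuous cf' Df].
have [m0|m0] := leP 0 m; last first.
  by exists 0 => // a b am; have := normr_ge0 a; lra.
have mm : - m <= m by lra.
have [|c _ cP] := @EVT_max R (fun z => `|f' z|) (- m) m mm.
  apply: continuous_subspaceT => z.
  by apply: (@continuous_comp _ _ _ f' Num.norm); [exact: cf'|exact: norm_continuous].
exists `|f' c|; first exact: normr_ge0.
have main a b : - m <= a -> a < b -> b <= m -> `|f b - f a| <= `|f' c| * `|b - a|.
  move=> ma ab bm; have [s /andP[s1 s2] ->] := @mean_value R f f' a b ab (fun x _ => Df x).
  rewrite normrM ler_wpM2r//; apply: cP; rewrite in_itv /=; apply/andP; split; lra.
move=> a b; rewrite !(ler_norml _ m) => /andP[a1 a2] /andP[b1 b2].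
have [ab|ba|->] := ltgtP a b.
- by rewrite (distrC (f a)) (distrC a); apply: main.
- by apply: main.
- by rewrite !subrr normr0 mulr0.
Qed.

Lemma rootK n (x : R) : 0 <= x -> (x `^ n.+1%:R^-1) ^+ n.+1 = x.
Proof.
by move=> x0; rewrite -powR_mulrn ?powR_ge0// -powRrM mulVf ?powRr1.
Qed.

(** Stated with the n-th power, as the estimates on kap deliver it. *)
Definition foot_holder n U := exists m K : R, [/\ 0 <= m,
  forall p, (U `&` @clOmegaC R) p -> `|p| <= m &
  forall p q, (U `&` @clOmegaC R) p -> (U `&` @clOmegaC R) q ->
    `|zC p - zC q| ^+ n <= K * `|p - q|].

Lemma ucoord_norm p q : `|ucoord p - ucoord q| <= 3 * `|p - q|.
Proof.
have : `|p - q| <= `|p - q| by [].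
rewrite {1}norm_pair_le /= => /andP[]; rewrite !ler_norml => /andP[? ?] /andP[? ?].
by rewrite /ucoord; apply/andP; split; lra.
Qed.

Lemma holder_foot n U (f g : R -> R) : foot_holder n.+1 U -> elem1 f -> elem1 g ->
  holder_on n.+1%:R^-1 (U `&` @clOmegaC R) (fun p => f (zC p) + g (ucoord p)).
Proof.
move=> [m [K [m0 Um UK]]] /(elem1_lipschitz (5 * m))[C1 C10 C1P].
move=> /(elem1_lipschitz (3 * m))[C2 C20 C2P].
pose kp := `|K| `^ n.+1%:R^-1; pose M := (2 * m) `^ n.+1%:R^-1.
exists (C1 * kp + C2 * (3 * M ^+ n)) => p q Ap Aq.
set a := `|p - q| `^ _; have a0 : 0 <= a by exact: powR_ge0.
have aE : a ^+ n.+1 = `|p - q| by exact: rootK.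
have kp0 : 0 <= kp by exact: powR_ge0.
have kE : kp ^+ n.+1 = `|K| by exact: rootK.
have M0 : 0 <= M by exact: powR_ge0.
have za : `|zC p - zC q| <= kp * a.
  rewrite -(@ler_pXn2r _ n.+1) ?nnegrE ?mulr_ge0// exprMn aE kE.
  by apply: le_trans (UK _ _ Ap Aq) _; rewrite ler_wpM2r// ler_norm.
have aM : a <= M.
  rewrite -(@ler_pXn2r _ n.+1) ?nnegrE// aE rootK ?mulr_ge0//.
  by apply: le_trans (ler_normB _ _) _; have := Um _ Ap; have := Um _ Aq; lra.
have ua : `|ucoord p - ucoord q| <= 3 * M ^+ n * a.
  apply: le_trans (ucoord_norm _ _) _; rewrite -mulrA ler_wpM2l// -aE exprSr.
  by rewrite ler_wpM2r// lerXn2r.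
have zb r : (U `&` @clOmegaC R) r -> `|zC r| <= 5 * m.
  move=> Ar; apply: (le_trans (zC_bound Ar.2)); rewrite ler_wpM2l//; exact: Um.
have ub r : (U `&` @clOmegaC R) r -> `|ucoord r| <= 3 * m.
  move=> Ar; have := ucoord_norm r 0; rewrite /ucoord /= mulr0 addr0 subr0 subr0 => /le_trans; apply.
  by rewrite ler_wpM2l//; exact: Um.
have -> : f (zC p) + g (ucoord p) - (f (zC q) + g (ucoord q)) =
   (f (zC p) - f (zC q)) + (g (ucoord p) - g (ucoord q)) by ring.
apply: le_trans (ler_normD _ _) _; rewrite mulrDl; apply: lerD.
  by apply: le_trans (C1P _ _ (zb _ Ap) (zb _ Aq)) _; rewrite -mulrA ler_wpM2l.
by apply: le_trans (C2P _ _ (ub _ Ap) (ub _ Aq)) _; rewrite -mulrA ler_wpM2l.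
Qed.

Lemma holder_pair (V W : normedModType R) (al : R) (A : set (R * R)) (f : R * R -> V) (g : R * R -> W) :
  holder_on al A f -> holder_on al A g -> holder_on al A (fun p => (f p, g p)).
Proof.
move=> [C1 H1] [C2 H2]; exists (Num.max C1 C2) => p q Ap Aq.
have a0 : 0 <= `|p - q| `^ al by exact: powR_ge0.
rewrite [X in X <= _](_ : _ = Num.max `|f p - f q| `|g p - g q|)// ge_max; apply/andP; split.
  by apply: le_trans (H1 _ _ Ap Aq) _; rewrite ler_wpM2r// le_max lexx.
by apply: le_trans (H2 _ _ Ap Aq) _; rewrite ler_wpM2r// le_max lexx orbT.
Qed.

Lemma open_ball_norm p0 : open [set q : R * R | `|q - p0| < 1].
Proof.
apply/open_epsP => q /= q1; exists (1 - `|q - p0|); first by rewrite subr_gt0.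
move=> r /= rq; have -> : r - p0 = (r - q) + (q - p0) by rewrite addrA subrK.
by apply: le_lt_trans (ler_normD _ _) _; lra.
Qed.

(** Both branches meet at S, and there the uniform cubic estimate is used. *)
Lemma foot_holderS : exists U, open_nbhs (sing (0:R)) U /\ foot_holder 3 U.
Proof.
exists [set q | `|q - sing 0| < 1]; split.
  by split; [exact: open_ball_norm|rewrite /= subrr normr0].
exists 3, (1200 * (1 + 15 ^+ 2)).
have m3 q : `|q - sing 0| < 1 -> `|q| <= 3.
  rewrite sing0 norm_pair_lt norm_pair_le /= !ltr_norml !ler_norml.
  by move=> /andP[/andP[? ?] /andP[? ?]]; apply/andP; split; apply/andP; split; lra.
split => // [p [/= /m3//]|p q [/m3 p3 cp] [/m3 q3 cq]].
apply: zC_cubic => //.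
  by apply: le_trans (zC_bound cp) _; lra.
by apply: le_trans (zC_bound cq) _; lra.
Qed.

(** In branch_same the factor z2 + 2 z1 is bounded below by 3 ze. *)
Lemma zC_quadratic p q m ze : @clOmegaC R p -> @clOmegaC R q -> 0 < ze ->
  ze <= zC p -> ze <= zC q -> `|zC p| <= m -> `|zC q| <= m ->
  `|zC p - zC q| ^+ 2 <= 27 * (1 + m ^+ 2) / ze * `|p - q|.
Proof.
move=> cp cq ze0 zp zq; rewrite !ler_norml => /andP[_ pm] /andP[_ qm].
have main p' q' : @clOmegaC R p' -> @clOmegaC R q' -> ze <= zC p' -> zC p' <= zC q' -> zC q' <= m ->
    `|p' - q'| = `|p - q| -> (zC q' - zC p') ^+ 2 <= 27 * (1 + m ^+ 2) / ze * `|p - q|.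
  move=> cp' cq' zp' zpq q'm <-; rewrite -mulrAC ler_pdivlMr//.
  have : `|p' - q'| <= `|p' - q'| by [].
  rewrite {1}norm_pair_le /= => /andP[d1 d2].
  have t1 : `|p'.1 - q'.1| <= 3 * `|p' - q'| by have := normr_ge0 (p' - q'); lra.
  have k1 : `|kap p'.1 (zC p') - kap q'.1 (zC q')| <= 3 * `|p' - q'|.
    rewrite !zC_kap//; move: d1 d2; rewrite !ler_norml => /andP[? ?] /andP[? ?].
    by apply/andP; split; lra.
  have zp0 : 0 <= zC p' by apply: le_trans zp'; exact: ltW.
  have := branch_same zp0 zpq q'm (zC_le cp') t1 k1.
  have -> : 9 * (1 + m ^+ 2) * (3 * `|p' - q'|) = 27 * (1 + m ^+ 2) * `|p' - q'| by ring.
  apply: le_trans; rewrite ler_wpM2l ?sqr_ge0//; lra.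
have [pq|/ltW qp] := leP (zC p) (zC q).
  by rewrite distrC real_normK ?num_real//; apply: main.
by rewrite real_normK ?num_real//; apply: main => //; exact: distrC.
Qed.

(** Near a point of B only the branch zC >= sqrt (t - 1) is met, and there zC is bounded
    below by a positive constant. *)
Lemma foot_holderB p0 : @Bset R p0 -> exists U, open_nbhs p0 U /\ foot_holder 2 U.
Proof.
rewrite BsetE => -[t1 pE]; pose z0 := wB p0.1; have z00 : 0 < z0 by exact: wB_gt0.
pose ze := z0 / 2; have ze0 : 0 < ze by rewrite divr_gt0.
have zeE : 1 + ze ^+ 2 < p0.1.
  have := wB_sqr (ltW t1); rewrite -/z0 /ze expr_div_n => zE.
  by have := exprn_gt0 2 z00; rewrite zE; lra.
have lt_ze t : 1 + ze ^+ 2 < t -> ze < wB t.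
  move=> h; rewrite ltNge; apply/negP => h2; have := le_oneDwB t.
  by have : wB t ^+ 2 <= ze ^+ 2; [rewrite lerXn2r ?nnegrE ?wB_ge0//; exact: ltW|lra].
pose U := [set q | `|q - p0| < 1] `&` ([set q | 4 < ucoord q] `&` [set q | 1 + ze ^+ 2 < q.1]).
exists U; split.
  split; last first.
    split; first by rewrite /= subrr normr0.
    by split => //=; rewrite /ucoord pE; exact: xB_above.
  apply: openI; first exact: open_ball_norm.
  apply: openI; first exact: open_superlevel (@continuous_ucoord R).
  by apply: open_superlevel => p; exact: cvg_fst.
pose m := `|p0| + 1; have m0 : 0 <= m by rewrite addr_ge0.
have m3 q : `|q - p0| < 1 -> `|q| <= m.
  by move=> h; rewrite -[q](subrK p0); apply: le_trans (ler_normD _ _) _; rewrite /m; lra.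
have zU q : (U `&` @clOmegaC R) q -> ze <= zC q /\ `|zC q| <= 5 * m.
  move=> [[/= /m3 qm [u4 q1]] cq]; split; last first.
    by apply: (le_trans (zC_bound cq)); rewrite ler_wpM2l.
  apply: ltW; apply: (lt_le_trans (lt_ze _ q1)); apply: zC_right => //.
  by case: cq => //; rewrite leNgt u4.
exists m, (27 * (1 + (5 * m) ^+ 2) / ze).
split => // [p [[/m3//]]|p q Ap Aq].
have [zp pm] := zU _ Ap; have [zq qm] := zU _ Aq.
exact: zC_quadratic Ap.2 Aq.2 ze0 zp zq pm qm.
Qed.

End BoundaryRegularity.

Section BoundaryExtensions.
Variable R : realType.
Implicit Types (p q : R * R) (t z : R) (U : set (R * R)).
Notation Om := (@OmegaC R).
Notation fz := (@zC R).

(** ** The Hoelder extensions *)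

Definition LextC p : R * R := (1, 2 - atan (zC p)).

Lemma LextC_L p : Om p -> LextC p = L (@PhiC R) p.
Proof. by move=> Op; rewrite /L Psi_PhiC. Qed.

Lemma foot_smooth (f : R -> R) : elem1 f -> smooth_on Om (fun p => f (zC p)).
Proof.
move=> ef; apply: (elem2_smooth (@open_OmegaC R) (@zC_kapO R) (@zC_lt R) (@zC_continuous R)).
exact: elem2_z.
Qed.

Lemma LextC_smooth : smooth_on Om LextC.
Proof.
apply: smooth_on_pair; first exact: open_OmegaC.
  by apply: (@foot_smooth (fun=> 1)); exact: elem1_cst.
have -> : (fun q : R * R => 2 - atan (zC q)) = (fun q => 2 + - 1 * atan (zC q)).
  by apply/funext => q; rewrite mulN1r.
apply: (@foot_smooth (fun z => 2 + - 1 * atan z)); apply: elem1_add; first exact: elem1_cst.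
by apply: elem1_mul; [exact: elem1_cst|exact: elem1_atan].
Qed.

Lemma holder_foot1 n U (f : R -> R) : foot_holder n.+1 U -> elem1 f ->
  holder_on n.+1%:R^-1 (U `&` @clOmegaC R) (fun p => f (zC p)).
Proof.
move=> UH ef; have [C CP] := holder_foot UH ef (elem1_cst 0).
by exists C => p q Ap Aq; have := CP p q Ap Aq; rewrite !addr0.
Qed.

Lemma metric_ofE :
  metric_of fz = (fun p => (form_tt (zC p), form_tx (zC p), form_xx (zC p))).
Proof. by apply/funext => p; rewrite /metric_of acoustical_formE. Qed.

Lemma metric_holder n U : foot_holder n.+1 U ->
  holder_on n.+1%:R^-1 (U `&` @clOmegaC R) (metric_of fz).
Proof.
move=> UH; rewrite metric_ofE; apply: holder_pair; first apply: holder_pair.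
- exact: (holder_foot1 UH (elem1_form_tt R)).
- exact: (holder_foot1 UH (elem1_form_tx R)).
- exact: (holder_foot1 UH (elem1_form_xx R)).
Qed.

Lemma LextC_holder n U : foot_holder n.+1 U ->
  holder_on n.+1%:R^-1 (U `&` @clOmegaC R) LextC.
Proof.
move=> UH; apply: holder_pair; first exact: (holder_foot1 UH (elem1_cst 1)).
have -> : (fun p : R * R => 2 - atan (zC p)) = (fun p => (fun z => 2 + - 1 * atan z) (zC p)).
  by apply/funext => q; rewrite mulN1r.
apply: (holder_foot1 UH (f := fun z => 2 + - 1 * atan z)).
apply: elem1_add; first exact: elem1_cst.
by apply: elem1_mul; [exact: elem1_cst|exact: elem1_atan].
Qed.

Lemma cvg_pair_point (V W : normedModType R) (T : Type) (F : set_system T) {FF : Filter F}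
    (f : T -> V) (g : T -> W) (a : V) (b : W) :
  f x @[x --> F] --> a -> g x @[x --> F] --> b -> (f x, g x) @[x --> F] --> (a, b).
Proof. exact: (@cvg_pair _ _ _ _ (nbhs a) (nbhs b)). Qed.

Lemma metric_cvg (A : set (R * R)) p : A `<=` @clOmegaC R -> A p ->
  metric_of fz q @[q --> within A (nbhs p)] --> metric_of fz p.
Proof.
move=> AO Ap; rewrite metric_ofE.
have [c1 c2 c3] := And3 (elem1_continuous (elem1_form_tt R)) (elem1_continuous (elem1_form_tx R))
  (elem1_continuous (elem1_form_xx R)).
apply: cvg_pair_point; last exact: (foot_cvg AO Ap c3).
by apply: cvg_pair_point; [exact: (foot_cvg AO Ap c1)|exact: (foot_cvg AO Ap c2)].
Qed.

Lemma LextC_cvg (A : set (R * R)) p : A `<=` @clOmegaC R -> A p ->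
  LextC q @[q --> within A (nbhs p)] --> LextC p.
Proof.
move=> AO Ap; apply: cvg_pair_point; first exact: cvg_cst.
by apply: cvgB; [exact: cvg_cst|apply: foot_cvg => //; exact: continuous_atan].
Qed.

Lemma holder_extension0 (V : normedModType R) (al : R) (f F : R * R -> V) U p :
  open_nbhs p U -> (forall q, Om q -> F q = f q) -> smooth_on Om F ->
  (forall q, (U `&` @clOmegaC R) q -> F r @[r --> within (U `&` @clOmegaC R) (nbhs q)] --> F q) ->
  holder_on al (U `&` @clOmegaC R) F -> holder_extension 0 al Om f F p.
Proof.
move=> pU Ff sF cF hF; exists U, (fun=> F); rewrite closure_OmegaC; split => //.
- by move=> q [_ /Ff].
- rewrite /Ck_up_to_boundary closure_OmegaC; split => //.
  + by apply: (smooth_onS _ sF) => q [].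
  + by case.
  + by move=> s _; apply/subspace_continuousP.
Qed.

(** The gradient is a function of u and of the foot alone, so it makes sense on the closure. *)
Definition gradC (s : seq bool) : R * R -> R :=
  match s with
  | [::] => @PhiC R
  | i :: _ => if i then Phix_of fz else Phit_of fz
  end.

Lemma gradC_cvg s (A : set (R * R)) p : A `<=` @clOmegaC R -> A p ->
  gradC s q @[q --> within A (nbhs p)] --> gradC s p.
Proof.
move=> AO Ap; have cln := elem1_continuous (elem1_lnf R).
have cx : Phix_of fz q @[q --> within A (nbhs p)] --> Phix_of fz p.
  by apply: cvgB; [exact: ucoord_cvg|exact: foot_cvg].
case: s => [|[] s]; [exact: PhiC_cvg|exact: cx|].
apply: cvgD; last by apply: cvgM => //; exact: cvg_cst.
by apply: cvgN; apply: foot_cvg => //; exact: continuous_atan.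
Qed.

Lemma gradC_pderiv s p : (size s <= 1)%N -> Om p -> gradC s p = pderiv s (@PhiC R) p.
Proof.
case: s => [//|i [|//]] _ Op; case: i.
  exact/esym/(derive_Phi_x (@open_OmegaC R) (@zC_kapO R) (@zC_lt R) (@zC_continuous R) Op).
exact/esym/(derive_Phi_t (@open_OmegaC R) (@zC_kapO R) (@zC_lt R) (@zC_continuous R) Op).
Qed.

Lemma gradC_holder n U s : foot_holder n.+1 U -> size s = 1%N ->
  holder_on n.+1%:R^-1 (U `&` @clOmegaC R) (gradC s).
Proof.
move=> UH; case: s => [//|i [|//]] _.
have en : elem1 (fun z : R => - 1 * lnf z) by apply: elem1_mul; [exact: elem1_cst|exact: elem1_lnf].
case: i => /=.
  have [C CP] := holder_foot UH en (elem1_lnf R).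
  exists C => p q Ap Aq; have := CP p q Ap Aq; congr (`|_| <= _).
  by rewrite /Phix_of; ring.
have ea : elem1 (fun z : R => - 1 * atan z + 2 * (- 1 * lnf z)).
  apply: elem1_add; first by apply: elem1_mul; [exact: elem1_cst|exact: elem1_atan].
  by apply: elem1_mul => //; exact: elem1_cst.
have eu : elem1 (fun z : R => 2 * lnf z) by apply: elem1_mul; [exact: elem1_cst|exact: elem1_lnf].
have [C CP] := holder_foot UH ea eu.
exists C => p q Ap Aq; have := CP p q Ap Aq; congr (`|_| <= _).
by rewrite /Phit_of /Phix_of; ring.
Qed.

Lemma PhiC_holder n U p : open_nbhs p U -> foot_holder n.+1 U ->
  holder_extension 1 n.+1%:R^-1 Om (@PhiC R) (@PhiC R) p.
Proof.
move=> pU UH; exists U, gradC; rewrite closure_OmegaC; split => //; last first.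
  by move=> s s1; exact: gradC_holder.
rewrite /Ck_up_to_boundary closure_OmegaC; split => //.
- by apply: (smooth_onS _ (@PhiC_smooth R)) => q [].
- by move=> s q s1 [_ Oq]; exact: gradC_pderiv.
- by move=> s s1; apply/subspace_continuousP => q Aq; apply: gradC_cvg => // r [].
Qed.

Lemma metric_extension n U p : open_nbhs p U -> foot_holder n.+1 U ->
  holder_extension 0 n.+1%:R^-1 Om (acoustical_metric (@PhiC R)) (metric_of fz) p.
Proof.
move=> pU UH; apply: (holder_extension0 pU).
- by move=> q /metric_PhiC.
- exact: (metric_of_smooth (@open_OmegaC R) (@zC_kapO R) (@zC_lt R) (@zC_continuous R)).
- by move=> q Aq; apply: metric_cvg => // r [].
- exact: metric_holder.
Qed.

Lemma LextC_extension n U p : open_nbhs p U -> foot_holder n.+1 U ->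
  holder_extension 0 n.+1%:R^-1 Om (L (@PhiC R)) LextC p.
Proof.
move=> pU UH; apply: (holder_extension0 pU).
- exact: LextC_L.
- exact: LextC_smooth.
- by move=> q Aq; apply: LextC_cvg => // r [].
- exact: LextC_holder.
Qed.

(** ** Sharpness *)

(** A function that varies by h between points at distance K h^(n+1) is not Hoelder continuous of
    any exponent be > 1 / (n+1): with ep = (n+1) be - 1 > 0, the bound would give
    1 <= C K^be h^ep for all small h. *)
Lemma no_holder n (K h0 C be : R) : 0 < h0 -> 0 <= K -> n.+1%:R^-1 < be ->
  ~ (forall h, 0 < h < h0 -> h <= C * (K * h ^+ n.+1) `^ be).
Proof.
move=> h00 K0 nb H; pose ep := n.+1%:R * be - 1.
have n0 : (0 : R) < n.+1%:R by rewrite ltr0n.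
have ep0 : 0 < ep by rewrite subr_gt0 mulrC -ltr_pdivrMr// div1r.
pose D := `|C| * K `^ be; have D0 : 0 <= D by rewrite mulr_ge0// powR_ge0.
pose h := Num.min (h0 / 2) ((D + 1)^-1 `^ ep^-1).
have D10 : 0 < D + 1 by lra.
have h1 : 0 < h by rewrite lt_min divr_gt0// powR_gt0// invr_gt0.
have hh0 : h < h0 by rewrite gt_min ltr_pdivrMr// ltr_pMr// ltrDl ltr01.
have hep : h `^ ep <= (D + 1)^-1.
  have : h <= (D + 1)^-1 `^ ep^-1 by rewrite ge_min lexx orbT.
  move=> /(@ge0_ler_powR _ ep (ltW ep0) h ((D + 1)^-1 `^ ep^-1)).
  rewrite -powRrM mulVf ?gt_eqF// powRr1 ?invr_ge0 ?(ltW D10)//; apply; rewrite nnegrE.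
    exact: ltW.
  exact: powR_ge0.
have := H h; rewrite h1 hh0 => /(_ isT).
rewrite powRM ?exprn_ge0 ?(ltW h1)// -powR_mulrn ?(ltW h1)// -powRrM.
have -> : n.+1%:R * be = 1 + ep by rewrite /ep addrC subrK.
rewrite powRD; last by rewrite (gt_eqF h1) implybT.
rewrite powRr1 ?(ltW h1)// => hC.
have : h <= h * (D * h `^ ep).
  apply: le_trans hC _.
  have -> : C * (K `^ be * (h * h `^ ep)) = h * (C * K `^ be * h `^ ep) by ring.
  by rewrite ler_pM2l// ler_wpM2r ?powR_ge0// ler_wpM2r ?powR_ge0// ler_norm.
rewrite -[X in X <= _]mulr1 ler_pM2l// => D1.
have : D * h `^ ep <= D * (D + 1)^-1 by rewrite ler_wpM2l.
have : D * (D + 1)^-1 < 1 by rewrite ltr_pdivrMr// mul1r ltrDl.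
lra.
Qed.

(** Two feet z0 + h and z0 + 2 h on the line t = 1 + z0^2 through sing z0: since
    kap' (z) = (z^2 - z0^2) / (1 + z^2) on it, their points are closer than the feet. *)
Definition nearby z0 h : R * R :=
  (1 + z0 ^+ 2, 2 * (1 + z0 ^+ 2) + kap (1 + z0 ^+ 2) (z0 + h)).

Lemma kap_upper z0 h a b : 0 <= z0 -> 0 <= h -> z0 <= a -> a <= b -> b <= z0 + 2 * h ->
  0 <= kap (1 + z0 ^+ 2) b - kap (1 + z0 ^+ 2) a <= 4 * h * (z0 + h) * (b - a).
Proof.
move=> z00 h0 za ab bh; set t := 1 + z0 ^+ 2; set c := 4 * h * (z0 + h).
have E z : (1 + z ^+ 2 - t) / (1 + z ^+ 2) = (z ^+ 2 - z0 ^+ 2) / (1 + z ^+ 2).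
  by congr (_ / _); rewrite /t; ring.
apply/andP; split.
  rewrite subr_ge0; apply: (@ger0_derive_le R (kap t) _ a b ab (fun x _ => is_derive_kap t x)).
  move=> z /andP[az zb] /=; rewrite E divr_ge0 ?(ltW (oneDsqr_gt0' z))// subr_ge0.
  by rewrite lerXn2r ?nnegrE; lra.
rewrite lerBlDr -lerBlDl.
have H z : is_derive z 1 (fun y => c * y - kap t y) (c - (1 + z ^+ 2 - t) / (1 + z ^+ 2)).
  apply: (is_derive_eq (is_deriveB (is_deriveZ c (is_derive_id z (1:R))) (is_derive_kap t z))).
  by rewrite /GRing.scale /= mulr1.
suff : c * a - kap t a <= c * b - kap t b by lra.
apply: (@ger0_derive_le R _ _ a b ab (fun x _ => H x)) => z /andP[az zb] /=.
rewrite E subr_ge0 ler_pdivrMr ?oneDsqr_gt0'//.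
have c0 : 0 <= c by rewrite /c !mulr_ge0//; lra.
apply: (@le_trans _ _ c); last by rewrite -[X in X <= _]mulr1 ler_wpM2l// lerDl sqr_ge0.
have -> : z ^+ 2 - z0 ^+ 2 = (z - z0) * (z + z0) by ring.
have -> : c = (2 * h) * (2 * z0 + 2 * h) by rewrite /c; ring.
by apply: ler_pM; lra.
Qed.

Lemma nearby_foot z0 h : 0 <= z0 -> 0 < h -> Om (nearby z0 h) /\ zC (nearby z0 h) = z0 + h.
Proof.
move=> z00 h0; have zh : 0 < z0 + h by lra.
have lt : 1 + z0 ^+ 2 < 1 + (z0 + h) ^+ 2 by rewrite ltrD2l ltr_sqr ?nnegrE//; lra.
have E : kap (nearby z0 h).1 (z0 + h) = (nearby z0 h).2 - 2 * (nearby z0 h).1.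
  by rewrite /nearby /=; ring.
split; first exact: (@right_OmegaC R (nearby z0 h) _ zh lt E).
by have [] := @right_uniq R (nearby z0 h) _ (ltW zh) (ltW lt) E.
Qed.

Lemma nearby_sing z0 : 0 <= z0 -> sing z0 = nearby z0 0.
Proof. by move=> z00; rewrite /sing /nearby /kap addr0; congr (_, _); ring. Qed.

Lemma nearby_dist z0 h a b : 0 <= z0 -> 0 <= h -> 0 <= a -> a <= b -> b <= 2 * h ->
  `|nearby z0 b - nearby z0 a| <= 4 * h * (z0 + h) * (b - a).
Proof.
move=> z00 h0 a0 ab bh.
have [ha hb hc] : [/\ z0 <= z0 + a, z0 + a <= z0 + b & z0 + b <= z0 + 2 * h] by split; lra.
have /andP[k1 k2] := kap_upper z00 h0 ha hb hc.
rewrite norm_pair_le /= subrr normr0; apply/andP; split.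
  apply: le_trans k1 _; apply: (le_trans k2); lra.
have -> : 2 * (1 + z0 ^+ 2) + kap (1 + z0 ^+ 2) (z0 + b) - (2 * (1 + z0 ^+ 2) +
  kap (1 + z0 ^+ 2) (z0 + a)) = kap (1 + z0 ^+ 2) (z0 + b) - kap (1 + z0 ^+ 2) (z0 + a) by ring.
by rewrite ger0_norm//; apply: (le_trans k2); lra.
Qed.

Lemma subr_atan_lower z1 z2 M : 0 <= z1 -> z1 <= z2 -> z2 <= M ->
  z2 - z1 <= (1 + M ^+ 2) * (atan z2 - atan z1).
Proof.
move=> z10 z12 z2M; have M0 : 0 < 1 + M ^+ 2 by exact: oneDsqr_gt0'.
have H z : is_derive z 1 (fun y : R => (1 + M ^+ 2) * atan y - y) ((1 + M ^+ 2) * (1 + z ^+ 2)^-1 - 1).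
  apply: (is_derive_eq (is_deriveB (is_deriveZ (1 + M ^+ 2) (is_derive1_atan z)) (is_derive_id z (1:R)))).
  by [].
suff : (1 + M ^+ 2) * atan z1 - z1 <= (1 + M ^+ 2) * atan z2 - z2 by lra.
apply: (@ger0_derive_le R _ _ z1 z2 z12 (fun x _ => H x)) => z /andP[az zb] /=.
rewrite subr_ge0 ler_pdivlMr ?oneDsqr_gt0'// mul1r lerD2l lerXn2r ?nnegrE; lra.
Qed.

(** A C^1 extension would carry along a Hoelder continuous extension of Psi = - atan zC, which is
    D [:: false] - 2 D [:: true]; test it on the points nearby z0 h and nearby z0 (2 h). *)
Lemma PhiC_sharp n z0 K : 0 <= z0 -> 0 <= K ->
  (forall h, 0 < h < 1 -> 4 * h * (z0 + h) * h <= K * h ^+ n.+1) ->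
  forall be : R, n.+1%:R^-1 < be ->
  ~ exists F, holder_extension 1 be Om (@PhiC R) F (sing z0).
Proof.
move=> z00 K0 HK be nb [F [U [D [[oU Us] FP [CkF _ DF _] hD]]]].
have be0 : 0 < be by apply: lt_trans nb; rewrite invr_gt0 ltr0n.
have DE p : U p -> Om p -> D [:: false] p - 2 * D [:: true] p = - atan (zC p).
  move=> Up Op; rewrite !DF//.
  have oUO : open (U `&` Om) by apply: openI => //; exact: open_OmegaC.
  rewrite !(pderiv_eq _ oUO FP)//.
  by rewrite -Psi_PhiC.
have [C1 C1P] := hD [:: false] erefl; have [C2 C2P] := hD [:: true] erefl.
have /open_epsP/(_ _ Us)[r r0 rP] := oU.
pose M := z0 + 2; pose c := 8 * (z0 + 1).
have c0 : 0 < c by rewrite /c; lra.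
pose h0 := Num.min 1 (r / c).
have h00 : 0 < h0 by rewrite lt_min ltr01 divr_gt0.
apply: (@no_holder n K h0 ((1 + M ^+ 2) * (`|C1| + 2 * `|C2|)) be h00 K0 nb).
move=> h /andP[hgt]; rewrite lt_min => /andP[h1]; rewrite ltr_pdivlMr// => hr.
have near_s a : 0 < a -> a <= 2 * h -> U (nearby z0 a) /\ Om (nearby z0 a).
  move=> a0 ah; split; last by have [] := nearby_foot z00 a0.
  apply: rP; rewrite nearby_sing//; apply: (le_lt_trans (@nearby_dist z0 h 0 a z00 (ltW hgt) (lexx _) (ltW a0) ah)).
  apply: le_lt_trans hr; rewrite /c subr0.
  have : 4 * h * (z0 + h) * a <= 4 * h * (z0 + 1) * a.
    by rewrite ler_wpM2r ?(ltW a0)// ler_wpM2l; lra.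
  move=> /le_trans; apply.
  have : 4 * h * (z0 + 1) * a <= 4 * h * (z0 + 1) * 2.
    by rewrite ler_wpM2l ?mulr_ge0//; lra.
  by move=> /le_trans; apply; lra.
have h2 : h <= 2 * h by lra.
have h20 : 0 < 2 * h by lra.
have [U1 O1] := near_s _ hgt h2; have [U2 O2] := near_s _ h20 (lexx _).
have [_ z1] := nearby_foot z00 hgt; have [_ z2] := nearby_foot z00 h20.
set p1 := nearby z0 h in U1 O1 z1; set p2 := nearby z0 (2 * h) in U2 O2 z2.
have A1 : (U `&` closure Om) p1 by split => //; exact: subset_closure.
have A2 : (U `&` closure Om) p2 by split => //; exact: subset_closure.
have d12 : `|p2 - p1| <= K * h ^+ n.+1.
  apply: (le_trans (@nearby_dist z0 h h (2 * h) z00 (ltW hgt) (ltW hgt) h2 (lexx _))).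
  by have := HK h; rewrite hgt h1 => /(_ isT); apply: le_trans; rewrite ler_wpM2l; [|apply: mulr_ge0|]; lra.
have X0 : 0 <= (K * h ^+ n.+1) `^ be by exact: powR_ge0.
have dpow : `|p2 - p1| `^ be <= (K * h ^+ n.+1) `^ be.
  by apply: ge0_ler_powR; rewrite ?nnegrE ?mulr_ge0 ?exprn_ge0 ?(ltW be0) ?(ltW hgt).
have e1b : `|D [:: false] p2 - D [:: false] p1| <= `|C1| * (K * h ^+ n.+1) `^ be.
  apply: (le_trans (C1P _ _ A2 A1)); apply: le_trans (ler_wpM2l (normr_ge0 _) dpow).
  by rewrite ler_wpM2r ?powR_ge0// ler_norm.
have e2b : `|D [:: true] p2 - D [:: true] p1| <= `|C2| * (K * h ^+ n.+1) `^ be.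
  apply: (le_trans (C2P _ _ A2 A1)); apply: le_trans (ler_wpM2l (normr_ge0 _) dpow).
  by rewrite ler_wpM2r ?powR_ge0// ler_norm.
have := @subr_atan_lower (z0 + h) (z0 + 2 * h) M.
have -> : z0 + 2 * h - (z0 + h) = h by ring.
have zz : 0 <= z0 + h by lra.
have zz2 : z0 + h <= z0 + 2 * h by lra.
have zz3 : z0 + 2 * h <= M by rewrite /M; lra.
move=> /(_ zz zz2 zz3) /le_trans; apply.
set X := _ `^ be in e1b e2b *; rewrite -[leRHS]mulrA ler_wpM2l ?(ltW (oneDsqr_gt0' _))//.
have := DE _ U1 O1; have := DE _ U2 O2; rewrite z1 z2.
move: e1b e2b; rewrite !ler_norml => /andP[a1 _] /andP[_ a2] E2 E1.
rewrite [leRHS]mulrDl; move: a1 a2 E1 E2; clear; lra.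
Qed.

End BoundaryExtensions.

(** * The singular boundary and the Cauchy horizon *)

Section SingularBoundary.
Variable R : realType.
Implicit Types (p q : R * R) (t z : R) (U : set (R * R)).
Notation Om := (@OmegaC R).
Notation fz := (@zC R).

(** The bound 4 h (z0 + h) h on the distance of the test points is cubic in h at z0 = 0, and
    quadratic at z0 > 0. *)
Lemma PhiC_sharpS : sharp_exponent 1 3^-1 Om (@PhiC R) (@Sset R).
Proof.
move=> _ -> be; apply: (@PhiC_sharp R 2 0 4) => // h _.
by rewrite le_eqVlt; apply/orP; left; apply/eqP; ring.
Qed.

Lemma PhiC_sharpB : sharp_exponent 1 2^-1 Om (@PhiC R) (@Bset R).
Proof.
move=> _ [z /= z0 <-] be; apply: (@PhiC_sharp R 1 z (4 * (z + 1))); rewrite ?mulr_ge0//; try lra.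
move=> h /andP[h0 h1].
have -> : 4 * h * (z + h) * h = (z + h) * (4 * h ^+ 2) by ring.
have -> : 4 * (z + 1) * h ^+ 2 = (z + 1) * (4 * h ^+ 2) by ring.
by apply: ler_wpM2r; [rewrite mulr_ge0// sqr_ge0|lra].
Qed.

(** ** Blow-up of the second derivatives *)

Lemma zC_sing z : 0 <= z -> zC (sing z) = z.
Proof.
move=> z0; have E : kap (sing z).1 z = (sing z).2 - 2 * (sing z).1 by rewrite /sing /kap /=; ring.
by have [] := @right_uniq R (sing z) z z0 (lexx _) E.
Qed.

Lemma singular_point p : (@Sset R `|` @Bset R) p -> exists2 z, 0 <= z & p = sing z.
Proof. by move=> [->|[z /= z0 <-]]; [exists 0|exists z; rewrite ?ltW]. Qed.

Lemma singular_cl p : (@Sset R `|` @Bset R) p -> clOmegaC p.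
Proof.
by move=> /singular_point[z z0 ->]; right; rewrite sing_xB.
Qed.

Lemma hessian_norm_ge (f : R * R -> R) p : pderiv [:: true; true] f p <= hessian_norm f p.
Proof.
set d := pderiv _ f p; apply: le_trans (ler_norm d) _; rewrite -sqrtr_sqr ler_sqrt; last first.
  by apply: sumr_ge0 => i _; apply: sumr_ge0 => j _; exact: sqr_ge0.
have sum_ge (G : bool -> R) : (forall i, 0 <= G i) -> G true <= \sum_(i : bool) G i.
  by move=> G0; rewrite (bigD1 true)//= lerDl sumr_ge0.
apply: le_trans (@sum_ge (fun i => \sum_(j : bool) pderiv [:: i; j] f p ^+ 2) _).
  by apply: (@sum_ge (fun j => pderiv [:: true; j] f p ^+ 2)) => j; exact: sqr_ge0.
by move=> i; apply: sumr_ge0 => j _; exact: sqr_ge0.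
Qed.

(** Phi_xx equals a bounded term plus mf (z) / (1 + z^2 - t), and mf >= 1/6. *)
Lemma hessian_PhiC p : Om p -> (6 * (1 + zC p ^+ 2 - p.1))^-1 - 1 <= hessian_norm (@PhiC R) p.
Proof.
move=> Op; apply: le_trans (hessian_norm_ge _ _).
rewrite [pderiv _ _ _](derive2_x (@open_OmegaC R) (@zC_kapO R) (@zC_lt R) (@zC_continuous R) true Op).
rewrite /dzv mul1r mulr1.
have q1 (y : R) : qf y * (1 + y ^+ 2) = 1 by rewrite /qf mulVf// oneDsqr_neq0'.
have q0 (y : R) : 0 <= qf y by rewrite invr_ge0 ltW// oneDsqr_gt0'.
have q2 (y : R) : qf y <= 1 by rewrite /qf invf_le1 ?oneDsqr_gt0'// lerDl sqr_ge0.
have m4 (y : R) : 0 < 4 - atan y by have := atan_lt2 y; lra.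
have m1 (y : R) : 6^-1 <= mf y.
  by rewrite /mf lef_pV2 ?posrE//; have := atan_gtN2 y; lra.
have m2 (y : R) : mf y <= 1.
  by rewrite /mf invf_le1//; have := atan_lt2 y; lra.
have r0 := rf_gt0 (@zC_lt R) Op.
have -> : - qf (zC p) * mf (zC p) * ((1 + zC p ^+ 2) * rf (@zC R) p) =
   - (mf (zC p) * rf (@zC R) p * (qf (zC p) * (1 + zC p ^+ 2))) by ring.
rewrite q1 mulr1 opprK invfM -/(rf (@zC R) p) addrC lerD//.
  rewrite mulNr lerN2; apply: le_trans (q2 (ucoord p)).
  by rewrite -[leRHS]mulr1 ler_wpM2l.
by rewrite ler_wpM2r// ltW.
Qed.

Lemma hessian_blowup p (p_ : nat -> R * R) : (@Sset R `|` @Bset R) p ->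
  (forall n, Om (p_ n)) -> p_ @ \oo --> p ->
  (fun n => hessian_norm (@PhiC R) (p_ n)) @ \oo --> +oo.
Proof.
move=> Sp Op cp; apply/cvgryPge => A.
have clp := singular_cl Sp; have [z z0 pE] := singular_point Sp.
pose A' := Num.max A 0 + 1; have A'0 : 0 < A' by rewrite ltr_pwDr// le_max lexx orbT.
pose e := (6 * A')^-1; have e0 : 0 < e by rewrite invr_gt0 mulr_gt0.
pose d p := 1 + zC p ^+ 2 - p.1.
have cd : d q @[q --> within (@clOmegaC R) (nbhs p)] --> d p.
  apply: cvgB; last first.
    apply: (@cvg_trans _ (fst @ nbhs p)); last exact: cvg_fst.
    by apply: cvg_app; exact: cvg_within.
  apply: cvgD; first exact: cvg_cst.
  by apply: (@foot_cvg R _ (fun z => z ^+ 2)) => // y; exact: exprn_continuous.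
have d0 : d p = 0 by rewrite /d pE zC_sing//; rewrite /sing /=; ring.
move/cvgrPdist_lt/(_ _ e0): cd; rewrite d0 /prop_near1 /within /= => nd.
have : \forall n \near \oo, clOmegaC (p_ n) -> `|0 - d (p_ n)| < e by exact: cp nd.
apply: filterS => n /(_ (sub_OmegaC (Op n))); rewrite sub0r normrN => de.
apply: le_trans (hessian_PhiC (Op n)).
have dn : 0 < d (p_ n) by rewrite subr_gt0; exact: zC_lt.
rewrite gtr0_norm// in de.
have : A' <= (6 * d (p_ n))^-1.
  rewrite -[A']invrK lef_pV2 ?posrE ?invr_gt0 ?mulr_gt0//.
  have : 6 * d (p_ n) < 6 * e by rewrite ltr_pM2l.
  by rewrite /e invfM mulrA mulfV// mul1r => /ltW.
rewrite -/(d _) /A'; have : A <= Num.max A 0 by rewrite le_max lexx.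
lra.
Qed.

(** ** The smooth extension to C *)

(** Left of B, the foot function of the closure is the reflection z (t, x) =
    - z (t, 4 t - x), which makes sense across C as far as B and its reflection. *)
Definition Uleft : set (R * R) :=
  [set p | 1 < p.1] `&` ([set p | p.2 - xB p.1 < 0] `&` [set p | 0 < 4 * p.1 - p.2 - xB p.1]).
Definition flip p : R * R := (p.1, 4 * p.1 - p.2).
Definition zleft p : R := - zC (flip p).

Lemma continuous_xB_fst : continuous (fun p : R * R => xB p.1).
Proof.
by move=> p; apply: (@continuous_comp _ _ _ fst (@xB R)); [exact: cvg_fst|exact: continuous_xB].
Qed.

Lemma continuous_flip2 : continuous (fun p : R * R => 4 * p.1 - p.2).
Proof.
move=> p; apply: cvgB; last exact: cvg_snd.
by apply: cvgM; [exact: cvg_cst|exact: cvg_fst].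
Qed.

Lemma open_Uleft : open Uleft.
Proof.
apply: openI; first exact: open_t1.
apply: openI; first exact: open_sublevel (@continuous_xBp R).
apply: open_superlevel => p; apply: cvgB; first exact: continuous_flip2.
exact: continuous_xB_fst.
Qed.

Lemma flip_OmegaC p : Uleft p -> Om (flip p).
Proof. by move=> [_ [_ /= h]]; right => /=; lra. Qed.

Lemma zleft_kap p : Uleft p -> kap p.1 (zleft p) = p.2 - 2 * p.1.
Proof. by move=> /flip_OmegaC/zC_kapO; rewrite /zleft kapN /= => ->; ring. Qed.

Lemma zleft_lt p : Uleft p -> p.1 < 1 + zleft p ^+ 2.
Proof. by move=> /flip_OmegaC/zC_lt; rewrite /zleft sqrrN. Qed.

Lemma zleft_continuous p : Uleft p -> {for p, continuous zleft}.
Proof.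
move=> Up; apply: cvgN.
apply: (@continuous_comp _ _ _ flip (@zC R)); last exact: zC_continuous (flip_OmegaC Up).
by apply: (@continuous_pair R _ fst (fun p => 4 * p.1 - p.2)); [exact: cvg_fst|exact: continuous_flip2].
Qed.

Lemma zleftE p : Uleft p -> clOmegaC p -> zleft p = zC p.
Proof.
move=> Up cp; have [p1 [/= xb h]] := Up.
have u4 : p.2 + 2 * p.1 <= 4 by case: cp => //; lra.
have zl0 : zleft p < 0.
  rewrite oppr_lt0; apply: lt_le_trans (wB_gt0 p1) _.
  apply: (@zC_right R (flip p)); first exact: sub_OmegaC (flip_OmegaC Up).
  by rewrite /=; lra.
by have [] := left_uniq zl0 (zleft_lt Up) (zleft_kap Up) u4.
Qed.

Lemma sub_Uleft : @Cset R `<=` Uleft.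
Proof.
move=> p [u4 p1]; have xa := xB_above p1.
have w0 := wB_gt0 p1; have u4' : p.2 + 2 * p.1 <= 4 by lra.
have xb : p.2 < xB p.1 by lra.
split => //; split; rewrite /=; first lra.
have := left_region u4' xb; rewrite kapN kap_wB; lra.
Qed.

Lemma smooth_extension_left (V : normedModType R) (f F F' : R * R -> V) p :
  Uleft p -> (forall q, Om q -> F q = f q) -> smooth_on Uleft F' ->
  (forall q, Uleft q -> clOmegaC q -> F q = F' q) -> smooth_extension Om f F p.
Proof.
move=> Up Ff sF' FF'; exists Uleft, (fun s => pderiv s F').
have oU := open_Uleft; have oUO : open (Uleft `&` Om) by apply: openI => //; exact: open_OmegaC.
have F'F q : (Uleft `&` Om) q -> F' q = F q by move=> [Uq /sub_OmegaC cq]; rewrite FF'.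
split => //; first by move=> q [_ /Ff].
move=> k; rewrite /Ck_up_to_boundary closure_OmegaC; split.
- by apply: (smooth_on_eq oUO F'F); apply: smooth_onS sF' => q [].
- by move=> q [Uq cq] /=; rewrite FF'.
- by move=> s q _ UOq; exact: pderiv_eq oUO F'F UOq.
- move=> s sk; apply: continuous_in_subspaceT => q; rewrite inE => -[Uq _].
  by have [_ H] := sF' k; exact: H.
Qed.

Lemma PhiC_extends_C : extends_smoothly Om (@PhiC R) (@Cset R).
Proof.
move=> p /sub_Uleft Up; exists (@PhiC R).
apply: (@smooth_extension_left _ _ _ (Phi_of zleft)) => //.
  exact: (Phi_of_smooth open_Uleft zleft_kap zleft_lt zleft_continuous).
by move=> q Uq cq; rewrite /PhiC /Phi_of zleftE.
Qed.

Lemma metric_extends_C p : @Cset R p ->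
  smooth_extension Om (acoustical_metric (@PhiC R)) (metric_of fz) p.
Proof.
move=> /sub_Uleft Up; apply: (@smooth_extension_left _ _ _ (metric_of zleft)) => //.
- by move=> q /metric_PhiC.
- exact: (metric_of_smooth open_Uleft zleft_kap zleft_lt zleft_continuous).
- by move=> q Uq cq; rewrite /metric_of zleftE.
Qed.

Lemma metric_lorentzian p : lorentzian (metric_of fz p).
Proof. by apply: lorentzian_acoustical; exact: natanN4. Qed.

Lemma null_metric p (v : R * R) :
  (v.2 + 2 * v.1) * (v.2 - (2 - atan (zC p)) * v.1) = 0 -> null (metric_of fz p) v.
Proof.
by move=> h; rewrite /null /metric_of form_acoustical ?h ?mulr0//; exact: natanN4.
Qed.

Lemma LextC_null p : null (metric_of fz p) (LextC p).
Proof. by apply: null_metric; rewrite /LextC /= !mulr1 subrr mulr0. Qed.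

(** ** Tangent directions *)

Lemma tangent_graph (M : set (R * R)) (f : R -> R) (d : R) p (v : R * R) :
  (forall q, M q -> q.2 = f q.1) -> is_derive p.1 1 f d -> tangent_to M p v -> v.2 = d * v.1.
Proof.
move=> Mf df [e [ga [dga [e0 [dg _] gM g0 dg0]]]].
have I0 : `](- e), e[%classic (0:R) by rewrite /= in_itv /= oppr_lt0 e0.
have Ie s' : `|s' - 0| < e -> `](- e), e[%classic s'.
  by rewrite subr0 ltr_norml /= in_itv.
have [D1 D2] := deriv_within_components e0 Ie (dg _ I0).
have df' : is_derive (ga 0).1 1 f d by rewrite g0.
have D3 := @is_derive1_comp R f (fun s => (ga s).1) 0 _ _ df' D1.
rewrite -dg0 -[LHS](@derive_val _ _ _ _ _ _ _ D2) -[RHS](@derive_val _ _ _ _ _ _ _ D3).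
apply: near_eq_derive; near=> s.
have : - e < s < e.
  by apply/andP; split; near: s; [apply: lt_nbhsr|apply: lt_nbhsl]; rewrite ?oppr_lt0.
by move=> /gM/Mf.
Unshelve. all: by end_near. Qed.

Lemma null_curve_C : null_curve (metric_of fz) (@Cset R).
Proof.
move=> p v Cp /(@tangent_graph _ (fun t => 4 - 2 * t) (- 2) p v) H; apply: null_metric.
have -> : v.2 = - 2 * v.1; last by rewrite mulNr addNr mul0r.
apply: H; first by move=> q [u4 _]; lra.
have := is_deriveB (is_derive_cst (4:R) p.1 (1:R)) (is_deriveZ 2 (is_derive_id p.1 (1:R))).
by rewrite sub0r /GRing.scale /= mulr1.
Qed.

Lemma zC_Bset p : @Bset R p -> zC p = wB p.1.
Proof. by move=> [z /= z0 <-]; rewrite zC_sing ?ltW// /sing /= wB_oneDsqr// ltW. Qed.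

Lemma null_curve_B : null_curve (metric_of fz) (@Bset R).
Proof.
move=> p v Bp /(@tangent_graph _ (@xB R) (2 - atan (zC p)) p v) H; apply: null_metric.
have -> : v.2 = (2 - atan (zC p)) * v.1; last by rewrite subrr mulr0.
apply: H; first by move=> q; rewrite BsetE => -[].
by rewrite zC_Bset//; apply: is_derive_xB; move: Bp; rewrite BsetE => -[].
Qed.

Lemma is_derive_shift (t0 s : R) (f : R -> R) (d : R) :
  is_derive (t0 + s) 1 f d -> is_derive s 1 (fun s => f (t0 + s)) d.
Proof.
move=> H; have D : is_derive s 1 (fun s : R => t0 + s) 1.
  by have := is_deriveD (is_derive_cst t0 s (1:R)) (is_derive_id s (1:R)); rewrite add0r.
by have := @is_derive1_comp R f (fun s => t0 + s) s _ _ H D; rewrite mulr1.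
Qed.

Lemma tangent_C p : @Cset R p -> tangent_to (@Cset R) p (Lbar p).
Proof.
move=> [u4 p1]; exists (p.1 - 1), (fun s => (p.1 + s, p.2 - 2 * s)), (fun=> Lbar p).
split => //.
- by rewrite subr_gt0.
- split; last by apply: continuous_subspaceT => s; exact: cvg_cst.
  move=> s _; apply: deriv_within_pair.
    exact: is_derive_shift (is_derive_id (p.1 + s) (1:R)).
  have := is_deriveB (is_derive_cst p.2 s (1:R)) (is_deriveZ 2 (is_derive_id s (1:R))).
  by rewrite sub0r /GRing.scale /= mulr1.
- by move=> s /andP[s1 _]; split => /=; lra.
- by rewrite addr0 mulr0 subr0 -surjective_pairing.
Qed.

Definition alongB (t0 s : R) : R * R := (t0 + s, xB (t0 + s)).

Lemma alongB_in t0 s : 1 < t0 + s -> @Bset R (alongB t0 s).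
Proof. by rewrite BsetE. Qed.

Lemma alongB_deriv I t0 s : 1 < t0 + s -> deriv_within I (alongB t0) s (LextC (alongB t0 s)).
Proof.
move=> h; apply: deriv_within_pair; first exact: is_derive_shift (is_derive_id (t0 + s) (1:R)).
rewrite zC_Bset; last exact: alongB_in.
exact: is_derive_shift (is_derive_xB h).
Qed.

Lemma tangent_B p : @Bset R p -> tangent_to (@Bset R) p (LextC p).
Proof.
rewrite {1}BsetE => -[p1 pE]; exists (p.1 - 1), (alongB p.1), (fun s => (1, 2 - atan (wB (p.1 + s)))).
have pB : alongB p.1 0 = p by rewrite /alongB addr0 -pE -surjective_pairing.
have t1 s : - (p.1 - 1) < s -> 1 < p.1 + s by lra.
split => //.
- by rewrite subr_gt0.
- split=> [s|].
    rewrite /= in_itv /= => /andP[/t1 s1 _].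
    by have := @alongB_deriv `](- (p.1 - 1)), (p.1 - 1)[%classic _ _ s1; rewrite /LextC zC_Bset//; exact: alongB_in.
  apply: continuous_subspaceT => s.
  apply: (@continuous_pair R _ (fun=> 1) (fun s => 2 - atan (wB (p.1 + s)))); first exact: cvg_cst.
  apply: cvgB; first exact: cvg_cst.
  apply: (@continuous_comp _ _ _ (fun s => wB (p.1 + s)) atan); last exact: continuous_atan.
  apply: (@continuous_comp _ _ _ (fun s => p.1 + s) (@wB R)); last exact: continuous_wB.
  by apply: cvgD; [exact: cvg_cst|exact: cvg_id].
- by move=> s /andP[/t1 s1 _]; exact: alongB_in.
- by rewrite /LextC zC_Bset ?addr0// BsetE.
Qed.

(** ** Non-uniqueness of the integral curves *)

(** The characteristic of foot z, parametrised by the time relative to its endpoint on B. *)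
Definition ray z s : R * R := (1 + z ^+ 2 + s, (sing z).2 + (2 - atan z) * s).

Lemma ray_foot z s : 0 < z -> s <= 0 -> zC (ray z s) = z /\ (s < 0 -> Om (ray z s)).
Proof.
move=> z0 s0.
have E : kap (ray z s).1 z = (ray z s).2 - 2 * (ray z s).1 by rewrite /ray /sing /kap /=; ring.
split=> [|s1].
  have t1 : (ray z s).1 <= 1 + z ^+ 2 by rewrite /ray /= gerDl.
  by have [] := right_uniq (ltW z0) t1 E.
by apply: (right_OmegaC z0 _ E); rewrite /ray /= gtrDl.
Qed.

Lemma affine_curve_smooth (I : set R) (a b : R * R) : smooth_curve I (fun s => a + s *: b).
Proof.
have dq s : \forall h \near (0:R)^', h^-1 *: (((fun s : R => a + s *: b) \o shift s) (h *: (1:R)) -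
    (a + s *: b)) = b.
  near=> h; have h0 : h != 0 by near: h; exact: nbhs_dnbhs_neq.
  have -> : h *: (1:R) = h by rewrite /GRing.scale /= mulr1.
  by rewrite /= opprD addrACA subrr add0r -scalerBl addrK scalerA mulVf// scale1r.
have D1 (s : R) : is_derive s (1:R) (fun s : R => a + s *: b) b.
  have H : (h^-1 *: (((fun s : R => a + s *: b) \o shift s) (h *: (1:R)) - (a + s *: b)))
      @[h --> (0:R)^'] --> b by apply: cvg_near_cst; exact: dq.
  by apply: DeriveDef; [exact: (cvgP _ H)|exact: (cvg_lim (@norm_hausdorff _ _) H)].
have E0 : derive1 (fun s : R => a + s *: b) = cst b.
  by apply/funext => s; rewrite derive1E; exact: (@derive_val _ _ _ _ _ _ _ (D1 s)).
have Ec (c : R * R) : derive1 (cst c : R -> R * R) = cst 0.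
  by apply/funext => s; rewrite derive1E derive_cst.
have En n : exists c, derive1n n (cst b : R -> R * R) = cst c.
  by elim: n => [|n [c IH]]; [exists b|exists 0; rewrite derive1nS IH Ec].
case=> [|n] s _; first exact: (@ex_derive _ _ _ _ _ _ _ (D1 s)).
by rewrite derive1Sn E0; have [c ->] := En n; exact: derivable_cst.
Unshelve. all: by end_near. Qed.

(** The curve B is the envelope of the characteristics: at sing z it is tangent to the one with
    foot z, which comes from inside Omega. *)
Lemma two_integral_curves p : @Bset R p -> exists (a : R) (gamma1 gamma2 : R -> R * R),
  [/\ 0 < a,
      [/\ integral_curve (@LextC R) `](- a), 0] gamma1, gamma1 0 = p &
          forall s, - a < s <= 0 -> @Bset R (gamma1 s)],
      [/\ integral_curve (@LextC R) `](- a), 0] gamma2, gamma2 0 = p,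
          forall s, - a < s < 0 -> Om (gamma2 s) &
          smooth_curve `](- a), 0[ gamma2] &
      exists2 s, - a < s <= 0 & gamma1 s <> gamma2 s].
Proof.
move=> [z /= z0 <-]; have a0 : 0 < z ^+ 2 by exact: exprn_gt0.
have t1 s : - z ^+ 2 < s -> 1 < 1 + z ^+ 2 + s by lra.
exists (z ^+ 2), (alongB (1 + z ^+ 2)), (ray z); split => //.
- split=> [s||s /andP[/t1 s1 _]]; last exact: alongB_in.
    by rewrite /= in_itv /= => /andP[/t1 s1 _]; exact: alongB_deriv.
  by rewrite /alongB addr0 -sing_xB// ltW.
- split=> [s||s /andP[_ s0]|].
  + rewrite /= in_itv /= => /andP[_ s0]; rewrite /LextC (ray_foot z0 s0).1.
    apply: deriv_within_pair.
      have := is_deriveD (is_derive_cst (1 + z ^+ 2) s (1:R)) (is_derive_id s (1:R)).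
      by rewrite add0r.
    have := is_deriveD (is_derive_cst (sing z).2 s (1:R)) (is_deriveZ (2 - atan z) (is_derive_id s (1:R))).
    by rewrite add0r /GRing.scale /= mulr1.
  + by rewrite /ray addr0 mulr0 addr0.
  + exact: (ray_foot z0 (ltW s0)).2.
  + have -> : ray z = (fun s => (1 + z ^+ 2, (sing z).2) + s *: (1, 2 - atan z)).
      apply/funext => s; rewrite -[RHS]/(1 + z ^+ 2 + s *: (1:R), (sing z).2 + s *: (2 - atan z)).
      by rewrite /ray /GRing.scale /= mulr1 [s * _]mulrC.
    exact: affine_curve_smooth.
- pose s := - (z ^+ 2 / 2); have s0 : s < 0 by rewrite oppr_lt0 divr_gt0.
  have s1 : - z ^+ 2 < s by rewrite ltrN2 ltr_pdivrMr// ltr_pMr// ltrDl.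
  exists s; first by rewrite s1 ltW.
  move=> E; have := alongB_in (t1 _ s1); rewrite E BsetE => -[p1 pE].
  have [h|h] := (ray_foot z0 (ltW s0)).2 s0; last by move: h; rewrite pE ltxx.
  by have := xB_above p1; rewrite -pE; lra.
Qed.

End SingularBoundary.

Theorem theorem1p2 (R : realType) :
  exists (Omega : set (R * R)) (Phi : R * R -> R),
    (* (1) existence *)
    [/\ classical_solution Omega Phi,
        Omega <> setT,
        forall p, Omega p -> - (pi / 2) < Psi Phi p < pi / 2,
        forall p, Omega p -> Psi Phi p <> - 4 &
        smooth_lorentzian_metric Omega (acoustical_metric Phi)] /\
    (* (2) uniqueness *)
    (MGHD Omega Phi /\
     forall Omega' Phi', MGHD Omega' Phi' ->
       Omega' = Omega /\ forall p, Omega p -> Phi' p = Phi p) /\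
    exists (B S C : set (R * R)) (g : R * R -> R * R * R) (Lext : R * R -> R * R),
      (* (3a) *)
      [/\ boundary Omega = B `|` S `|` C,
          [/\ B `&` S = set0, B `&` C = set0 & S `&` C = set0],
          [/\ submanifold 1 B, submanifold 2 S & submanifold 1 C],
          [/\ connected B, connected S & connected C] &
          connected (boundary Omega)] /\
      (* (3b) *)
      (B = [set sing z | z in [set z | 0 < z]] /\ S = [set sing 0]) /\
      (* (3c) *)
      (closure C `\` C = S /\ closure B `\` B = S) /\
      (* (3d) *)
      extends_smoothly Omega Phi C /\
      (* (3e) *)
      [/\ extends_holder 1 3^-1 Omega Phi S,
          sharp_exponent 1 3^-1 Omega Phi S,
          extends_holder 1 2^-1 Omega Phi B,
          sharp_exponent 1 2^-1 Omega Phi B &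
          forall (p : R * R) (p_ : nat -> R * R), (S `|` B) p ->
            (forall n, Omega (p_ n)) -> p_ @ \oo --> p ->
            (fun n => hessian_norm Phi (p_ n)) @ \oo --> +oo] /\
      (* (3f): g and Lext are the extensions of the metric and of L *)
      ([/\ forall p, Omega p -> g p = acoustical_metric Phi p,
           forall p, S p -> holder_extension 0 3^-1 Omega (acoustical_metric Phi) g p,
           forall p, B p -> holder_extension 0 2^-1 Omega (acoustical_metric Phi) g p,
           forall p, C p -> smooth_extension Omega (acoustical_metric Phi) g p &
           forall p, boundary Omega p -> lorentzian (g p)] /\
       [/\ forall p, Omega p -> Lext p = L Phi p,
           forall p, S p -> holder_extension 0 3^-1 Omega (L Phi) Lext p,
           forall p, B p -> holder_extension 0 2^-1 Omega (L Phi) Lext p &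
           forall p, (S `|` B) p -> null (g p) (Lext p)]) /\
      (* (3g) *)
      [/\ forall p, C p -> tangent_to C p (Lbar p),
          null_curve g C,
          forall p, B p -> tangent_to B p (Lext p) &
          null_curve g B] /\
      (* (4) *)
      forall p, B p -> exists (a : R) (gamma1 gamma2 : R -> R * R),
        [/\ 0 < a,
            [/\ integral_curve Lext `](- a), 0] gamma1, gamma1 0 = p &
                forall s, - a < s <= 0 -> B (gamma1 s)],
            [/\ integral_curve Lext `](- a), 0] gamma2, gamma2 0 = p,
                forall s, - a < s < 0 -> Omega (gamma2 s) &
                smooth_curve `](- a), 0[ gamma2] &
            exists2 s, - a < s <= 0 & gamma1 s <> gamma2 s].
Proof.
exists (@OmegaC R), (@PhiC R); split.
  split.
  - exact: PhiC_classical.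
  - move=> OT; have : (@Sset R `&` @OmegaC R) (sing 0) by rewrite OT.
    have := boundaryE R; rewrite /boundary (interior_id _).1; last exact: open_OmegaC.
    by move=> bE [S0 O0]; have [] : (closure (@OmegaC R) `\` @OmegaC R) (sing 0) by rewrite bE; left; right.
  - by move=> p Op; rewrite Psi_PhiC// ltrN2 atan_ltpi2 ltrNl atan_gtNpi2.
  - by move=> p Op; rewrite Psi_PhiC//; exact: natanN4.
  - exact: metric_smooth_lorentzian.
split; first by split; [exact: PhiC_MGHD|exact: MGHD_unique].
exists (@Bset R), (@Sset R), (@Cset R), (metric_of (@zC R)), (@LextC R); split.
  split.
  - exact: boundaryE.
  - by split; [exact: BS_disjoint|exact: BC_disjoint|exact: SC_disjoint].
  - by split; [exact: submanifold_Bset|exact: submanifold_Sset|exact: submanifold_Cset].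
  - by split; [exact: connected_Bset|exact: connected_Sset|exact: connected_Cset].
  - exact: connected_boundary.
split; first by [].
split; first by split; [exact: closure_Cset|exact: closure_Bset].
split; first exact: PhiC_extends_C.
have holS p : Sset p -> exists U, open_nbhs p U /\ foot_holder 3 U.
  by move=> ->; exact: foot_holderS.
split.
  split.
  - move=> p /holS[U [pU UH]]; exists (@PhiC R); exact: PhiC_holder pU UH.
  - exact: PhiC_sharpS.
  - move=> p /foot_holderB[U [pU UH]]; exists (@PhiC R); exact: PhiC_holder pU UH.
  - exact: PhiC_sharpB.
  - exact: hessian_blowup.
split.
  split; split.
  - by move=> p /metric_PhiC.
  - by move=> p /holS[U [pU UH]]; exact: metric_extension pU UH.
  - by move=> p /foot_holderB[U [pU UH]]; exact: metric_extension pU UH.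
  - exact: metric_extends_C.
  - by move=> p _; exact: metric_lorentzian.
  - exact: LextC_L.
  - by move=> p /holS[U [pU UH]]; exact: LextC_extension pU UH.
  - by move=> p /foot_holderB[U [pU UH]]; exact: LextC_extension pU UH.
  - by move=> p _; exact: LextC_null.
split; last exact: two_integral_curves.
split.
- exact: tangent_C.
- exact: null_curve_C.
- exact: tangent_B.
- exact: null_curve_B.
Qed.
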